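(* Let $d\ge2$, $n=d-1$, and let $G=\mathrm{SO}(d,1)^0$ if $d>2$ and $G=\mathrm{SO}(2,1)\cong\mathrm{PGL}_2(\mathbb R)$ if $d=2$. For $\lambda,\mu,\nu\in\mathfrak a^*\cong\mathbb C$ imaginary, let $$\mathcal T_{\rm st}(\lambda,\mu,\nu)=\int_G\underline a(w_0n_0y)^{\lambda+\rho}\,\underline a(w_0y)^{\mu+\rho}\,\underline a(y)^{\nu+\rho}\,dy .$$ Then there is a positive constant, independent of $\lambda,\mu,\nu$, such that for all imaginary $\lambda,\mu,\nu$ the number $\mathcal T_{\rm st}(\lambda,\mu,\nu)$ equals this constant times $$\frac{\Gamma\left(\frac{2(\lambda+\mu-\nu)+n}4\right)\Gamma\left(\frac{2(\lambda-\mu+\nu)+n}4\right)\Gamma\left(\frac{2(-\lambda+\mu+\nu)+n}4\right)\Gamma\left(\frac{2(\lambda+\mu+\nu)+n}4\right)}{\Gamma\left(\frac{2\lambda+n}2\right)\Gamma\left(\frac{2\mu+n}2\right)\Gamma\left(\frac{2\nu+n}2\right)} .$$ In particular, for fixed imaginary $\mu$ and $\nu$, as $|\lambda|\to\infty$ with $\lambda$ imaginary, one has $$|\mathcal T_{\rm st}(\lambda,\mu,\nu)|=c\,\exp\left(-\frac\pi2|\lambda|\right)|\lambda|^{\frac d2-2}\left(1+O\left(\frac1{|\lambda|}\right)\right)$$ for some constant $c>0$.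
   Context: Let $J=\mathrm{diag}(1,\dots,1,-1)$ of size $d+1$; $\mathrm{SO}(d,1)$ is the group of real matrices $g$ of determinant $1$ with $g^tJg=J$, and $\mathrm{SO}(d,1)^0$ is its identity component. $K$ is the standard maximal compact subgroup ($K\cong\mathrm{SO}(d)$ acting on the first $d$ coordinates if $d>2$, $K\cong \mathrm O(2)$ if $d=2$). Let $H=E_{d,d+1}+E_{d+1,d}$ (matrix units), $A=\{\exp(tH):t\in\mathbb R\}$, and $N=\{n(x):x\in\mathbb R^{d-1}\}$, where, for $x$ a column vector, $$n(x)=\begin{pmatrix} I_{d-1} & -x & x \\ {x^t} & 1-\frac{|x|^2}2 & \frac{|x|^2}2 \\ {x^t} & -\frac{|x|^2}2 & 1+\frac{|x|^2}2 \end{pmatrix}.$$ Then $G=ANK$ (Iwasawa decomposition) and $\underline a:G\to A$ denotes the $A$-component, so $x\in\underline a(x)NK$. Let $w_0=\mathrm{diag}(1,\dots,1,-1,-1,1)$, a representative of the nontrivial Weyl group element, and $n_0=n(1,0,\dots,0)$. $dy$ is a Haar measure on $G$. $\mathfrak a$ is the complexified Lie algebra of $A$; $\mathfrak a^*$ is identified with $\mathbb C$ by $\lambda\mapsto\lambda(H)$, so $\exp(tH)^\lambda=e^{t\lambda}$; under this identification $\rho=\frac{d-1}2$ (where $a^{2\rho}=\det(a|\mathfrak n)$, $\mathfrak n$ the Lie algebra of $N$), ''imaginary'' means $\lambda\in i\mathbb R$, and $|\lambda|$ is the absolute value. The number $\mathcal T_{\rm st}(\lambda,\mu,\nu)$ is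 the value of the standard invariant trilinear form $\mathcal T_{\rm st}(f_1,f_2,f_3)=\int_Gf_1(w_0n_0y)f_2(w_0y)f_3(y)\,dy$ on the class one vectors $e_\lambda,e_\mu,e_\nu$ of the principal series, where $e_\lambda(ank)=a^{\lambda+\rho}$ for $a\in A$, $n\in N$, $k\in K$. The integral converges absolutely for imaginary parameters. *)

(* Defs.v *)
From HB Require Import structures.
From mathcomp Require Import all_boot all_order all_algebra.
From mathcomp Require Import all_classical all_reals all_analysis.
From mathcomp Require Import complex.

Set Implicit Arguments.
Unset Strict Implicit.
Unset Printing Implicit Defensive.

Import Order.TTheory GRing.Theory Num.Theory.
Import numFieldNormedType.Exports.

Local Open Scope classical_set_scope.
Local Open Scope ring_scope.
Local Open Scope complex_scope.

(* The dimension is written d = n + 1, so that matrices of size d + 1 have type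
   'M_(n + 1 + 1) and split into blocks of sizes n, 1 and 1. *)

Section ComplexAnalysis.
Variable R : realType.

Definition cexp (z : R[i]) : R[i] :=
  (expR (complex.Re z) * cos (complex.Im z)) +i*
  (expR (complex.Re z) * sin (complex.Im z)).

Definition cintegral d (T : measurableType d) (mu : {measure set T -> \bar R})
    (D : set T) (f : T -> R[i]) : R[i] :=
  (\int[mu]_(x in D) complex.Re (f x))%R +i*
  (\int[mu]_(x in D) complex.Im (f x))%R.

(* Euler's integral: this is the Gamma function on the half-plane 0 < Re z
   only (for the other z the integral diverges). *)
Definition cGamma (z : R[i]) : R[i] :=
  cintegral lebesgue_measure `]0, +oo[
    (fun t : R => cexp ((z - 1) * (ln t)%:C) * (expR (- t))%:C).

Definition imaginary (z : R[i]) : Prop := complex.Re z = 0.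

End ComplexAnalysis.

Section LorentzGroup.
Variables (R : realType) (n : nat).

Local Notation mx := 'M[R]_(n + 1 + 1).

Definition idx_d : 'I_(n + 1 + 1) := lshift 1 (rshift n ord0).
Definition idx_d1 : 'I_(n + 1 + 1) := rshift (n + 1) ord0.

Definition Jmx : mx := block_mx 1%:M 0 0 (- 1%:M).

Definition SOd1 : set mx := [set g | g^T *m Jmx *m g = Jmx /\ \det g = 1].

(* The identity component of SO(d,1) if d > 2, but all of SO(2,1) if d = 2. *)
Definition Ggrp : set mx :=
  if n == 1%N then SOd1 else connected_component SOd1 1%:M.

(* {diag(k, 1) : k in SO(d)} if d > 2, and {diag(k, det k) : k in O(2)},
   isomorphic to O(2), if d = 2. *)
Definition Kgrp : set mx :=
  [set g | exists k : 'M[R]_(n + 1),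
    [/\ k^T *m k = 1%:M,
        n <> 1%N -> \det k = 1 &
        g = block_mx k 0 0 (\det k)%:M]].

Definition Hmx : mx := delta_mx idx_d idx_d1 + delta_mx idx_d1 idx_d.

Definition expmx (M : mx) : mx :=
  limn (series (fun k => (k`!)%:R^-1 *: M ^+ k)).

Definition sqnorm (x : 'cV[R]_n) : R := \sum_i x i 0 ^+ 2.

Definition nmx (x : 'cV[R]_n) : mx :=
  block_mx
    (block_mx 1%:M (- x) x^T (1 - sqnorm x / 2)%:M)
    (col_mx x (sqnorm x / 2)%:M)
    (row_mx x^T (- (sqnorm x / 2))%:M)
    (1 + sqnorm x / 2)%:M.

(* diag(1, ..., 1, -1, -1, 1); rows and columns are numbered from 0 to n + 1. *)
Definition w0 : mx :=
  diag_mx (\row_(i < n + 1 + 1)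
    (if (i == n.-1 :> nat) || (i == n :> nat) then -1 else 1)).

Definition n0 : mx := nmx (\col_(i < n) (i == 0%N :> nat)%:R).

(* The real t such that g lies in exp(tH) N K, i.e. the A-component of g is
   exp(tH). It exists and is unique for g in G = ANK; 0 is a dummy value for
   the other matrices. *)
Definition logA (g : mx) : R :=
  xget 0 [set t | exists x k, Kgrp k /\ g = expmx (t *: Hmx) *m nmx x *m k].

(* The A-component of g raised to the power lam. *)
Definition powA (g : mx) (lam : R[i]) : R[i] := cexp ((logA g)%:C * lam).

Definition rho : R[i] := n%:R / 2.

Definition borelMx := g_sigma_algebraType (@open mx).

(* The Borel subsets of the closed subgroup G are the Borel sets of matrices
   contained in G, so a Haar measure on G is given by a Borel measure on
   matrices; its values outside G are irrelevant. *)
Definition is_haar (mu : {measure set borelMx -> \bar R}) : Prop :=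
  [/\ forall (g : mx) (B : set borelMx),
        Ggrp g -> measurable B -> B `<=` Ggrp ->
        mu [set g *m b | b in B] = mu B,
      forall C : set mx, compact C -> C `<=` Ggrp -> (mu C < +oo)%E &
      (0 < mu Ggrp)%E].

(* Rintegral is total, with value 0 when the integral is +oo. The formula of
   the theorem excludes this: the value at lam1 = lam2 = lam3 = 0, where the
   integrand is positive, is nonzero, and the absolute value of the integrand
   is the same for all imaginary parameters. *)
Definition Tst (mu : {measure set borelMx -> \bar R})
    (lam1 lam2 lam3 : R[i]) : R[i] :=
  cintegral mu Ggrp (fun y : mx =>
    powA (w0 *m n0 *m y) (lam1 + rho) *
    powA (w0 *m y) (lam2 + rho) *
    powA y (lam3 + rho)).

Definition gammaQuot (lam1 lam2 lam3 : R[i]) : R[i] :=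
  (cGamma ((2 * (lam1 + lam2 - lam3) + n%:R) / 4) *
   cGamma ((2 * (lam1 - lam2 + lam3) + n%:R) / 4) *
   cGamma ((2 * (- lam1 + lam2 + lam3) + n%:R) / 4) *
   cGamma ((2 * (lam1 + lam2 + lam3) + n%:R) / 4)) /
  (cGamma ((2 * lam1 + n%:R) / 2) *
   cGamma ((2 * lam2 + n%:R) / 2) *
   cGamma ((2 * lam3 + n%:R) / 2)).

End LorentzGroup.

(* Main.v *)
(** Let l1, l2, l3 be the logarithms of the A-components of w0 n0 y, w0 y and y.
    Multiply the integral by the three Gamma functions of the denominator, written
    as integrals of e^((rho + lambda_i) s_i - e^(s_i)) over the real line, and
    translate s_i by l_i. The factor exp (sum (rho + lambda_i) l_i) disappears and
    the variable y only occurs in exp (- sum e^(s_i - l_i)). As e^(-l1), e^(-l2)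
    and e^(-l3) are e^l + e^(-l) |x + e|^2, e^l + e^(-l) |x|^2 and e^(-l) in
    horospherical coordinates, with e the first basis vector, the y-integral is
    Gaussian in x and becomes a constant times a K-Bessel type integral
      int e^(- n q / 2 - e^q - e^(-q) (e^(s1+s2) + e^(s1+s3) + e^(s2+s3))) dq.
    In the linear coordinates q, s1 + s2 - q, s1 + s3 - q, s2 + s3 - q the
    integrand splits into the four Gamma densities of the numerator. The constant
    is positive and finite since the Haar measure is positive and locally finite.

    The Haar integral is reduced to Lebesgue integrals by Fubini's theorem on
    G times A and on G times N and the invariance under A and N. The asymptotics
    follow from Stirling's formula on vertical lines: up to O(1/b),
    ln |Gamma (a + ib)|^2 is c + (2a - 1) ln |b| - pi |b|. *)

Require Import Defs.
From HB Require Import structures.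
From mathcomp Require Import all_boot all_order all_algebra.
From mathcomp Require Import all_classical all_reals all_analysis.
From mathcomp Require Import complex.
From mathcomp Require Import measurable_realfun ring lra.

Set Implicit Arguments.
Unset Strict Implicit.
Unset Printing Implicit Defensive.

Import Order.TTheory GRing.Theory Num.Theory.
Import numFieldNormedType.Exports.

Local Open Scope classical_set_scope.
Local Open Scope ring_scope.
Local Open Scope complex_scope.

Section LebesgueAffine.
Variable R : realType.
Local Notation leb := (@lebesgue_measure R).

Definition affine (k c : R) : measurableTypeR R -> measurableTypeR R :=
  fun x => k * x + c.

Lemma measurable_affine (k c : R) : measurable_fun setT (affine k c).
Proof.
apply: continuous_measurable_fun => x; apply: cvgD; last exact: cvg_cst.
by apply: cvgM; [exact: cvg_cst|exact: cvg_id].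
Qed.

Lemma lebesgue_affine (k c : R) (A : set (measurableTypeR R)) :
  k != 0 -> measurable A ->
  leb A = (`|k|%:E * leb (affine k c @^-1` A))%E.
Proof.
move=> k0 mA.
apply: (@lebesgue_measure_unique _ (mscale (NngNum (normr_ge0 k)) (pushforward leb (affine k c)))) => //.
  exact: measurable_affine.
move=> ma _ [[a b]] _ <- /=.
transitivity (`|k|%:E * (if (a < b)%R then ((b - a) / `|k|)%:E else 0))%E.
  rewrite !lebesgue_measure_itv/= !lte_fin.
  case: ifPn => _; last by rewrite mule0.
  by rewrite -EFinB -EFinM mulrC divfK ?normr_eq0.
congr (_ * _)%E; case: (ltgtP k 0) => [kn|kp|k00]; last by rewrite k00 eqxx in k0.
- transitivity (leb `[((b - c) / k)%R, ((a - c) / k)%R[%classic)%E; last first.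
    congr (leb _)%E; apply/seteqP; split => x /=; rewrite /affine !in_itv/= ltr_ndivlMr//
      ler_ndivrMr// ltrBlDr lerBrDr (mulrC x) andbC//.
  rewrite !lebesgue_measure_itv/= !lte_fin ltr_nM2r ?invr_lt0// ltrD2r ltr0_norm//.
  case: ifPn => // _; rewrite -EFinB; congr _%:E.
  by field; rewrite lt_eqF.
- transitivity (leb `]((a - c) / k)%R, ((b - c) / k)%R]%classic)%E; last first.
    congr (leb _)%E; apply/seteqP; split => x /=; rewrite /affine !in_itv/= ltr_pdivrMr//
      ler_pdivlMr// ltrBlDr lerBrDr (mulrC x)//.
  rewrite !lebesgue_measure_itv/= !lte_fin ltr_pM2r ?invr_gt0// ltrBlDr subrK gtr0_norm//.
  case: ifPn => // _; rewrite -EFinB; congr _%:E.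
  by field; rewrite gt_eqF.
Qed.

Lemma ge0_integral_affine (k c : R) (f : R -> \bar R) : k != 0 ->
  measurable_fun setT f -> (forall x, 0 <= f x)%E ->
  (\int[leb]_x f x = `|k|%:E * \int[leb]_x f (k * x + c)%R)%E.
Proof.
move=> k0 mf f0.
apply: etrans.
  apply: (@eq_measure_integral _ _ _ _
    (mscale (NngNum (normr_ge0 k)) (pushforward leb (affine k c)))).
    exact: measurable_affine.
  by move=> ma A mA _; exact: lebesgue_affine.
rewrite ge0_integral_mscale//= ge0_integral_pushforward//.
exact: measurable_affine.
Qed.

Lemma ge0_integral_shift (c : R) (f : R -> \bar R) :
  measurable_fun setT f -> (forall x, 0 <= f x)%E ->
  (\int[leb]_x f (x + c)%R = \int[leb]_x f x)%E.
Proof.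
move=> mf f0; rewrite [RHS](@ge0_integral_affine 1 c)// normr1 mul1e.
by under [RHS]eq_integral do rewrite mul1r.
Qed.

Lemma ge0_integral_exp (f : R -> R) :
  {in `]0, +oo[, continuous f} -> (forall x, 0 < x -> 0 <= f x) ->
  (\int[leb]_(t in `]0%R, +oo[) (f t)%:E = \int[leb]_x (f (expR x) * expR x)%:E)%E.
Proof.
move=> cf f0.
pose e (i : nat) : set (measurableTypeR R) := `[- i%:R, i%:R]%classic.
pose E (i : nat) : set (measurableTypeR R) := `[expR (- i%:R), expR i%:R]%classic.
have bnd (x : R) : exists i : nat, `|x| <= i%:R.
  by exists (Num.truncn `|x|).+1; rewrite ltW// truncnS_gt.
have Eu : \bigcup_i E i = `]0, +oo[%classic.
  apply/seteqP; split => x; rewrite /E /= ?in_itv/=.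
    by move=> [i _]; rewrite /= in_itv/= => /andP[/(lt_le_trans (expR_gt0 _)) ->].
  rewrite andbT => x0; have [j] := bnd (ln x); rewrite ler_norml => /andP[h1 h2].
  exists j => //=; rewrite in_itv/=; apply/andP.
  by move: h1 h2; rewrite -[_ <= ln x]ler_expR -[ln x <= _]ler_expR lnK.
have eu : \bigcup_i e i = setT.
  apply/seteqP; split => x // _; have [j] := bnd x.
  by rewrite ler_norml => h; exists j => //=; rewrite in_itv.
have cfe : continuous (fun x => f (expR x) * expR x).
  move=> x; apply: cvgM; last exact: continuous_expR.
  apply: (@continuous_comp _ _ _ expR f); first exact: continuous_expR.
  by apply: cf; rewrite in_itv/= expR_gt0.
have ndE : nondecreasing_seq E.
  move=> i j ij; apply/subsetPset => x; rewrite /E/= !in_itv/= => /andP[h1 h2].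
  by rewrite (le_trans _ h1) ?(le_trans h2)// ler_expR ?lerN2 ler_nat.
have nde : nondecreasing_seq e.
  move=> i j ij; apply/subsetPset => x; rewrite /e/= !in_itv/= => /andP[h1 h2].
  by rewrite (le_trans _ h1) ?(le_trans h2)// ?lerN2 ler_nat.
have mf1 : measurable_fun (`]0%R, +oo[%classic : set R) f.
  apply: open_continuous_measurable_fun; first exact: interval_open.
  by move=> x; rewrite inE => /cf.
have C1 : (\int[leb]_(t in E i) (f t)%:E @[i --> \oo] --> \int[leb]_(t in `]0%R, +oo[) (f t)%:E)%E.
  rewrite -Eu; apply: ge0_nondecreasing_set_cvg_integral => //.
  - by move=> i; exact: measurable_itv.
  - move=> i; apply/measurable_EFinP; apply: measurable_funS mf1 => //.
    by rewrite -Eu; exact: bigcup_sup.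
  - move=> i x; rewrite /E/= in_itv/= => /andP[h _]; rewrite lee_fin f0//.
    exact: lt_le_trans (expR_gt0 _) h.
have C2 : (\int[leb]_(t in e i) (f (expR t) * expR t)%:E @[i --> \oo] --> \int[leb]_x (f (expR x) * expR x)%:E)%E.
  rewrite -eu; apply: ge0_nondecreasing_set_cvg_integral => //.
  - by move=> i; exact: measurable_itv.
  - move=> i; apply/measurable_EFinP; apply: measurable_funTS.
    exact: continuous_measurable_fun.
  - by move=> i x _; rewrite lee_fin mulr_ge0 ?expR_ge0 ?f0 ?expR_gt0.
apply: (cvg_unique _ C1); rewrite //.
apply: cvg_trans C2; apply: near_eq_cvg; near=> i.
have dE : derive1 (@expR R) = expR by apply/funext => x; rewrite derive1E derive_val.
have := @integration_by_substitution_increasing R expR f (- i%:R) i%:R.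
rewrite dE => ->//.
- by rewrite (@le_trans _ _ 0)// oppr_le0.
- by move=> x y _ _; rewrite ltr_expR.
- by move=> x _; exact: continuous_expR.
- apply/cvg_ex; exists (expR (- i%:R)); apply: cvg_at_right_filter; exact: continuous_expR.
- apply/cvg_ex; exists (expR (i%:R)); apply: cvg_at_left_filter; exact: continuous_expR.
- split=> //; [exact: (cvg_at_right_filter (@continuous_expR R _))|exact: (cvg_at_left_filter (@continuous_expR R _))].
- apply: continuous_in_subspaceT => x; rewrite inE /= in_itv/= => /andP[h _].
  by apply: cf; rewrite in_itv/= andbT (lt_le_trans _ h)// expR_gt0.
Unshelve. all: by end_near. Qed.

Lemma integral_exp (f : R -> R) : {in `]0, +oo[, continuous f} ->
  (\int[leb]_(t in `]0%R, +oo[) (f t)%:E = \int[leb]_x (f (expR x) * expR x)%:E)%E.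
Proof.
move=> cf; rewrite integralE [RHS]integralE; congr (_ - _)%E.
- transitivity (\int[leb]_(t in `]0%R, +oo[) (Num.max (f t) 0)%:E)%E.
    by apply: eq_integral => x _; rewrite funeposE EFin_max.
  rewrite ge0_integral_exp.
  + by apply: eq_integral => x _; rewrite funeposE -EFin_max maxr_pMl ?expR_ge0// mul0r.
  + by move=> x /cf cfx; apply: continuous_max => //; exact: cst_continuous.
  + by move=> x _; rewrite le_max lexx orbT.
- transitivity (\int[leb]_(t in `]0%R, +oo[) (Num.max (- f t) 0)%:E)%E.
    by apply: eq_integral => x _; rewrite funenegE EFin_max.
  rewrite (@ge0_integral_exp (fun t => Num.max (- f t) 0)).
  + by apply: eq_integral => x _; rewrite funenegE -EFinN -EFin_max maxr_pMl ?expR_ge0// mul0r mulNr.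
  + move=> x /cf cfx; apply: (@continuous_max _ _ (fun t => - f t) (cst 0)) => //; last exact: cst_continuous.
    exact: continuousN.
  + by move=> x _; rewrite le_max lexx orbT.
Qed.

Lemma integral_gauss_affine (al c : R) :
  (\int[leb]_x (expR (- (expR al * (x + c) ^+ 2)))%:E =
   (Num.sqrt pi * expR (- al / 2))%:E)%E.
Proof.
have k0 : 0 < expR (al / 2) := expR_gt0 _.
have := @ge0_integral_affine (expR (al / 2)) (expR (al / 2) * c)
  (fun x => (gauss_fun x)%:E) (lt0r_neq0 k0).
rewrite integralT_gauss => /(_ _ _)/wrap[].
- by apply/measurable_EFinP; exact: measurable_gauss_fun.
- by move=> x; rewrite lee_fin gauss_fun_ge0.
rewrite (_ : (fun x => _) = (fun x => (expR (- (expR al * (x + c) ^+ 2)))%:E)); last first.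
  apply/funext => x; rewrite /gauss_fun -mulrDr exprMn.
  rewrite (_ : expR (al / 2) ^+ 2 = expR al)//.
  by rewrite -expRM_natl mulrC divfK.
rewrite mulNr expRN EFinM gtr0_norm// => ->.
by rewrite muleAC -EFinM divff ?mul1e// gt_eqF.
Qed.

End LebesgueAffine.

(** * The Gamma function on vertical lines *)

Section GammaDensity.
Variable R : realType.
Local Notation leb := (@lebesgue_measure R).

Definition gammaD (a x : R) : R := expR (a * x - expR x).

Lemma gammaD_gt0 a x : 0 < gammaD a x. Proof. exact: expR_gt0. Qed.
Lemma gammaD_ge0 a x : 0 <= gammaD a x. Proof. exact: expR_ge0. Qed.

Lemma continuous_gammaD a : continuous (gammaD a).
Proof.
move=> x; apply: (@continuous_comp _ _ _ (fun x => a * x - expR x) expR); last first.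
  exact: continuous_expR.
apply: cvgB; last exact: continuous_expR.
by apply: cvgM; [exact: cvg_cst|exact: cvg_id].
Qed.

Lemma gammaD_bound a : 0 < a -> exists M : R, forall x, gammaD a x <= M / (1 + x ^+ 2).
Proof.
move=> a0; pose k := Num.min a 1.
have k0 : 0 < k by rewrite lt_min a0 ltr01.
have k1 : k <= 1 by rewrite ge_min lexx orbT.
have ka : k <= a by rewrite ge_min lexx.
have q0 (x : R) : 0 < 1 + x ^+ 2 by rewrite ltr_pwDl// sqr_ge0.
exists (2 / k ^+ 2 * expR ((a + 1) ^+ 2 / 2)) => x.
have h1 : gammaD a x <= expR ((a + 1) ^+ 2 / 2) * expR (- (k * `|x|)).
  rewrite -expRD ler_expR; have [x0|x0] := leP 0 x.
    rewrite ger0_norm//.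
    have := expR_ge1Dxn 1 x0; rewrite /= => h.
    have : k * x <= x by rewrite ler_piMl.
    have : 0 <= (x - (a + 1)) ^+ 2 by exact: sqr_ge0.
    move: h; rewrite (_ : 2`!%:R = 2 :> R)//; nra.
  rewrite ltr0_norm//.
  have : 0 <= (a + 1) ^+ 2 by exact: sqr_ge0.
  have := expR_gt0 x; nra.
apply: (le_trans h1); rewrite [leRHS]mulrAC [leRHS]mulrC ler_pM2l ?expR_gt0//.
rewrite expRN -ler_pV2 ?inE ?unitfE ?gt_eqF ?invr_gt0 ?expR_gt0 ?divr_gt0 ?exprn_gt0//=; last first.
rewrite invrK invfM invrK invf_div.
have y0 : 0 <= k * `|x| by rewrite mulr_ge0// ltW.
have := expR_ge1Dxn 1 y0; rewrite /= (_ : 2`!%:R = 2 :> R)// exprMn real_normK ?num_real//.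
have : k ^+ 2 <= 1 by rewrite expr_le1// ltW.
have := sqr_ge0 x.
have := sqr_ge0 k.
nra.
Qed.

Lemma integrable_oneDsqrV :
  leb.-integrable setT (EFin \o (fun x : R => (1 + x ^+ 2)^-1)).
Proof.
have co : continuous (fun x : R => (1 + x ^+ 2)^-1).
  move=> x; exact: (@continuous_oneDsqrV R x).
have o0 (x : R) : 0 <= (1 + x ^+ 2)^-1 by rewrite invr_ge0 addr_ge0// sqr_ge0.
apply/integrableP; split.
  by apply/measurable_EFinP; exact: continuous_measurable_fun.
under eq_integral do rewrite /= ger0_norm//.
rewrite ge0_symfun_integralT//; last by move=> x /=; rewrite sqrrN.
have -> : [set x : R | 0 <= x] = `[0, +oo[%classic by rewrite set_itvcy.
by rewrite integral0y_oneDsqr -EFinM ltry.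
Qed.

Lemma integrable_gammaD a : 0 < a -> leb.-integrable setT (EFin \o gammaD a).
Proof.
move=> a0; have [M HM] := gammaD_bound a0.
apply: (le_integrable _ _ _ (integrableZl _ M integrable_oneDsqrV)) => //.
  by apply/measurable_EFinP; exact: continuous_measurable_fun (@continuous_gammaD a).
move=> x _ /=; rewrite lee_fin (ger0_norm (gammaD_ge0 _ _)).
by apply: le_trans (HM x) _; rewrite ler_norm.
Qed.

Lemma integrable_gammaDM a (h : R -> R) : 0 < a -> continuous h ->
  (forall x, `|h x| <= 1) ->
  leb.-integrable setT (EFin \o (fun x => gammaD a x * h x)).
Proof.
move=> a0 ch h1; apply: le_integrable (integrable_gammaD a0) => //.
  apply/measurable_EFinP; apply: continuous_measurable_fun => x.
  by apply: cvgM; [exact: continuous_gammaD|exact: ch].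
move=> x _ /=; rewrite lee_fin normrM ler_piMr//.
Qed.

Lemma integral_deriv_eq0 (F f : R -> R) :
  (forall x : R, is_derive x (1 : R) F (f x)) -> continuous f ->
  leb.-integrable setT (EFin \o f) ->
  F n%:R @[n --> \oo] --> (0 : R) -> F (- n%:R) @[n --> \oo] --> (0 : R) ->
  \int[leb]_x (f x) = 0.
Proof.
move=> dF cf intf F1 F2.
pose fn (n : nat) : measurableTypeR R -> \bar R :=
  (EFin \o f) \_ (`[- n%:R, n%:R]%classic : set (measurableTypeR R)).
have C1 : (\int[leb]_x fn n x @[n --> \oo] --> \int[leb]_x (f x)%:E)%E.
  apply: (@dominated_cvg _ _ _ leb setT measurableT fn (EFin \o f) (fun x => `|(f x)%:E|)%E) => //.
  - move=> n; have mI : measurable (`[- n%:R, n%:R]%classic : set (measurableTypeR R)) by [].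
    have mf : measurable_fun setT (EFin \o f) by exact: (measurable_int leb).
    exact: (proj1 (measurable_restrictT _ mI) (measurable_funTS mf)).
  - move=> x _; apply: cvg_near_cst; near=> n.
    rewrite /fn patchT// inE/= in_itv/= -ler_norml.
    by near: n; exact: nbhs_infty_ger.
  - exact: integrable_abse.
  - by move=> n x _; rewrite /fn /patch; case: ifPn => //; rewrite abse0.
have C2 : (\int[leb]_x fn n x @[n --> \oo] --> 0%E)%E.
  apply: (@cvg_trans _ ((fun n : nat => (F n%:R - F (- n%:R))%:E) @ \oo)).
    apply: near_eq_cvg; near=> n.
    rewrite /fn -integral_mkcond.
    rewrite (@continuous_FTC2 _ f F)//.
    + rewrite (@lt_trans _ _ 0)// ?oppr_lt0 ltr0n; near: n; exact: nbhs_infty_gt.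
    + exact: continuous_subspaceT.
    + have cF x : {for x, continuous F}.
        by apply: differentiable_continuous; apply/derivable1_diffP; apply: ex_derive.
      split.
      * by move=> x _; apply: ex_derive.
      * by apply: cvg_at_right_filter; exact: cF.
      * by apply: cvg_at_left_filter; exact: cF.
    + by move=> x _; rewrite derive1E derive_val.
  apply: cvg_EFin; first by near=> n.
  rewrite -[0](subr0 0); exact: cvgB.
by rewrite /Rintegral (cvg_unique _ C1 C2).
Unshelve. all: by end_near. Qed.

Definition gammaC (a b : R) : R := \int[leb]_x (gammaD a x * cos (b * x)).
Definition gammaS (a b : R) : R := \int[leb]_x (gammaD a x * sin (b * x)).
Definition gammaR (a : R) : R := \int[leb]_x gammaD a x.

Lemma continuous_cosM (b : R) : continuous (fun x : R => cos (b * x)).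
Proof.
move=> x; apply: (@continuous_comp _ _ _ (fun x => b * x) (@cos R)).
  by apply: cvgM; [exact: cvg_cst|exact: cvg_id].
exact: continuous_cos.
Qed.

Lemma continuous_sinM (b : R) : continuous (fun x : R => sin (b * x)).
Proof.
move=> x; apply: (@continuous_comp _ _ _ (fun x => b * x) (@sin R)).
  by apply: cvgM; [exact: cvg_cst|exact: cvg_id].
exact: continuous_sin.
Qed.

Lemma integrable_gammaC a b : 0 < a ->
  leb.-integrable setT (EFin \o (fun x => gammaD a x * cos (b * x))).
Proof.
move=> a0; apply: integrable_gammaDM => //; first exact: continuous_cosM.
by move=> x; exact: cos_max.
Qed.

Lemma integrable_gammaS a b : 0 < a ->
  leb.-integrable setT (EFin \o (fun x => gammaD a x * sin (b * x))).
Proof.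
move=> a0; apply: integrable_gammaDM => //; first exact: continuous_sinM.
by move=> x; exact: sin_max.
Qed.

Lemma gammaDS a x : gammaD (a + 1) x = gammaD a x * expR x.
Proof. by rewrite /gammaD -expRD mulrDl mul1r addrAC. Qed.

Lemma gammaDM_cvg0 a (h : R -> R) : 0 < a -> (forall x, `|h x| <= 1) ->
  gammaD a n%:R * h n%:R @[n --> \oo] --> (0 : R) /\
  gammaD a (- n%:R) * h (- n%:R) @[n --> \oo] --> (0 : R).
Proof.
move=> a0 h1; have [M HM] := gammaD_bound a0.
have M0 : 0 <= M.
  have := HM 0; rewrite expr0n addr0 divr1; apply: le_trans; exact: gammaD_ge0.
have bnd (n : nat) (x : R) : `|x| = n%:R -> `|gammaD a x * h x| <= 2 * M * harmonic n.
  move=> xn; rewrite normrM (ger0_norm (gammaD_ge0 _ _)).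
  apply: (@le_trans _ _ (gammaD a x)); first by rewrite ler_piMr// gammaD_ge0.
  apply: (le_trans (HM x)); rewrite -real_normK ?num_real// xn /harmonic /=.
  rewrite ler_pdivrMr ?ltr_pwDl ?sqr_ge0// mulrAC ler_pdivlMr ?ltr0n//.
  rewrite mulrAC -mulrA mulrC -subr_ge0 (_ : _ - _ =  M * (2 + 2 * n%:R ^+ 2 - n.+1%:R)); last by ring.
  apply: mulr_ge0 => //; rewrite -addn1 natrD.
  have := sqr_ge0 (n%:R - 1 : R); have := ler0n R n; nra.
have H : 2 * M * harmonic n @[n --> \oo] --> (0 : R).
  by rewrite -[0](mulr0 (2 * M)); apply: cvgM; [exact: cvg_cst|exact: cvg_harmonic].
by split; apply/norm_cvg0P; apply: (squeeze_cvgr _ (cvg_cst 0) H);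
  near=> n; rewrite normr_ge0 bnd// ?normrN ger0_norm.
Unshelve. all: by end_near. Qed.

Lemma is_derive_gammaD a x : is_derive x (1 : R) (gammaD a) (a * gammaD a x - gammaD (a + 1) x).
Proof.
rewrite gammaDS /gammaD; apply: is_derive_eq.
by rewrite /GRing.scale /=; ring.
Qed.

Lemma gamma_shift a b (h g : R -> R) : 0 < a ->
  (forall x : R, is_derive x (1 : R) h (b * g x)) -> continuous h -> continuous g ->
  (forall x, `|h x| <= 1) -> (forall x, `|g x| <= 1) ->
  \int[leb]_x (gammaD (a + 1) x * h x) =
  a * \int[leb]_x (gammaD a x * h x) + b * \int[leb]_x (gammaD a x * g x).
Proof.
move=> a0 dh ch cg h1 g1.
have a10 : 0 < a + 1 by rewrite addr_gt0.
have Ih := integrable_gammaDM a0 ch h1.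
have Ig := integrable_gammaDM a0 cg g1.
have Ih' := integrable_gammaDM a10 ch h1.
have cM c k : continuous k -> continuous (fun x => gammaD c x * k x).
  by move=> ck x; apply: cvgM; [exact: continuous_gammaD|exact: ck].
pose f x := a * (gammaD a x * h x) + b * (gammaD a x * g x) - gammaD (a + 1) x * h x.
have [F1 F2] := gammaDM_cvg0 a0 h1.
have If1 : leb.-integrable setT (EFin \o (fun x => a * (gammaD a x * h x))) := integrableZl measurableT a Ih.
have If2 : leb.-integrable setT (EFin \o (fun x => b * (gammaD a x * g x))) := integrableZl measurableT b Ig.
have If12 : leb.-integrable setT (EFin \o (fun x => a * (gammaD a x * h x) + b * (gammaD a x * g x))) := integrableD measurableT If1 If2.
have cf : continuous f.
  move=> x; apply: cvgB; last exact: cM.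
  by apply: cvgD; (apply: cvgM; [exact: cvg_cst|exact: cM]).
have If : leb.-integrable setT (EFin \o f) := integrableB measurableT If12 Ih'.
have := @integral_deriv_eq0 (fun x => gammaD a x * h x) f _ cf If F1 F2.
rewrite /f RintegralB// RintegralD// !RintegralZl// => /(_ _)/wrap[]; last by move/subr0_eq.
move=> x; have dg := is_derive_gammaD a x; have dhx := dh x.
apply: is_derive_eq; rewrite /GRing.scale /= /f; ring.
Qed.

Lemma gammaCS a b : 0 < a -> gammaC (a + 1) b = a * gammaC a b - b * gammaS a b.
Proof.
move=> a0; rewrite -mulNr.
apply: (@gamma_shift a (- b) (fun x => cos (b * x)) (fun x => sin (b * x))) => //.
- by move=> x; apply: is_derive_eq; rewrite /GRing.scale /=; ring.
- exact: continuous_cosM.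
- exact: continuous_sinM.
- by move=> x; exact: cos_max.
- by move=> x; exact: sin_max.
Qed.

Lemma gammaSS a b : 0 < a -> gammaS (a + 1) b = a * gammaS a b + b * gammaC a b.
Proof.
move=> a0.
apply: (@gamma_shift a b (fun x => sin (b * x)) (fun x => cos (b * x))) => //.
- by move=> x; apply: is_derive_eq; rewrite /GRing.scale /=; ring.
- exact: continuous_sinM.
- exact: continuous_cosM.
- by move=> x; exact: sin_max.
- by move=> x; exact: cos_max.
Qed.

Lemma gammaC0 a : gammaC a 0 = gammaR a.
Proof.
by rewrite /gammaC; apply: eq_Rintegral => x _; rewrite mul0r cos0 mulr1.
Qed.

Lemma gammaRS a : 0 < a -> gammaR (a + 1) = a * gammaR a.
Proof. by move=> a0; rewrite -!gammaC0 gammaCS// mul0r subr0. Qed.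

Lemma gammaR_gt0 a : 0 < a -> 0 < gammaR a.
Proof.
move=> a0.
have Ia := integrable_gammaD a0.
have lb : expR (- expR 1) <= gammaR a.
  rewrite /gammaR -lee_fin /Rintegral fineK ?integrable_fin_num//.
  apply: (@le_trans _ _ (\int[leb]_(x in `[0%R, 1%R]) (expR (- expR 1))%:E)%E).
    by rewrite integral_cst//= lebesgue_measure_itv/= lte_fin ltr01 oppr0 adde0 mule1.
  apply: (@le_trans _ _ (\int[leb]_(x in `[0%R, 1%R]) (gammaD a x)%:E)%E).
    apply: ge0_le_integral => //.
    - by apply/measurable_EFinP; apply: measurable_funTS; exact: continuous_measurable_fun (@continuous_gammaD a).
    - move=> x; rewrite /= in_itv/= => /andP[x0 x1]; rewrite lee_fin ler_expR.
      have : expR x <= expR 1 by rewrite ler_expR.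
      have : 0 <= a * x by rewrite mulr_ge0// ltW.
      by lra.
  apply: ge0_subset_integral => //.
  - by apply/measurable_EFinP; exact: continuous_measurable_fun (@continuous_gammaD a).
  - by move=> x _; rewrite lee_fin gammaD_ge0.
by apply: lt_le_trans lb; exact: expR_gt0.
Qed.

Definition gammaN (a b : R) : R := gammaC a b ^+ 2 + gammaS a b ^+ 2.

Lemma gammaNS a b : 0 < a -> gammaN (a + 1) b = (a ^+ 2 + b ^+ 2) * gammaN a b.
Proof. by move=> a0; rewrite /gammaN gammaCS// gammaSS//; ring. Qed.

Lemma le_at0_deriv (F f : R -> R) : (forall x : R, is_derive x (1 : R) F (f x)) ->
  (forall x, 0 <= x -> 0 <= f x) -> forall x, 0 <= x -> F 0 <= F x.
Proof.
move=> dF f0 x x0.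
have cF y : {for y, continuous F}.
  by apply: differentiable_continuous; apply/derivable1_diffP; apply: ex_derive.
have [|c] := @MVT_segment R F f 0 x x0 (fun y _ => dF y).
  by apply: continuous_subspaceT => y; exact: cF.
rewrite in_itv/= => /andP[c0 _] h.
by rewrite -subr_ge0 h subr0 mulr_ge0// f0.
Qed.

Lemma sin_le (x : R) : 0 <= x -> sin x <= x.
Proof.
move=> x0.
have dF (y : R) : is_derive y (1 : R) (fun x => x - sin x) (1 - cos y) by apply: is_derive_eq.
have f0 (y : R) : 0 <= y -> 0 <= 1 - cos y by move=> _; rewrite subr_ge0 cos_le1.
by have := le_at0_deriv dF f0 x0; rewrite sin0 subr0 subr_ge0.
Qed.

Lemma cosB_ge (x : R) : 1 - x ^+ 2 / 2 <= cos x.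
Proof.
wlog x0 : x / 0 <= x => [hw|].
  have [/hw//|xn] := leP 0 x; have := hw (- x); rewrite cosN sqrrN; apply.
  by rewrite oppr_ge0 ltW.
have dF (y : R) : is_derive y (1 : R) (fun x => cos x + x ^+ 2 / 2) (y - sin y).
  by apply: is_derive_eq; rewrite /GRing.scale /=; field.
have f0 (y : R) : 0 <= y -> 0 <= y - sin y by move=> y0; rewrite subr_ge0 sin_le.
by have := le_at0_deriv dF f0 x0; rewrite cos0 expr0n/= mul0r addr0 lerBlDr.
Qed.

Lemma cosh_ge (x : R) : 2 + x ^+ 2 <= expR x + expR (- x).
Proof.
wlog x0 : x / 0 <= x => [hw|].
  have [/hw//|xn] := leP 0 x; have := hw (- x); rewrite opprK sqrrN (addrC (expR (- x))); apply.
  by rewrite oppr_ge0 ltW.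
have dF1 (y : R) : is_derive y (1 : R) (fun x => expR x - expR (- x) - 2 * x) (expR y + expR (- y) - 2).
  by apply: is_derive_eq; rewrite /GRing.scale /=; ring.
have h1 (y : R) : 0 <= y -> 0 <= expR y + expR (- y) - 2.
  by move=> _; have := expR_ge1Dx y; have := expR_ge1Dx (- y); lra.
have h2 (y : R) : 0 <= y -> 0 <= expR y - expR (- y) - 2 * y.
  by move=> y0; have := le_at0_deriv dF1 h1 y0; rewrite oppr0 subrr mulr0 subr0.
have dF2 (y : R) : is_derive y (1 : R) (fun x => expR x + expR (- x) - x ^+ 2) (expR y - expR (- y) - 2 * y).
  by apply: is_derive_eq; rewrite /GRing.scale /=; ring.
by have := le_at0_deriv dF2 h2 x0; rewrite oppr0 expR0 expr0n/= subr0 lerBrDr.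
Qed.

Lemma sqr_dot_unit_le (C S c s : R) : c ^+ 2 + s ^+ 2 = 1 ->
  (C * c + S * s) ^+ 2 <= C ^+ 2 + S ^+ 2.
Proof.
move=> cs; rewrite -subr_ge0 (_ : _ - _ = (C * s - S * c) ^+ 2) ?sqr_ge0//.
by rewrite -[C ^+ 2 + S ^+ 2]mulr1 -cs; ring.
Qed.

Lemma gammaN_le a b : 0 < a -> gammaN a b <= gammaR a ^+ 2.
Proof.
move=> a0; pose r := Num.sqrt (gammaN a b).
have N0 : 0 <= gammaN a b by rewrite addr_ge0// sqr_ge0.
have r2 : r ^+ 2 = gammaN a b by rewrite sqr_sqrtr.
have r0 : 0 <= r := sqrtr_ge0 _.
have IC := integrable_gammaC b a0; have IS := integrable_gammaS b a0.
have Ia := integrable_gammaD a0.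
have I1 : leb.-integrable setT (EFin \o (fun x => gammaC a b * (gammaD a x * cos (b * x)))) := integrableZl measurableT _ IC.
have I2 : leb.-integrable setT (EFin \o (fun x => gammaS a b * (gammaD a x * sin (b * x)))) := integrableZl measurableT _ IS.
have I3 : leb.-integrable setT (EFin \o (fun x => gammaC a b * (gammaD a x * cos (b * x)) + gammaS a b * (gammaD a x * sin (b * x)))) := integrableD measurableT I1 I2.
have I4 : leb.-integrable setT (EFin \o (fun x => r * gammaD a x)) := integrableZl measurableT _ Ia.
have : gammaN a b <= r * gammaR a.
  rewrite /gammaN !expr2 {1}/gammaC {1}/gammaS.
  rewrite ![(Rintegral _ _ _) * _]mulrC -!RintegralZl// -RintegralD//.
  apply: le_Rintegral => // x _.
  rewrite !(mulrCA _ (gammaD a x)) -mulrDr [leRHS]mulrC ler_pM2l ?gammaD_gt0//.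
  rewrite -/(gammaC a b) -/(gammaS a b).
  apply: (le_trans (ler_norm _)); rewrite -ler_sqr ?nnegrE// ?real_normK ?num_real//.
  by rewrite r2; apply: sqr_dot_unit_le; exact: cos2Dsin2.
rewrite -r2 expr2 => h.
have [->|rn] := eqVneq r 0; first by rewrite mul0r sqr_ge0.
have rp : 0 < r by rewrite lt_neqAle eq_sym rn.
move: h; rewrite ler_pM2l// => h; nra.
Qed.

Lemma gammaN_ge a b : 1 < a -> b ^+ 2 <= 2 * (a - 1) ->
  gammaR a ^+ 2 * (1 - b ^+ 2 / (2 * (a - 1))) ^+ 2 <= gammaN a b.
Proof.
move=> a1 ba; have a0 : 0 < a by rewrite (lt_trans _ a1).
have am0 : 0 < a - 1 by rewrite subr_gt0.
pose th := b * ln a.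
have IC := integrable_gammaC b a0; have IS := integrable_gammaS b a0.
have Ia := integrable_gammaD a0.
have aS0 : 0 < a + 1 by rewrite addr_gt0.
have IaS := integrable_gammaD aS0.
have Iam := integrable_gammaD am0.
have I1 : leb.-integrable setT (EFin \o (fun x => cos th * (gammaD a x * cos (b * x)))) := integrableZl measurableT _ IC.
have I2 : leb.-integrable setT (EFin \o (fun x => sin th * (gammaD a x * sin (b * x)))) := integrableZl measurableT _ IS.
have I3 : leb.-integrable setT (EFin \o (fun x => cos th * (gammaD a x * cos (b * x)) + sin th * (gammaD a x * sin (b * x)))) := integrableD measurableT I1 I2.
have J1 : leb.-integrable setT (EFin \o (fun x => (1 + b ^+ 2) * gammaD a x)) := integrableZl measurableT _ Ia.
have J2 : leb.-integrable setT (EFin \o (fun x => (b ^+ 2 / 2 / a) * gammaD (a + 1) x)) := integrableZl measurableT _ IaS.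
have J3 : leb.-integrable setT (EFin \o (fun x => (b ^+ 2 / 2 * a) * gammaD (a - 1) x)) := integrableZl measurableT _ Iam.
have J4 : leb.-integrable setT (EFin \o (fun x => (1 + b ^+ 2) * gammaD a x - (b ^+ 2 / 2 / a) * gammaD (a + 1) x)) := integrableB measurableT J1 J2.
have J5 : leb.-integrable setT (EFin \o (fun x => (1 + b ^+ 2) * gammaD a x - (b ^+ 2 / 2 / a) * gammaD (a + 1) x - (b ^+ 2 / 2 * a) * gammaD (a - 1) x)) := integrableB measurableT J4 J3.
have G1 : gammaR a = (a - 1) * gammaR (a - 1) by rewrite -gammaRS// subrK.
have H : gammaR a * (1 - b ^+ 2 / (2 * (a - 1))) <= cos th * gammaC a b + sin th * gammaS a b.
  rewrite [leLHS](_ : _ = (1 + b ^+ 2) * gammaR a - (b ^+ 2 / 2 / a) * gammaR (a + 1) - (b ^+ 2 / 2 * a) * gammaR (a - 1)); last first.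
    by rewrite gammaRS// G1; field; rewrite !gt_eqF.
  rewrite /gammaR -!RintegralZl// -!RintegralB// -RintegralD//.
  apply: le_Rintegral => // x _.
  have -> : gammaD (a - 1) x = gammaD a x * expR (- x).
    by rewrite -[in RHS](subrK 1 a) gammaDS -mulrA -expRD subrr expR0 mulr1.
  rewrite gammaDS [leLHS](_ : _ = gammaD a x * (1 - b ^+ 2 / 2 * (expR x / a + a * expR (- x) - 2))); last first.
    by field; rewrite gt_eqF.
  rewrite !(mulrCA _ (gammaD a x)) -mulrDr ler_pM2l ?gammaD_gt0//.
  have := cosB_ge (b * (x - ln a)); rewrite mulrBr cosB -/th -mulrBr exprMn.
  rewrite (mulrC (cos (b * x))) (mulrC (sin (b * x))); apply: le_trans.
  have := cosh_ge (x - ln a); rewrite opprB !expRB lnK// (expRN x) => h.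
  rewrite lerB// mulrAC ler_wpM2l// ?divr_ge0 ?sqr_ge0//.
  by rewrite lerBrDl.
have H0 : 0 <= gammaR a * (1 - b ^+ 2 / (2 * (a - 1))).
  apply: mulr_ge0; first exact/ltW/gammaR_gt0.
  by rewrite subr_ge0 ler_pdivrMr ?mul1r// mulr_gt0.
rewrite -exprMn; move: H H0; set u := gammaR a * _ => uC u0.
apply: le_trans (sqr_dot_unit_le (gammaC a b) (gammaS a b) (cos2Dsin2 th)).
by rewrite ler_sqr ?nnegrE// 1?mulrC 1?(mulrC (gammaS _ _))// (le_trans u0).
Qed.

End GammaDensity.

(** * Stirling asymptotics *)

Section Stirling.
Variable R : realType.

Lemma ln1D_ge (u : R) : -1 < u -> u / (1 + u) <= ln (1 + u).
Proof.
move=> u1; have p : 0 < 1 + u by lra.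
rewrite -lerN2 -[leLHS]lnV ?posrE// [X in ln X](_ : _ = 1 + - (u / (1 + u))); last by field; lra.
apply: le_ln1Dx; rewrite ltrN2 ltr_pdivrMr//; lra.
Qed.

Lemma ln1D_abs (u : R) : - (1 / 2) <= u -> `|ln (1 + u)| <= 2 * `|u|.
Proof.
move=> u1; have p : 0 < 1 + u by lra.
have h1 : ln (1 + u) <= u by apply: le_ln1Dx; lra.
have h2 : u / (1 + u) <= ln (1 + u) by apply: ln1D_ge; lra.
have [u0|u0] := leP 0 u.
  have : 0 <= u / (1 + u) by rewrite divr_ge0// ltW.
  move=> h3; rewrite !ger0_norm ?(le_trans h3)//; lra.
have h3 : 2 * u <= u / (1 + u) by rewrite ler_pdivlMr//; nra.
rewrite !ler0_norm ?(le_trans h1)//; lra.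
Qed.

Definition lnsq_prim (b x : R) : R :=
  x * ln (x ^+ 2 + b ^+ 2) - 2 * x + 2 * b * atan (x / b).

Lemma sqrD_gt0 (b x : R) : 0 < b -> 0 < x ^+ 2 + b ^+ 2.
Proof. by move=> b0; rewrite ltr_wpDl ?sqr_ge0// exprn_gt0. Qed.

Lemma is_derive_lnsq_prim (b x : R) : 0 < b ->
  is_derive x (1 : R) (lnsq_prim b) (ln (x ^+ 2 + b ^+ 2)).
Proof.
move=> b0; have q0 := sqrD_gt0 x b0.
have d1 : is_derive x (1 : R) (fun x => x ^+ 2 + b ^+ 2) (2 * x).
  by apply: is_derive_eq; rewrite /GRing.scale /=; ring.
have d2 : is_derive x (1 : R) (fun x => ln (x ^+ 2 + b ^+ 2)) ((x ^+ 2 + b ^+ 2)^-1 * (2 * x)).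
  have d3 := @is_derive1_comp R (@ln R) (fun x => x ^+ 2 + b ^+ 2) x _ _ (is_derive1_ln q0) d1.
  by apply: is_derive_eq.
have d4 : is_derive x (1 : R) (fun x => x / b) (b^-1).
  by apply: is_derive_eq; rewrite /GRing.scale /=; ring.
have d5 := @is_derive1_comp R (@atan R) (fun x => x / b) x _ _ (is_derive1_atan _) d4.
rewrite /lnsq_prim; apply: is_derive_eq.
rewrite /GRing.scale /=; field.
rewrite gt_eqF// gt_eqF// addrC; exact: sqrD_gt0.
Qed.

Lemma lnsq_midpoint (b c : R) : 1 <= b ->
  `|lnsq_prim b (c + 1 / 2) - lnsq_prim b (c - 1 / 2) - ln (c ^+ 2 + b ^+ 2)|
   <= (c ^+ 2 + b ^+ 2)^-1.
Proof.
move=> b1; have b0 : 0 < b by lra.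
pose Q := c ^+ 2 + b ^+ 2.
have Q1 : 1 <= Q by rewrite /Q; have := sqr_ge0 c; nra.
have Q0 : 0 < Q by lra.
pose phi d := lnsq_prim b (c + d) - lnsq_prim b (c - d) - 2 * d * ln Q.
pose f d := ln ((c + d) ^+ 2 + b ^+ 2) + ln ((c - d) ^+ 2 + b ^+ 2) - 2 * ln Q.
have dphi (d : R) : is_derive d (1 : R) phi (f d).
  have d1 : is_derive d (1 : R) (fun d => c + d) 1.
    have := is_deriveD (is_derive_cst c d (1 : R)) (is_derive_id d (1 : R)).
    by rewrite add0r.
  have d2 : is_derive d (1 : R) (fun d => c - d) (- 1).
    have := is_deriveB (is_derive_cst c d (1 : R)) (is_derive_id d (1 : R)).
    by rewrite sub0r.
  have d3 := @is_derive1_comp R (lnsq_prim b) (fun d => c + d) d _ _ (is_derive_lnsq_prim _ b0) d1.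
  have d4 := @is_derive1_comp R (lnsq_prim b) (fun d => c - d) d _ _ (is_derive_lnsq_prim _ b0) d2.
  rewrite /phi; apply: is_derive_eq.
  by rewrite /f /GRing.scale /=; ring.
have cphi : {within `[0, 1 / 2], continuous phi}.
  apply: continuous_subspaceT => y.
  by apply: differentiable_continuous; apply/derivable1_diffP; apply: ex_derive.
have h0 : (0 : R) <= 1 / 2 by lra.
have [xi] := @MVT_segment R phi f 0 (1 / 2) h0 (fun y _ => dphi y) cphi.
rewrite in_itv/= => /andP[x0 x1].
rewrite {2}/phi addr0 subr0 subrr mulr0 mul0r !subr0 => E.
have -> : lnsq_prim b (c + 1 / 2) - lnsq_prim b (c - 1 / 2) - ln Q = phi (1 / 2).
  by rewrite /phi; field.
rewrite E /f.
have p1 := sqrD_gt0 (c + xi) b0; have p2 := sqrD_gt0 (c - xi) b0.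
pose u := (2 * Q * xi ^+ 2 + xi ^+ 4 - 4 * c ^+ 2 * xi ^+ 2) / Q ^+ 2.
have -> : ln ((c + xi) ^+ 2 + b ^+ 2) + ln ((c - xi) ^+ 2 + b ^+ 2) - 2 * ln Q = ln (1 + u).
  rewrite -lnM ?posrE// mulr_natl -lnXn// -ln_div ?posrE ?mulr_gt0 ?exprn_gt0//.
  by congr ln; rewrite /u /Q; field; rewrite -/Q gt_eqF.
have x2 : xi ^+ 2 <= 1 / 4 by nra.
have x2' : 0 <= xi ^+ 2 by exact: sqr_ge0.
have cQ : c ^+ 2 <= Q by rewrite /Q lerDl sqr_ge0.
have c0 : 0 <= c ^+ 2 by exact: sqr_ge0.
have uh : - (2 * Q)^-1 <= u.
  rewrite /u ler_pdivlMr ?exprn_gt0// (_ : - _ * _ = - (Q / 2)); last by field; rewrite gt_eqF.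
  rewrite (_ : xi ^+ 4 = (xi ^+ 2) ^+ 2); last by ring.
  by move: (xi ^+ 2) (c ^+ 2) x2 x2' cQ c0 => X C x2 x2' cQ c0; nra.
have ul : u <= Q^-1.
  rewrite /u ler_pdivrMr ?exprn_gt0// (_ : Q^-1 * _ = Q); last by field; rewrite gt_eqF.
  rewrite (_ : xi ^+ 4 = (xi ^+ 2) ^+ 2); last by ring.
  by move: (xi ^+ 2) (c ^+ 2) x2 x2' cQ c0 => X C x2 x2' cQ c0; nra.
have Qi : Q^-1 <= 1 by rewrite invf_le1.
have Qi0 : 0 < Q^-1 by rewrite invr_gt0.
have uh' : - (Q^-1 / 2) <= u by move: uh; rewrite invfM mulrC.
have un : `|u| <= Q^-1 by rewrite ler_norml ul andbT; lra.
have h : `|ln (1 + u)| <= 2 * `|u| by apply: ln1D_abs; lra.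
rewrite -/Q normrM [X in _ * X]ger0_norm//; lra.
Qed.

Lemma sum_inv_sqrD (a b : R) (N : nat) : 0 < a -> 2 <= b ->
  \sum_(k < N) ((a + k%:R) ^+ 2 + b ^+ 2)^-1 <= 4 / b.
Proof.
move=> a0 b2.
have H : \sum_(k < N) ((a + k%:R) ^+ 2 + b ^+ 2)^-1 <= 2 / (b - 1) - 2 / (b + N%:R - 1).
  elim: N => [|N IH]; first by rewrite big_ord0 addr0 subrr.
  rewrite big_ord_recr /=.
  have N0 : 0 <= N%:R :> R by [].
  apply: (le_trans (lerD IH (_ : _ <= 2 / (b + N%:R - 1) - 2 / (b + N.+1%:R - 1)))); last by lra.
  rewrite -[N.+1]addn1 natrD; set n := N%:R in N0 *.
  rewrite (_ : 2 / _ - _ = 2 / ((b + n - 1) * (b + n))); last by field; apply/andP; split; rewrite gt_eqF//; lra.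
  have p1 : 0 < (b + n - 1) * (b + n) by rewrite mulr_gt0//; lra.
  rewrite -[leLHS]div1r ler_pdivrMr; last by apply: sqrD_gt0; lra.
  rewrite mulrAC ler_pdivlMr// mul1r.
  have := sqr_ge0 (b - n); nra.
apply: (le_trans H).
have : 0 <= 2 / (b + N%:R - 1) by rewrite divr_ge0//; have := ler0n R N; lra.
have : 2 / (b - 1) <= 4 / b.
  rewrite ler_pdivrMr; last lra.
  rewrite mulrAC ler_pdivlMr; lra.
lra.
Qed.

Lemma sum_lnsq (a b : R) (N : nat) : 0 < a -> 2 <= b ->
  `|\sum_(k < N) ln ((a + k%:R) ^+ 2 + b ^+ 2)
    - (lnsq_prim b (a + N%:R - 1 / 2) - lnsq_prim b (a - 1 / 2))| <= 4 / b.
Proof.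
move=> a0 b2.
apply: le_trans (sum_inv_sqrD N a0 b2).
elim: N => [|N IH]; first by rewrite !big_ord0 addr0 subrr subr0 normr0.
rewrite !big_ord_recr /=.
have b1 : 1 <= b by lra.
have := lnsq_midpoint (a + N%:R) b1.
rewrite distrC.
have -> : a + N.+1%:R - 1 / 2 = a + N%:R + 1 / 2 by rewrite -addn1 natrD; field.
move: IH; set s := \sum_(_ < _) _; set t := \sum_(_ < _) _.
set h1 := lnsq_prim b (a + N%:R - 1 / 2); set h2 := lnsq_prim b (a + N%:R + 1 / 2).
set l := ln _; set h0 := lnsq_prim b (a - 1 / 2) => IH1 IH2.
rewrite (_ : s + l - (h2 - h0) = (s - (h1 - h0)) + (l - (h2 - h1))); last by ring.
by apply: (le_trans (ler_normD _ _)); exact: lerD.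
Qed.

Lemma gammaN_gt0 (a b : R) : 0 < a -> 0 < gammaN a b.
Proof.
move=> a0.
suff H (N : nat) : 0 < gammaN (a + N%:R) b -> 0 < gammaN a b.
  pose N := (Num.truncn (b ^+ 2)).+2.
  have hN : b ^+ 2 + 1 < N%:R.
    by rewrite /N -natr1 ltrD2r truncnS_gt.
  apply: (H N).
  have b20 := sqr_ge0 b.
  have aN : 1 < a + N%:R by lra.
  have p : 0 < 2 * (a + N%:R - 1) by lra.
  apply: lt_le_trans (gammaN_ge aN _); last by lra.
  apply: mulr_gt0; rewrite exprn_gt0//; first by apply: gammaR_gt0; lra.
  by rewrite subr_gt0 ltr_pdivrMr// mul1r; lra.
elim: N => [|N IH]; first by rewrite addr0.
move=> h; apply: IH; move: h; have aN : 0 < a + N%:R by rewrite ltr_wpDr.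
rewrite -[N.+1]addn1 natrD addrA gammaNS// pmulr_rgt0//.
by rewrite ltr_pwDl ?sqr_ge0// exprn_gt0.
Qed.

Lemma ln_gammaN_shift (a b : R) (N : nat) : 0 < a -> 0 < b ->
  ln (gammaN a b) = ln (gammaN (a + N%:R) b) - \sum_(k < N) ln ((a + k%:R) ^+ 2 + b ^+ 2).
Proof.
move=> a0 b0; elim: N => [|N IH]; first by rewrite big_ord0 addr0 subr0.
have aN : 0 < a + N%:R by rewrite ltr_wpDr.
rewrite big_ord_recr/= -[N.+1]addn1 natrD addrA gammaNS// lnM ?posrE ?gammaN_gt0//; last exact: sqrD_gt0.
by rewrite IH; ring.
Qed.

Lemma ln_gammaN_near (a b : R) : 1 < a -> b ^+ 2 <= a - 1 ->
  `|ln (gammaN a b) - 2 * ln (gammaR a)| <= 2 * b ^+ 2 / (a - 1).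
Proof.
move=> a1 ba; have a0 : 0 < a by lra.
have am : 0 < a - 1 by lra.
have G0 := gammaR_gt0 a0; have N0 := gammaN_gt0 b a0.
have E : 2 * ln (gammaR a) = ln (gammaR a ^+ 2) by rewrite lnXn// mulr_natl.
have up : ln (gammaN a b) <= 2 * ln (gammaR a).
  by rewrite E ler_ln ?posrE ?exprn_gt0//; exact: gammaN_le.
set v := b ^+ 2 / (2 * (a - 1)).
have v0 : 0 <= v by rewrite divr_ge0 ?sqr_ge0//; lra.
have v1 : v <= 1 / 2 by rewrite /v ler_pdivrMr; lra.
have lo : 2 * ln (gammaR a) + 2 * ln (1 + - v) <= ln (gammaN a b).
  have p : 0 < 1 + - v by lra.
  rewrite E [2 * ln (1 + - v)]mulr_natl -lnXn// -lnM ?posrE ?exprn_gt0//.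
  rewrite ler_ln ?posrE ?mulr_gt0 ?exprn_gt0//; apply: gammaN_ge => //; lra.
have h := @ln1D_abs (- v); rewrite normrN (ger0_norm v0) in h.
have {h} : `|ln (1 + - v)| <= 2 * v by apply: h; lra.
rewrite ler_norml => /andP[h1 h2].
rewrite ler0_norm; last by lra.
rewrite (_ : 2 * b ^+ 2 / (a - 1) = 4 * v); last by rewrite /v; field; lra.
lra.
Qed.

Lemma lnsq_prim_pinfty (b eps : R) : 0 < b -> 0 < eps ->
  \forall x \near +oo, `|lnsq_prim b x - pi * b - (2 * x * ln x - 2 * x)| <= eps.
Proof.
move=> b0 e0.
have C : \forall t \near +oo, `|pi / 2 - @atan R t| < eps / (4 * b).
  have /cvgrPdist_lt := @cvgy_atan R; apply; rewrite divr_gt0// mulr_gt0//.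
have [A [_ HA]] := C.
near=> x.
have x0 : 0 < x by near: x; exact: nbhs_pinfty_gt.
have E : lnsq_prim b x - pi * b - (2 * x * ln x - 2 * x) =
    x * ln (1 + b ^+ 2 / x ^+ 2) - 2 * b * (pi / 2 - atan (x / b)).
  have -> : ln (1 + b ^+ 2 / x ^+ 2) = ln (x ^+ 2 + b ^+ 2) - 2 * ln x.
    rewrite mulr_natl -lnXn// -ln_div ?posrE ?exprn_gt0 ?sqrD_gt0//.
    by congr ln; field; rewrite gt_eqF.
  by rewrite /lnsq_prim; field.
have b20 : 0 <= b ^+ 2 / x ^+ 2 by rewrite divr_ge0 ?sqr_ge0.
have h1 : `|x * ln (1 + b ^+ 2 / x ^+ 2)| <= b ^+ 2 / x.
  rewrite ger0_norm; last by rewrite mulr_ge0 ?ln_ge0 ?lerDl// ltW.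
  rewrite (_ : b ^+ 2 / x = x * (b ^+ 2 / x ^+ 2)); last by field; rewrite gt_eqF.
  by rewrite ler_pM2l//; apply: le_ln1Dx; apply: lt_le_trans b20; lra.
have x1 : 2 * b ^+ 2 / eps < x by near: x; apply: nbhs_pinfty_gt; exact: num_real.
have x2 : A * b < x by near: x; apply: nbhs_pinfty_gt; exact: num_real.
have h2 : b ^+ 2 / x <= eps / 2.
  by move: x1; rewrite ltr_pdivrMr// => x1; rewrite ler_pdivrMr//; lra.
have h3 : `|2 * b * (pi / 2 - atan (x / b))| <= eps / 2.
  have b2 : 0 < 2 * b by rewrite mulr_gt0.
  rewrite normrM (gtr0_norm b2) -ler_pdivlMl//.
  rewrite (_ : _^-1 * _ = eps / (4 * b)); last by field; rewrite gt_eqF.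
  by apply/ltW/HA; rewrite ltr_pdivlMr.
rewrite E; apply: (le_trans (ler_normB _ _)); lra.
Unshelve. all: by end_near. Qed.

(* Comparing with the parameter a + N, N tending to infinity, through the
   functional equation shows that this depends on b only up to O(1/b). *)
Definition stirlingD (a b : R) := ln (gammaN a b) - lnsq_prim b (a - 1 / 2) + pi * b.

Lemma stirlingD_near (a b eps : R) : 0 < a -> 2 <= b -> 0 < eps ->
  \forall N \near \oo, `|stirlingD a b - (2 * ln (gammaR (a + N%:R))
    - (2 * (a + N%:R - 1 / 2) * ln (a + N%:R - 1 / 2) - 2 * (a + N%:R - 1 / 2)))| <= 4 / b + eps.
Proof.
move=> a0 b2 e0; have b0 : 0 < b by lra.
have e20 : 0 < eps / 2 by lra.
have [A [_ HA]] := lnsq_prim_pinfty b0 e20.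
near=> N.
have N1 : A + 1 / 2 < N%:R by near: N; exact: nbhs_infty_gtr.
have N2 : b ^+ 2 + 1 < N%:R by near: N; exact: nbhs_infty_gtr.
have N3 : 4 * b ^+ 2 / eps + 1 < N%:R by near: N; exact: nbhs_infty_gtr.
have b20 := sqr_ge0 b.
have aN1 : 1 < a + N%:R by lra.
have bN : b ^+ 2 <= a + N%:R - 1 by lra.
have h1 := ln_gammaN_near aN1 bN.
have h1' : 2 * b ^+ 2 / (a + N%:R - 1) <= eps / 2.
  rewrite ler_pdivrMr; last lra.
  have : 4 * b ^+ 2 / eps < a + N%:R - 1 by lra.
  by rewrite ltr_pdivrMr//; lra.
have AN : A < a + N%:R - 1 / 2 by lra.
have h2 := HA _ AN.
have h3 := sum_lnsq N a0 b2.
rewrite /stirlingD (ln_gammaN_shift N a0 b0).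
move: h1 h2 h3.
set S := \sum_(_ < _) _; set L1 := ln (gammaN _ _); set L2 := ln (gammaR _).
set H := 2 * (a + N%:R - 1 / 2) * _ - _; set h0 := lnsq_prim b (a - 1 / 2).
set hN := lnsq_prim b _ => h1 h2 h3.
rewrite (_ : L1 - S - h0 + pi * b - (2 * L2 - H) =
  (L1 - 2 * L2) - (hN - pi * b - H) - (S - (hN - h0))); last by ring.
apply: (le_trans (ler_normB _ _)).
have := ler_normB (L1 - 2 * L2) (hN - pi * b - H).
lra.
Unshelve. all: by end_near. Qed.

Lemma stirlingD_cauchy (a b b' : R) : 0 < a -> 2 <= b -> 2 <= b' ->
  stirlingD a b - 4 / b <= stirlingD a b' + 4 / b'.
Proof.
move=> a0 b2 b2'; apply/ler_addgt0Pr => eps e0.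
have e20 : 0 < eps / 2 by lra.
near \oo => N.
have h1 : `|stirlingD a b - (2 * ln (gammaR (a + N%:R))
    - (2 * (a + N%:R - 1 / 2) * ln (a + N%:R - 1 / 2) - 2 * (a + N%:R - 1 / 2)))| <= 4 / b + eps / 2.
  by near: N; exact: stirlingD_near.
have h2 : `|stirlingD a b' - (2 * ln (gammaR (a + N%:R))
    - (2 * (a + N%:R - 1 / 2) * ln (a + N%:R - 1 / 2) - 2 * (a + N%:R - 1 / 2)))| <= 4 / b' + eps / 2.
  by near: N; exact: stirlingD_near.
move: h1 h2; rewrite !ler_norml => /andP[_ h1] /andP[h2 _]; lra.
Unshelve. all: by end_near. Qed.

Lemma atan_sub_le (t : R) : `|atan t - t| <= `|t| ^+ 3.
Proof.
wlog t0 : t / 0 <= t => [hw|].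
  have [/hw//|tn] := leP 0 t; have := hw (- t).
  rewrite atanN -opprD !normrN; apply; rewrite oppr_ge0 ltW//.
have dF (x : R) : is_derive x (1 : R) (fun t => t - atan t) (1 - (1 + x ^+ 2)^-1).
  by apply: is_derive_eq.
have q (x : R) : 0 < 1 + x ^+ 2 by rewrite ltr_pwDl ?sqr_ge0.
have f0 (x : R) : 0 <= x -> 0 <= 1 - (1 + x ^+ 2)^-1.
  by move=> _; rewrite subr_ge0 invf_le1// lerDl sqr_ge0.
have dG (x : R) : is_derive x (1 : R) (fun t => t ^+ 3 - (t - atan t)) (3 * x ^+ 2 - (1 - (1 + x ^+ 2)^-1)).
  by apply: is_derive_eq; rewrite /GRing.scale /=; ring.
have g0 (x : R) : 0 <= x -> 0 <= 3 * x ^+ 2 - (1 - (1 + x ^+ 2)^-1).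
  move=> _; rewrite (_ : _ - _ = (2 * x ^+ 2 + 3 * (x ^+ 2) ^+ 2) / (1 + x ^+ 2)); last first.
    by field; rewrite gt_eqF.
  have := sqr_ge0 x => x20.
  by rewrite divr_ge0 ?(ltW (q _))// addr_ge0// mulr_ge0// sqr_ge0.
have h1 := le_at0_deriv dF f0 t0; have h2 := le_at0_deriv dG g0 t0.
rewrite /= atan0 subrr in h1; rewrite /= atan0 expr0n/= !subrr in h2.
rewrite distrC !ger0_norm//; lra.
Qed.

Lemma gammaN_norm (a b : R) : 0 < a -> gammaN a `|b| = gammaN a b.
Proof.
move=> a0; have [b0|b0] := leP 0 b; first by rewrite ger0_norm.
have C : gammaC a (- b) = gammaC a b.
  by apply: eq_Rintegral => x _; rewrite mulNr cosN.
have S : gammaS a (- b) = - gammaS a b.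
  rewrite -[RHS]mulN1r /gammaS -RintegralZl//; last exact: integrable_gammaS.
  by apply: eq_Rintegral => x _; rewrite mulNr sinN mulrN mulN1r.
by rewrite ltr0_norm// /gammaN C S sqrrN.
Qed.

Lemma stirling (a : R) : 0 < a -> exists c C : R, forall b : R, 2 <= `|b| ->
  `|ln (gammaN a b) - (c + (2 * a - 1) * ln `|b| - pi * `|b|)| <= C / `|b|.
Proof.
move=> a0.
pose E := [set x | exists b, 2 <= b /\ x = stirlingD a b - 4 / b].
have E2 : E (stirlingD a 2 - 4 / 2) by exists 2.
have hs : has_sup E.
  split; first by eexists; exact: E2.
  by exists (stirlingD a 2 + 4 / 2) => x [b [b2 ->]]; exact: stirlingD_cauchy.
pose y := a - 1 / 2.
exists (sup E), (4 + 3 * `|y| ^+ 3) => b0.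
rewrite -gammaN_norm//.
move: (`|b0|) => b b2.
have b0' : 0 < b by lra.
have h1 : stirlingD a b - 4 / b <= sup E by apply: sup_ubound; [case: hs|exists b].
have h2 : sup E <= stirlingD a b + 4 / b.
  by apply: ge_sup; [case: hs|move=> x [b' [b2' ->]]; exact: stirlingD_cauchy].
have E1 : lnsq_prim b y = 2 * y * ln b + y * ln (1 + y ^+ 2 / b ^+ 2) + 2 * b * (atan (y / b) - y / b).
  have -> : ln (1 + y ^+ 2 / b ^+ 2) = ln (y ^+ 2 + b ^+ 2) - 2 * ln b.
    rewrite mulr_natl -lnXn// -ln_div ?posrE ?exprn_gt0 ?sqrD_gt0//.
    by congr ln; field; rewrite gt_eqF.
  by rewrite /lnsq_prim; field; rewrite gt_eqF.
have yb : 0 <= y ^+ 2 / b ^+ 2 by rewrite divr_ge0 ?sqr_ge0.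
have yn : `|y| ^+ 2 = y ^+ 2 by rewrite real_normK ?num_real.
have y30 : 0 <= `|y| ^+ 3 by rewrite exprn_ge0.
have ib : (b ^+ 2)^-1 <= b^-1.
  rewrite lef_pV2 ?posrE ?exprn_gt0//; nra.
have b1 : `|y * ln (1 + y ^+ 2 / b ^+ 2)| <= `|y| ^+ 3 / b.
  rewrite normrM (@ger0_norm _ (ln _)); last by rewrite ln_ge0 // lerDl.
  apply: (@le_trans _ _ (`|y| * (y ^+ 2 / b ^+ 2))).
    by rewrite ler_wpM2l//; apply: le_ln1Dx; apply: lt_le_trans yb; lra.
  by rewrite -yn mulrA -exprS ler_wpM2l.
have b2' : `|2 * b * (atan (y / b) - y / b)| <= 2 * `|y| ^+ 3 / b.
  rewrite normrM gtr0_norm ?mulr_gt0//.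
  apply: (@le_trans _ _ (2 * b * (`|y / b| ^+ 3))).
    by rewrite ler_wpM2l ?atan_sub_le// mulr_ge0// ltW.
  rewrite normrM normfV (gtr0_norm b0') (_ : _ * _ = 2 * `|y| ^+ 3 * (b ^+ 2)^-1); last by field; rewrite gt_eqF.
  by rewrite ler_wpM2l// mulr_ge0.
have b3 := ler_normD (y * ln (1 + y ^+ 2 / b ^+ 2)) (2 * b * (atan (y / b) - y / b)).
have h3 : `|stirlingD a b - sup E| <= 4 / b by rewrite ler_distl; apply/andP; split; lra.
have -> : ln (gammaN a b) - (sup E + (2 * a - 1) * ln b - pi * b) =
    (stirlingD a b - sup E) + (y * ln (1 + y ^+ 2 / b ^+ 2) + 2 * b * (atan (y / b) - y / b)).
  rewrite (_ : 2 * a - 1 = 2 * y); last by rewrite /y; field.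
  by rewrite /stirlingD -/y E1; ring.
apply: (le_trans (ler_normD _ _)).
rewrite [leRHS]mulrDl; lra.
Qed.

End Stirling.

(** * Coordinates on the Lorentz group *)

Section MatrixTopology.
Variables (R : realType) (p q : nat).

Lemma mx_cvgP (T : Type) (F : set_system T) (FF : Filter F) (f : T -> 'M[R]_(p, q)) (M : 'M[R]_(p, q)) :
  (forall i j, f x i j @[x --> F] --> M i j) -> f x @[x --> F] --> M.
Proof.
move=> H A /= [P MP sPA].
have : \forall x \near F, forall i j, P i j (f x i j).
  apply: filter_forall => i; apply: filter_forall => j.
  exact: (H i j _ (MP i j)).
by apply: filterS => x Hx; exact: sPA.
Qed.

Lemma mx_continuous (T : topologicalType) (f : T -> 'M[R]_(p, q)) :
  (forall i j, continuous (fun x => f x i j)) -> continuous f.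
Proof. by move=> H x; apply: mx_cvgP => i j; exact: H. Qed.

End MatrixTopology.

Section Group.
Variables (R : realType) (n : nat).
Local Notation mx := 'M[R]_(n + 1 + 1).
Local Notation ld := (idx_d n).
Local Notation ll := (idx_d1 n).
Definition emb (i : 'I_n) : 'I_(n + 1 + 1) := lshift 1 (lshift 1 i).

Lemma big_idx (F : 'I_(n + 1 + 1) -> R) :
  \sum_i F i = \sum_(i < n) F (emb i) + F ld + F ll.
Proof. by rewrite big_split_ord big_split_ord/= !big_ord1. Qed.

Lemma idx_ind (P : 'I_(n + 1 + 1) -> Prop) :
  (forall i, P (emb i)) -> P ld -> P ll -> forall i, P i.
Proof.
move=> h1 h2 h3 i; case: (split_ordP i) => k ->; last by rewrite ord1.
by case: (split_ordP k) => m ->; [exact: h1|rewrite ord1].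
Qed.

Lemma mulmx_idx (g y : mx) i j :
  (g *m y) i j = \sum_(k < n) g i (emb k) * y (emb k) j + g i ld * y ld j + g i ll * y ll j.
Proof. by rewrite mxE big_idx. Qed.

Lemma emb_neq_ll i : (emb i == ll) = false.
Proof. exact: eq_lrshift. Qed.

Lemma emb_neq_ld i : (emb i == ld) = false.
Proof. by rewrite /emb /idx_d eq_lshift eq_lrshift. Qed.

Lemma ld_neq_ll : (ld == ll) = false.
Proof. exact: eq_lrshift. Qed.

Lemma JmxE : Jmx R n = diag_mx (\row_i (if i == ll then -1 else 1)).
Proof.
apply/matrixP => i j; rewrite [RHS]mxE /Jmx.
case: (split_ordP i) => a ->; case: (split_ordP j) => b ->; rewrite ?eq_lrshift ?eq_rlshift ?eq_lshift ?eq_rshift ?ord1 ?eqxx.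
- by rewrite block_mxEul !mxE eq_lrshift.
- by rewrite block_mxEur mxE mulr0n.
- by rewrite block_mxEdl mxE mulr0n.
- by rewrite block_mxEdr !mxE !eqxx !mulr1n.
Qed.

Lemma Jmx_entry i j : Jmx R n i j = (if i == ll then -1 else 1) *+ (i == j).
Proof. by rewrite JmxE !mxE. Qed.

Lemma trJmul (g y : mx) i j : (g^T *m Jmx R n *m y) i j =
  \sum_(k < n) g (emb k) i * y (emb k) j + g ld i * y ld j - g ll i * y ll j.
Proof.
rewrite JmxE -mulmxA mulmx_idx mul_diag_mx !mxE ld_neq_ll eqxx mul1r mulN1r mulrN.
by congr (_ + _ - _); apply: eq_bigr => k _; rewrite !mxE emb_neq_ll mul1r.
Qed.

Lemma mulJtr (g y : mx) i j : (g *m Jmx R n *m y^T) i j =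
  \sum_(k < n) g i (emb k) * y j (emb k) + g i ld * y j ld - g i ll * y j ll.
Proof.
have := trJmul g^T y^T i j; rewrite trmxK => ->; rewrite !mxE.
by congr (_ + _ - _); apply: eq_bigr => k _; rewrite !mxE.
Qed.

Lemma JmxJ : Jmx R n *m Jmx R n = 1%:M.
Proof.
rewrite JmxE; apply/matrixP => i j; rewrite mul_diag_mx !mxE.
by case: (i == ll); case: (i == j); rewrite ?mulr1n ?mulr0n ?mulr0 ?mulrNN ?mulr1.
Qed.

Definition Oform (g : mx) := g^T *m Jmx R n *m g = Jmx R n.

Lemma OformM g h : Oform g -> Oform h -> Oform (g *m h).
Proof.
by rewrite /Oform => Hg Hh; rewrite trmx_mul -!mulmxA (mulmxA _ g h) (mulmxA _ (_ *m _) h) (mulmxA g^T) Hg mulmxA.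
Qed.

Lemma Oform1 : Oform 1%:M.
Proof. by rewrite /Oform trmx1 mul1mx mulmx1. Qed.

Lemma OformV g : Oform g -> (Jmx R n *m g^T *m Jmx R n) *m g = 1%:M.
Proof. by rewrite /Oform => Hg; rewrite -!mulmxA (mulmxA g^T) Hg JmxJ. Qed.

Lemma OformT g : Oform g -> g *m Jmx R n *m g^T = Jmx R n.
Proof.
move=> Hg; have /mulmx1C := OformV Hg.
rewrite !mulmxA => /(congr1 (fun M => M *m Jmx R n)).
by rewrite -!mulmxA JmxJ mulmx1 mul1mx.
Qed.

Lemma Oform_det g : Oform g -> \det g ^+ 2 = 1.
Proof.
move=> /(congr1 (fun M => \det M)); rewrite !det_mulmx det_tr => h.
have J0 : \det (Jmx R n) != 0.
  have := congr1 (fun M => \det M) JmxJ; rewrite det_mulmx det1 => h1.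
  by apply/eqP => h0; move: h1; rewrite h0 mul0r => /eqP; rewrite eq_sym oner_eq0.
by apply: (mulIf J0); rewrite mul1r expr2 -[RHS]h mulrAC.
Qed.

Definition cdif (y : mx) : R := y ll ll - y ld ll.
Definition csum (y : mx) : R := y ll ll + y ld ll.
Definition lheight (y : mx) : R := - ln `|cdif y|.
Definition hcoord (i : 'I_n) (y : mx) : R := y (emb i) ll / cdif y.

Lemma cdif_csum y : Oform y ->
  cdif y * csum y = 1 + \sum_(i < n) y (emb i) ll ^+ 2.
Proof.
move=> Hy; have := trJmul y y ll ll; rewrite Hy JmxE !mxE eqxx mulr1n /cdif /csum => h.
under [in RHS]eq_bigr do rewrite expr2.
by apply: (addrI (-1)); rewrite addrA addNr add0r; move: h; set S := \sum_(_ < _) _; lra.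
Qed.

Lemma cdif_neq0 y : Oform y -> cdif y != 0.
Proof.
move=> Hy; apply/eqP => h; have := cdif_csum Hy; rewrite h mul0r => /esym/eqP.
by rewrite gt_eqF// ltr_pwDl// sumr_ge0// => i _; exact: sqr_ge0.
Qed.

Lemma norm_cdif y : Oform y -> `|cdif y| = expR (- lheight y).
Proof. by move=> Hy; rewrite /lheight opprK lnK// posrE normr_gt0 cdif_neq0. Qed.

Lemma norm_csum y : Oform y -> `|csum y| =
  expR (lheight y) + expR (- lheight y) * \sum_(i < n) hcoord i y ^+ 2.
Proof.
move=> Hy; have c0 := cdif_neq0 Hy.
have -> : csum y = (1 + \sum_(i < n) y (emb i) ll ^+ 2) / cdif y.
  by rewrite -cdif_csum// mulrAC divff// mul1r.
rewrite normrM normfV norm_cdif// -expRN opprK ger0_norm; last first.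
  by rewrite addr_ge0// sumr_ge0// => i _; exact: sqr_ge0.
rewrite mulrDl mul1r; congr (_ + _).
rewrite mulr_suml mulr_sumr; apply: eq_bigr => i _.
rewrite /hcoord exprMn exprVn -[cdif y ^+ 2]real_normK ?num_real// norm_cdif//.
rewrite -expRM_natl -expRN mulrCA -expRD mulrC.
by rewrite mulrC; congr (_ * expR _); lra.
Qed.

Lemma delta_mulE (a b : 'I_(n + 1 + 1)) (y : mx) i j :
  (delta_mx a b *m y) i j = if i == a then y b j else 0.
Proof.
rewrite mxE (bigD1 b)//= big1 ?addr0 ?mxE ?eqxx.
  by case: eqP; rewrite ?mul1r ?mul0r.
by move=> k kb; rewrite mxE (negbTE kb) andbF mul0r.
Qed.

Lemma nmxE (x : 'cV[R]_n) :
  [/\ forall i k, nmx x (emb i) (emb k) = (i == k)%:R,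
      forall i, nmx x (emb i) ld = - x i 0 /\ nmx x (emb i) ll = x i 0,
      forall k, nmx x ld (emb k) = x k 0 /\ nmx x ll (emb k) = x k 0,
      nmx x ld ld = 1 - sqnorm x / 2 /\ nmx x ld ll = sqnorm x / 2 &
      nmx x ll ld = - (sqnorm x / 2) /\ nmx x ll ll = 1 + sqnorm x / 2].
Proof.
pose blkE := (@block_mxEul R, @block_mxEur R, @block_mxEdl R, @block_mxEdr R,
  @col_mxEu R, @col_mxEd R, @row_mxEl R, @row_mxEr R).
rewrite /nmx /emb /idx_d /idx_d1; split => [i k|i|k||]; rewrite !blkE ?mxE ?eqxx ?mulr1n//.
Qed.

Lemma nmx_mul_emb x (y : mx) i j :
  (nmx x *m y) (emb i) j = y (emb i) j + x i 0 * (y ll j - y ld j).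
Proof.
have [h1 h2 _ _ _] := nmxE x.
rewrite mulmx_idx (bigD1 i)//= big1 ?addr0 => [|k ki]; last by rewrite h1 eq_sym (negbTE ki) mul0r.
by rewrite h1 eqxx mul1r (h2 i).1 (h2 i).2; ring.
Qed.

Lemma nmx_mul_ld x (y : mx) j : (nmx x *m y) ld j =
  \sum_(k < n) x k 0 * y (emb k) j + (1 - sqnorm x / 2) * y ld j + sqnorm x / 2 * y ll j.
Proof.
have [_ _ h3 h4 _] := nmxE x.
by rewrite mulmx_idx h4.1 h4.2; congr (_ + _ + _); apply: eq_bigr => k _; rewrite (h3 k).1.
Qed.

Lemma nmx_mul_ll x (y : mx) j : (nmx x *m y) ll j =
  \sum_(k < n) x k 0 * y (emb k) j - sqnorm x / 2 * y ld j + (1 + sqnorm x / 2) * y ll j.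
Proof.
have [_ _ h3 _ h5] := nmxE x.
by rewrite mulmx_idx h5.1 h5.2 mulNr; congr (_ + _ + _); apply: eq_bigr => k _; rewrite (h3 k).2.
Qed.

Lemma sqnorm0 : sqnorm (0 : 'cV[R]_n) = 0.
Proof. by rewrite /sqnorm big1// => i _; rewrite mxE expr0n. Qed.

Lemma nmx0 : nmx (0 : 'cV[R]_n) = 1%:M.
Proof.
rewrite /nmx sqnorm0 mul0r subr0 addr0 !oppr0 trmx0 raddf0.
by rewrite !col_mx0 row_mx0 -!scalar_mx_block.
Qed.

Lemma nmxD (x x' : 'cV[R]_n) : nmx x *m nmx x' = nmx (x + x').
Proof.
have [h1 h2 h3 h4 h5] := nmxE x'.
have [g1 g2 g3 g4 g5] := nmxE (x + x').
have sD : sqnorm (x + x') = sqnorm x + sqnorm x' + 2 * \sum_k x k 0 * x' k 0.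
  rewrite /sqnorm mulr_sumr -!big_split/=; apply: eq_bigr => k _.
  by rewrite !mxE; ring.
have sE (k : 'I_n) : \sum_(i < n) x i 0 * nmx x' (emb i) (emb k) = x k 0.
  rewrite (bigD1 k)//= big1 ?addr0 ?h1 ?eqxx ?mulr1// => i ik.
  by rewrite h1 (negbTE ik) mulr0.
have sN : \sum_(i < n) x i 0 * nmx x' (emb i) ld = - \sum_k x k 0 * x' k 0.
  by rewrite -sumrN; apply: eq_bigr => i _; rewrite (h2 i).1 mulrN.
have sP : \sum_(i < n) x i 0 * nmx x' (emb i) ll = \sum_k x k 0 * x' k 0.
  by apply: eq_bigr => i _; rewrite (h2 i).2.
have [h41 h42] := h4; have [h51 h52] := h5.
apply/matrixP => i j; move: i; apply: idx_ind => [i||]; move: j; apply: idx_ind => [j||].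
- by rewrite nmx_mul_emb h1 g1 (h3 j).1 (h3 j).2 subrr mulr0 addr0.
- by rewrite nmx_mul_emb (h2 i).1 (g2 i).1 h41 h51 mxE; ring.
- by rewrite nmx_mul_emb (h2 i).2 (g2 i).2 h42 h52 mxE; ring.
- by rewrite nmx_mul_ld sE (g3 j).1 (h3 j).1 (h3 j).2 mxE; ring.
- by rewrite nmx_mul_ld sN g4.1 h41 h51 sD; field.
- by rewrite nmx_mul_ld sP g4.2 h42 h52 sD; field.
- by rewrite nmx_mul_ll sE (g3 j).2 (h3 j).1 (h3 j).2 mxE; ring.
- by rewrite nmx_mul_ll sN g5.1 h41 h51 sD; field.
- by rewrite nmx_mul_ll sP g5.2 h42 h52 sD; field.
Qed.

Lemma Oform_nmx x : Oform (nmx x).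
Proof.
have [h1 h2 h3 [h41 h42] [h51 h52]] := nmxE x.
have eqC (i k : 'I_n) : (i == k)%:R = (k == i)%:R :> R by rewrite eq_sym.
have sE (k : 'I_n) (f : 'I_n -> R) : \sum_(i < n) nmx x (emb i) (emb k) * f i = f k.
  rewrite (bigD1 k)//= big1 ?addr0 ?h1 ?eqxx ?mul1r// => i ik.
  by rewrite h1 (negbTE ik) mul0r.
have sE' (k : 'I_n) (f : 'I_n -> R) : \sum_(i < n) f i * nmx x (emb i) (emb k) = f k.
  by rewrite -[RHS](sE k); apply: eq_bigr => i _; rewrite mulrC.
have snn (f g : 'I_n -> R) : (forall i, f i * g i = x i 0 ^+ 2) -> \sum_(i < n) f i * g i = sqnorm x.
  by move=> H; apply: eq_bigr => i _; exact: H.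
have snN (f g : 'I_n -> R) : (forall i, f i * g i = - x i 0 ^+ 2) -> \sum_(i < n) f i * g i = - sqnorm x.
  by move=> H; rewrite -sumrN; apply: eq_bigr => i _; exact: H.
apply/matrixP => i j; rewrite trJmul Jmx_entry.
move: i; apply: idx_ind => [i||]; move: j; apply: idx_ind => [j||].
- by rewrite sE h1 !(h3 i).1 !(h3 i).2 (h3 j).1 (h3 j).2 emb_neq_ll !eq_lshift addrK; case: eqP.
- by rewrite (sE i (fun k => nmx x (emb k) ld)) !(h3 i).1 !(h3 i).2 (h2 i).1 h41 h51 emb_neq_ld mulr0n; ring.
- by rewrite (sE i (fun k => nmx x (emb k) ll)) !(h3 i).1 !(h3 i).2 (h2 i).2 h42 h52 emb_neq_ll mulr0n; ring.
- by rewrite (sE' j (fun k => nmx x (emb k) ld)) !(h3 j).1 !(h3 j).2 (h2 j).1 h41 h51 [_ == emb _]eq_sym emb_neq_ld mulr0n; ring.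
- rewrite snn; last by move=> i; rewrite (h2 i).1; ring.
  by rewrite h41 h51 eqxx ld_neq_ll mulr1n; field.
- rewrite snN; last by move=> i; rewrite (h2 i).1 (h2 i).2; ring.
  by rewrite h41 h51 h42 h52 ld_neq_ll mulr0n; field.
- by rewrite (sE' j (fun k => nmx x (emb k) ll)) !(h3 j).1 !(h3 j).2 (h2 j).2 h42 h52 [_ == emb _]eq_sym emb_neq_ll mulr0n; ring.
- rewrite snN; last by move=> i; rewrite (h2 i).1 (h2 i).2; ring.
  by rewrite h41 h51 h42 h52 [_ == ld]eq_sym ld_neq_ll mulr0n; field.
- rewrite snn; last by move=> i; rewrite (h2 i).2; ring.
  by rewrite h42 h52 eqxx mulr1n; field.
Qed.

Section Plane.
Variables (E K : mx) (sg : R).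
Hypotheses (EE : E *m E = E) (EK : E *m K = K) (KE : K *m E = K) (KK : K *m K = sg *: E).

Definition plane_mx (p q : R) : mx := 1%:M + p *: E + q *: K.

Lemma plane_mxM p q p' q' : plane_mx p q *m plane_mx p' q' =
  plane_mx (p + p' + p * p' + sg * q * q') (q + q' + p * q' + q * p').
Proof.
rewrite /plane_mx !mulmxDl !mulmxDr !mul1mx !mulmx1 -!scalemxAl -!scalemxAr EE EK KE KK.
rewrite !scalerA !scalerDl; apply/matrixP => i j; rewrite !mxE; ring.
Qed.

Lemma Oform_plane p q : E^T *m Jmx R n = Jmx R n *m E -> K^T *m Jmx R n = - (Jmx R n *m K) ->
  2 * p + p ^+ 2 = sg * q ^+ 2 -> Oform (plane_mx p q).
Proof.
move=> EJ KJ pq; rewrite /Oform.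
have -> : (plane_mx p q)^T *m Jmx R n = Jmx R n *m plane_mx p (- q).
  rewrite /plane_mx !(mulmxDr (Jmx R n)) -!scalemxAr mulmx1 !linearD !linearZ/= trmx1 !mulmxDl mul1mx -!scalemxAl EJ KJ.
  by rewrite scalerN scaleNr.
rewrite -mulmxA plane_mxM (_ : _ + _ = 0); last by rewrite mulrN mulNr -mulrA -expr2 -pq; ring.
by rewrite (_ : _ + _ = 0); [rewrite /plane_mx !scale0r !addr0 mulmx1|ring].
Qed.

End Plane.

Definition Aproj : mx := delta_mx ld ld + delta_mx ll ll.

Definition amx (t : R) : mx :=
  plane_mx Aproj (Hmx R n) ((expR t + expR (- t)) / 2 - 1) ((expR t - expR (- t)) / 2).

Lemma ll_neq_ld : (ll == ld) = false. Proof. by rewrite eq_sym ld_neq_ll. Qed.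

Lemma delta_mulmx (a b c d : 'I_(n + 1 + 1)) :
  delta_mx a b *m delta_mx c d = if b == c then delta_mx a d else (0 : mx).
Proof. by case: eqP => [->|/eqP h]; [rewrite mul_delta_mx|rewrite mul_delta_mx_0]. Qed.

Lemma Aproj_rels : [/\ Aproj *m Aproj = Aproj, Aproj *m Hmx R n = Hmx R n,
  Hmx R n *m Aproj = Hmx R n & Hmx R n *m Hmx R n = 1 *: Aproj].
Proof.
rewrite /Aproj /Hmx scale1r !mulmxDl !mulmxDr !delta_mulmx !eqxx ld_neq_ll ll_neq_ld.
by rewrite ?addr0 ?add0r; split => //; rewrite addrC.
Qed.

Lemma amxD s t : amx s *m amx t = amx (s + t).
Proof.
have [h1 h2 h3 h4] := Aproj_rels.
by rewrite /amx (plane_mxM h1 h2 h3 h4); congr plane_mx; rewrite opprD !expRD; field.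
Qed.

Lemma amx0 : amx 0 = 1%:M.
Proof. by rewrite /amx oppr0 expR0 /plane_mx subrr mul0r scale0r addr0 (_ : _ - 1 = 0) ?scale0r ?addr0//; field. Qed.

Lemma Jdelta (a b : 'I_(n + 1 + 1)) : Jmx R n *m delta_mx a b = (if a == ll then -1 else 1) *: delta_mx a b.
Proof.
apply/matrixP => i j; rewrite JmxE mul_diag_mx !mxE.
by case: (eqVneq i a) => [->|]; rewrite ?mulr0//= mulr0.
Qed.

Lemma deltaJ (a b : 'I_(n + 1 + 1)) : delta_mx a b *m Jmx R n = (if b == ll then -1 else 1) *: delta_mx a b.
Proof.
apply/matrixP => i j; rewrite JmxE mul_mx_diag !mxE.
by case: (eqVneq j b) => [->|]; rewrite ?andbF ?mulr0 ?mul0r// mulrC.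
Qed.

Lemma Oform_amx t : Oform (amx t).
Proof.
have [h1 h2 h3 h4] := Aproj_rels.
apply: (Oform_plane h1 h2 h3 h4).
- by rewrite /Aproj linearD/= !trmx_delta mulmxDl mulmxDr !Jdelta !deltaJ.
- rewrite /Hmx linearD/= !trmx_delta mulmxDl mulmxDr !Jdelta !deltaJ ld_neq_ll eqxx.
  by rewrite !scaleN1r !scale1r opprB.
- have : expR t * expR (- t) = 1 by exact: expRxMexpNx_1.
  move: (expR t) (expR (- t)) => u v uv.
  have -> : 2 * ((u + v) / 2 - 1) + ((u + v) / 2 - 1) ^+ 2 = ((u - v) / 2) ^+ 2 + (u * v - 1) by field.
  by rewrite uv subrr addr0 mul1r.
Qed.

Lemma amx_mulE t (y : mx) i j : (amx t *m y) i j = y i j +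
  ((expR t + expR (- t)) / 2 - 1) * ((if i == ld then y ld j else 0) + (if i == ll then y ll j else 0)) +
  ((expR t - expR (- t)) / 2) * ((if i == ld then y ll j else 0) + (if i == ll then y ld j else 0)).
Proof.
rewrite /amx /plane_mx !mulmxDl mul1mx -!scalemxAl !mulmxDl.
by rewrite !mxE; congr (_ + _ * _ + _ * _); rewrite -!delta_mulE !mxE.
Qed.

Lemma amx_mul_emb t (y : mx) i j : (amx t *m y) (emb i) j = y (emb i) j.
Proof. by rewrite amx_mulE !emb_neq_ld !emb_neq_ll !addr0 !mulr0 !addr0. Qed.

Lemma amx_mul_ld t (y : mx) j : (amx t *m y) ld j =
  (expR t + expR (- t)) / 2 * y ld j + (expR t - expR (- t)) / 2 * y ll j.
Proof. by rewrite amx_mulE eqxx ld_neq_ll; field. Qed.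

Lemma amx_mul_ll t (y : mx) j : (amx t *m y) ll j =
  (expR t + expR (- t)) / 2 * y ll j + (expR t - expR (- t)) / 2 * y ld j.
Proof. by rewrite amx_mulE eqxx ll_neq_ld; field. Qed.

Lemma expmx_amx t : expmx (t *: Hmx R n) = amx t.
Proof.
have [h1 h2 h3 h4] := Aproj_rels.
pose P := 2^-1 *: (Aproj + Hmx R n); pose Q := 2^-1 *: (Aproj - Hmx R n).
have HP : Hmx R n *m P = P by rewrite -scalemxAr mulmxDr h3 h4 scale1r addrC.
have HQ : Hmx R n *m Q = - Q.
  by rewrite -scalemxAr mulmxDr mulmxN h3 h4 scale1r -scalerN opprB.
have PQ : P + Q = Aproj.
  by apply/matrixP => i j; rewrite !mxE; field.
have amxPQ : amx t = (1%:M - Aproj) + expR t *: P + expR (- t) *: Q.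
  by rewrite /amx /plane_mx /P /Q; apply/matrixP => i j; rewrite !mxE; field.
have H1 : Hmx R n = P - Q by apply/matrixP => i j; rewrite !mxE; field.
clearbody P Q.
have Hk k : (t *: Hmx R n) ^+ k.+1 = t ^+ k.+1 *: P + (- t) ^+ k.+1 *: Q.
  elim: k => [|k IH].
    by rewrite !expr1 scaleNr -scalerBr H1.
  rewrite exprS IH -[_ * _]/(_ *m _) mulmxDr -!scalemxAl -!scalemxAr HP HQ !scalerA -!exprS.
  by rewrite scalerN -scaleNr -mulNr -exprS.
have partial N : series (fun k => (k`!)%:R^-1 *: (t *: Hmx R n) ^+ k) N.+1 =
    (1%:M - Aproj) + series (exp_coeff t) N.+1 *: P + series (exp_coeff (- t)) N.+1 *: Q.
  elim: N => [|N IH].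
    rewrite !seriesSr /series /= !big_geq// !add0r /exp_coeff /= !expr0 fact0 divr1 invr1 !scale1r.
    by rewrite -addrA PQ subrK.
  rewrite seriesSr IH Hk [series (exp_coeff t) N.+2]seriesSr [series (exp_coeff (- t)) N.+2]seriesSr.
  move: (series _ _) (series _ _) => u v; rewrite /exp_coeff /=.
  rewrite scalerDr !scalerDl !scalerA ![_^-1 * _]mulrC.
  by rewrite addrACA -!addrA.
rewrite amxPQ.
rewrite /expmx; apply/cvg_lim; first exact: norm_hausdorff.
rewrite -cvg_shiftS /=; under eq_fun do rewrite partial.
apply: mx_cvgP => i j; rewrite !mxE; under eq_fun do rewrite !mxE.
have ce (u : R) : series (exp_coeff u) N.+1 @[N --> \oo] --> expR u.
  by rewrite (cvg_shiftS (series (exp_coeff u))); exact: is_cvg_series_exp_coeff.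
by apply: cvgD; [apply: cvgD; [exact: cvg_cst|]|]; apply: cvgM; (try exact: ce); exact: cvg_cst.
Qed.

Section Rotation.
Variable a : 'I_n.

Definition rot_proj : mx := delta_mx (emb a) (emb a) + delta_mx ld ld.
Definition rot_gen : mx := delta_mx (emb a) ld - delta_mx ld (emb a).
Definition rotmx (t : R) : mx := plane_mx rot_proj rot_gen (cos t - 1) (sin t).

Lemma rot_rels : [/\ rot_proj *m rot_proj = rot_proj, rot_proj *m rot_gen = rot_gen,
  rot_gen *m rot_proj = rot_gen & rot_gen *m rot_gen = -1 *: rot_proj].
Proof.
rewrite /rot_proj /rot_gen !mulmxDl !mulmxDr !mulNmx !mulmxN !delta_mulmx !eqxx emb_neq_ld [ld == _]eq_sym emb_neq_ld.
rewrite ?(oppr0, addr0, add0r) scaleN1r opprD; split => //; by rewrite addrC.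
Qed.

Lemma rotmxD s t : rotmx s *m rotmx t = rotmx (s + t).
Proof.
have [h1 h2 h3 h4] := rot_rels.
by rewrite /rotmx (plane_mxM h1 h2 h3 h4) cosD sinD; congr plane_mx; ring.
Qed.

Lemma rotmx0 : rotmx 0 = 1%:M.
Proof. by rewrite /rotmx sin0 cos0 /plane_mx subrr !scale0r !addr0. Qed.

Lemma Oform_rotmx t : Oform (rotmx t).
Proof.
have [h1 h2 h3 h4] := rot_rels.
apply: (Oform_plane h1 h2 h3 h4).
- by rewrite /rot_proj linearD/= !trmx_delta mulmxDl mulmxDr !Jdelta !deltaJ.
- rewrite /rot_gen linearB/= !trmx_delta mulmxBl mulmxBr !Jdelta !deltaJ emb_neq_ll ld_neq_ll.
  by rewrite !scale1r opprB.
- have := cos2Dsin2 t; set c := cos t; set s := sin t; nra.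
Qed.

End Rotation.

Definition oneparam (c : R -> mx) := [/\ continuous c, c 0 = 1%:M,
  forall s t, c s *m c t = c (s + t) & forall t, Oform (c t)].

Lemma continuous_plane (E K : mx) (p q : R -> R) : continuous p -> continuous q ->
  continuous (fun t => plane_mx E K (p t) (q t)).
Proof.
move=> cp cq; apply: mx_continuous => i j.
have -> : (fun t => plane_mx E K (p t) (q t) i j) = (fun t => (1%:M : mx) i j + p t * E i j + q t * K i j).
  by apply/funext => t; rewrite !mxE.
move=> t; apply: cvgD; [apply: cvgD; [exact: cvg_cst|]|]; apply: cvgM; (try exact: cvg_cst).
- exact: cp.
- exact: cq.
Qed.

Lemma continuous_expRN : continuous (fun t : R => expR (- t)).
Proof. by move=> t; apply: (@continuous_comp _ _ _ -%R expR); [exact: opp_continuous|exact: continuous_expR]. Qed.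

Lemma oneparam_amx : oneparam amx.
Proof.
split; [|exact: amx0|exact: amxD|exact: Oform_amx].
apply: continuous_plane => t.
- apply: cvgB; last exact: cvg_cst.
  by apply: cvgM; [apply: cvgD; [exact: continuous_expR|exact: continuous_expRN]|exact: cvg_cst].
- by apply: cvgM; [apply: cvgB; [exact: continuous_expR|exact: continuous_expRN]|exact: cvg_cst].
Qed.

Lemma oneparam_rotmx a : oneparam (rotmx a).
Proof.
split; [|exact: rotmx0|exact: rotmxD|exact: Oform_rotmx].
apply: continuous_plane => t; last exact: continuous_sin.
by apply: cvgB; [exact: continuous_cos|exact: cvg_cst].
Qed.

Lemma sqnormZ t (x : 'cV[R]_n) : sqnorm (t *: x) = t ^+ 2 * sqnorm x.
Proof. by rewrite /sqnorm mulr_sumr; apply: eq_bigr => i _; rewrite mxE exprMn. Qed.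

Lemma oneparam_nmx (x : 'cV[R]_n) : oneparam (fun t => nmx (t *: x)).
Proof.
split => [|||t]; last exact: Oform_nmx.
- have cs k : continuous (fun t : R => t * k).
    by move=> t; apply: cvgM; [exact: cvg_id|exact: cvg_cst].
  have cq : continuous (fun t : R => t ^+ 2 * sqnorm x / 2).
    move=> t; apply: cvgM; [apply: cvgM|]; [exact: (@exprn_continuous R 2)|exact: cvg_cst|exact: cvg_cst].
  have E (i j : 'I_(n + 1 + 1)) (f : R -> R) : (forall t, nmx (t *: x) i j = f t) -> continuous f -> continuous (fun t : R => nmx (t *: x) i j).
    by move=> H; rewrite (_ : (fun t => _) = f)//; apply/funext.
  apply: mx_continuous; apply: idx_ind => [i||]; apply: idx_ind => [j||].
  + apply: (E _ _ (fun=> (i == j)%:R)) => [t|]; last by move=> t; exact: cvg_cst.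
    by have [h _ _ _ _] := nmxE (t *: x); rewrite h.
  + apply: (E _ _ (fun t => - (t * x i 0))) => t; last by apply: cvgN; exact: cs.
    by have [_ h _ _ _] := nmxE (t *: x); rewrite (h i).1 mxE.
  + apply: (E _ _ (fun t => t * x i 0)) => // t.
    by have [_ h _ _ _] := nmxE (t *: x); rewrite (h i).2 mxE.
  + apply: (E _ _ (fun t => t * x j 0)) => // t.
    by have [_ _ h _ _] := nmxE (t *: x); rewrite (h j).1 mxE.
  + apply: (E _ _ (fun t => 1 - t ^+ 2 * sqnorm x / 2)) => t.
      by have [_ _ _ h _] := nmxE (t *: x); rewrite h.1 sqnormZ.
    by apply: cvgB; [exact: cvg_cst|exact: cq].
  + apply: (E _ _ (fun t => t ^+ 2 * sqnorm x / 2)) => // t.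
    by have [_ _ _ h _] := nmxE (t *: x); rewrite h.2 sqnormZ.
  + apply: (E _ _ (fun t => t * x j 0)) => // t.
    by have [_ _ h _ _] := nmxE (t *: x); rewrite (h j).2 mxE.
  + apply: (E _ _ (fun t => - (t ^+ 2 * sqnorm x / 2))) => t.
      by have [_ _ _ _ h] := nmxE (t *: x); rewrite h.1 sqnormZ.
    by apply: cvgN; exact: cq.
  + apply: (E _ _ (fun t => 1 + t ^+ 2 * sqnorm x / 2)) => t.
      by have [_ _ _ _ h] := nmxE (t *: x); rewrite h.2 sqnormZ.
    by apply: cvgD; [exact: cvg_cst|exact: cq].
- by rewrite scale0r nmx0.
- by move=> s t; rewrite nmxD scalerDl.
Qed.

Lemma oneparam_SO (c : R -> mx) t : oneparam c -> SOd1 (c t).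
Proof.
move=> [_ _ cD cO]; split; first exact: cO.
have -> : c t = c (t / 2) *m c (t / 2) by rewrite cD -splitr.
by rewrite det_mulmx -expr2 Oform_det.
Qed.

Lemma SOd1M (g h : mx) : SOd1 g -> SOd1 h -> SOd1 (g *m h).
Proof. by move=> [g1 g2] [h1 h2]; split; [exact: OformM|rewrite det_mulmx g2 h2 mulr1]. Qed.

Lemma SOd1_1 : SOd1 (1%:M : mx).
Proof. by split; [exact: Oform1|exact: det1]. Qed.

Lemma Ggrp_SO (g : mx) : Ggrp g -> SOd1 g.
Proof. by rewrite /Ggrp; case: ifP => // _; exact: connected_component_sub. Qed.

Lemma Ggrp_O (g : mx) : Ggrp g -> Oform g. Proof. by move=> /Ggrp_SO[]. Qed.

Lemma Ggrp1 : Ggrp (1%:M : mx).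
Proof.
rewrite /Ggrp; case: ifP => _; first exact: SOd1_1.
apply: connected_component_refl; exact: SOd1_1.
Qed.

Lemma continuous_mulmxr (y : mx) : continuous (fun g : mx => g *m y).
Proof.
apply: mx_continuous => i j; under eq_fun do rewrite mxE.
apply: (continuous_big (@add_continuous _)) => k _ g.
by apply: continuousM; [exact: coord_continuous|exact: cst_continuous].
Qed.

Lemma Ggrp_oneparam (c : R -> mx) t y : oneparam c -> Ggrp y -> Ggrp (c t *m y).
Proof.
move=> hc; have [cc c0 cD cO] := hc.
rewrite /Ggrp; case: ifP => _; first exact/SOd1M/oneparam_SO.
move=> Gy; apply: (connected_component_trans Gy).
exists (range (fun s => c s *m y)); last by exists t.
split.
- by exists 0 => //; rewrite c0 mul1mx.
- move=> _ [s _ <-]; apply: SOd1M; first exact: oneparam_SO.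
  exact: connected_component_sub Gy.
- apply: connected_continuous_connected.
    by apply/connected_intervalP => //; exact: is_intervalT.
  apply: continuous_subspaceT => s.
  by apply: (@continuous_comp _ _ _ c (fun g => g *m y)); [exact: cc|exact: continuous_mulmxr].
Qed.

Lemma oneparam_G (c : R -> mx) t : oneparam c -> Ggrp (c t).
Proof. by move=> hc; rewrite -[c t]mulmx1; apply: Ggrp_oneparam => //; exact: Ggrp1. Qed.

Lemma w0_rotmx (a : 'I_n) : a = n.-1 :> nat -> w0 R n = rotmx a pi.
Proof.
move=> an; rewrite /rotmx cospi sinpi /plane_mx scale0r addr0 /w0 /rot_proj.
have ea (i : 'I_(n + 1 + 1)) : (i == n.-1 :> nat) = (i == emb a) by rewrite -an.
have ed (i : 'I_(n + 1 + 1)) : (i == n :> nat) = (i == ld).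
  by rewrite -val_eqE /= addn0.
have ne : (emb a == ld) = false := emb_neq_ld a.
apply/matrixP => i j; rewrite !mxE ea ed.
have [<-|ij] := eqVneq i j.
  rewrite !andbb; case: (eqVneq i (emb a)) => [->|_] /=.
    by rewrite ne /= mulr0n mulr1n; ring.
  by case: (i == ld) => /=; rewrite ?mulr0n ?mulr1n; ring.
have -> : (i == emb a) && (j == emb a) = false.
  by apply/negP => /andP[/eqP h1 /eqP h2]; move: ij; rewrite h1 h2 eqxx.
have -> : (i == ld) && (j == ld) = false.
  by apply/negP => /andP[/eqP h1 /eqP h2]; move: ij; rewrite h1 h2 eqxx.
by rewrite ?mulr0n addr0 mulr0 addr0.
Qed.

Lemma Ggrp_w0 (y : mx) : (0 < n)%N -> Ggrp y -> Ggrp (w0 R n *m y).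
Proof.
move=> n0; have h : (n.-1 < n)%N by rewrite prednK.
rewrite (@w0_rotmx (Ordinal h))//.
exact/Ggrp_oneparam/oneparam_rotmx.
Qed.

Lemma w0_mulE (y : mx) j : (0 < n)%N ->
  (w0 R n *m y) ld j = - y ld j /\ (w0 R n *m y) ll j = y ll j.
Proof.
move=> n0; rewrite /w0 mul_diag_mx !mxE /= addn0 eqxx orbT mulN1r; split=> //.
have -> : (n + 1 + 0 == n.-1)%N = false.
  by apply: gtn_eqF; rewrite addn0 addn1 ltnS leq_pred.
by rewrite (_ : (n + 1 + 0 == n)%N = false) ?mul1r//; apply: gtn_eqF; rewrite addn0 addn1.
Qed.

Lemma cdif_w0 (y : mx) : (0 < n)%N -> cdif (w0 R n *m y) = csum y.
Proof. by move=> n0; rewrite /cdif (w0_mulE y ll n0).1 (w0_mulE y ll n0).2 opprK. Qed.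

Lemma cdif_nmx x (y : mx) : cdif (nmx x *m y) = cdif y.
Proof. by rewrite /cdif nmx_mul_ld nmx_mul_ll; field. Qed.

Lemma lheight_nmx x (y : mx) : lheight (nmx x *m y) = lheight y.
Proof. by rewrite /lheight cdif_nmx. Qed.

Lemma hcoord_nmx x (y : mx) i : Oform y -> hcoord i (nmx x *m y) = hcoord i y + x i 0.
Proof.
move=> /cdif_neq0 c0; rewrite /hcoord cdif_nmx nmx_mul_emb -/(cdif y).
by rewrite mulrDl mulfK.
Qed.

Lemma cdif_amx t (y : mx) : cdif (amx t *m y) = expR (- t) * cdif y.
Proof. by rewrite /cdif amx_mul_ld amx_mul_ll; field. Qed.

Lemma lheight_amx t (y : mx) : Oform y -> lheight (amx t *m y) = lheight y + t.
Proof.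
move=> /cdif_neq0 c0; rewrite /lheight cdif_amx normrM gtr0_norm ?expR_gt0//.
by rewrite lnM ?posrE ?expR_gt0 ?normr_gt0// expRK; ring.
Qed.

Lemma hcoord_amx t (y : mx) i : hcoord i (amx t *m y) = expR t * hcoord i y.
Proof.
by rewrite /hcoord cdif_amx amx_mul_emb invfM -expRN opprK mulrCA.
Qed.

Lemma Ggrp_ll_gt0 (y : mx) : n <> 1%N -> Ggrp y -> 0 < y ll ll.
Proof.
rewrite /Ggrp => /eqP/negbTE -> Gy.
pose I := [set g ll ll | g in connected_component (@SOd1 R n) 1%:M].
have cI : connected I.
  apply: connected_continuous_connected; first exact: component_connected.
  by apply: continuous_subspaceT => g; exact: coord_continuous.
have I1 : I 1.
  by exists 1%:M; [exact: connected_component_refl SOd1_1|rewrite mxE eqxx].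
rewrite ltNge; apply/negP => y0.
have [g Gg g0] : I 0.
  move/connected_intervalP: cI => /(_ (y ll ll) 1); apply => //; last by rewrite y0 ler01.
  by exists y.
have [Og _] : SOd1 g := connected_component_sub Gg.
have := cdif_csum Og; rewrite /cdif /csum g0 sub0r add0r.
have : 0 <= \sum_(i < n) g (emb i) ll ^+ 2 by rewrite sumr_ge0// => i _; exact: sqr_ge0.
have := sqr_ge0 (g ld ll); nra.
Qed.

Lemma cdif_gt0 (y : mx) : n <> 1%N -> Ggrp y -> 0 < cdif y.
Proof.
move=> n1 Gy; have y0 := Ggrp_ll_gt0 n1 Gy.
have := cdif_csum (Ggrp_O Gy); rewrite /cdif /csum.
have : 0 <= \sum_(i < n) y (emb i) ll ^+ 2 by rewrite sumr_ge0// => i _; exact: sqr_ge0.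
nra.
Qed.

Lemma iwasawa (y : mx) : Ggrp y ->
  exists x k, Kgrp k /\ y = expmx (lheight y *: Hmx R n) *m nmx x *m k.
Proof.
move=> Gy; have Oy := Ggrp_O Gy.
pose t := lheight y.
pose x : 'cV[R]_n := \col_i (expR (- t) * hcoord i y).
pose k := nmx (- x) *m (amx (- t) *m y).
have Ok : Oform k by apply: OformM; [exact: Oform_nmx|apply: OformM => //; exact: Oform_amx].
have yk : y = amx t *m nmx x *m k.
  by rewrite /k -mulmxA (mulmxA (nmx x)) nmxD subrr nmx0 mul1mx mulmxA amxD subrr amx0 mul1mx.
have Oy' : Oform (amx (- t) *m y) by apply: OformM => //; exact: Oform_amx.
have hk i : k (emb i) ll = 0.
  have : hcoord i k = 0 by rewrite hcoord_nmx// hcoord_amx !mxE subrr.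
  by rewrite /hcoord => /eqP; rewrite mulf_eq0 invr_eq0 (negbTE (cdif_neq0 Ok)) orbF => /eqP.
have ck : cdif k = expR t * cdif y by rewrite cdif_nmx cdif_amx opprK.
clearbody k.
have nk : `|cdif k| = 1 by rewrite ck normrM gtr0_norm ?expR_gt0// norm_cdif// -expRD subrr expR0.
have ck2 : cdif k ^+ 2 = 1 by rewrite -real_normK ?num_real// nk expr1n.
have csk : csum k = cdif k.
  apply: (mulfI (cdif_neq0 Ok)); rewrite cdif_csum// big1 ?addr0 ?expr2 -?expr2 ?ck2// => i _.
  by rewrite hk expr0n.
have kld : k ld ll = 0 by move: csk; rewrite /csum /cdif; lra.
have kll : k ll ll = cdif k by rewrite /cdif kld subr0.
have kT := mulJtr k k ll ll.
rewrite (OformT Ok) Jmx_entry eqxx mulr1n -expr2 kll -!expr2 ck2 in kT.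
have sq0 : \sum_(i < n) k ll (emb i) ^+ 2 = 0 /\ k ll ld = 0.
  have h1 : 0 <= \sum_(i < n) k ll (emb i) ^+ 2 by rewrite sumr_ge0// => i _; exact: sqr_ge0.
  have h2 := sqr_ge0 (k ll ld).
  have E : \sum_(i < n) k ll (emb i) * k ll (emb i) = \sum_(i < n) k ll (emb i) ^+ 2 by apply: eq_bigr => i _; rewrite expr2.
  rewrite E in kT; split; first by lra.
  by apply/eqP; rewrite -sqrf_eq0; apply/eqP; lra.
have klast i : k ll (emb i) = 0.
  apply/eqP; rewrite -sqrf_eq0.
  have := sq0.1 => /eqP; rewrite psumr_eq0; last by move=> j _; exact: sqr_ge0.
  by move=> /allP/(_ i); rewrite mem_index_enum => /(_ isT).
pose k' := ulsubmx k.
have kE : k = block_mx k' 0 0 (cdif k)%:M.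
  rewrite -[LHS]submxK; congr block_mx.
  - apply/matrixP => i j; rewrite !mxE ord1; case: (split_ordP i) => m ->; first exact: hk.
    by rewrite ord1; exact: kld.
  - apply/matrixP => i j; rewrite !mxE ord1; case: (split_ordP j) => m ->; first exact: klast.
    by rewrite ord1; exact: sq0.2.
  - by apply/matrixP => i j; rewrite !mxE !ord1 eqxx mulr1n; exact: kll.
have Ok' : k'^T *m k' = 1%:M.
  have := Ok; rewrite /Oform kE /Jmx tr_block_mx !mulmx_block !trmx0 !(mulmx0, mul0mx, addr0, add0r, mulmx1, mul1mx).
  by move=> /eq_block_mx[].
have detk : \det k = 1.
  have [_ dy] := Ggrp_SO Gy; move: dy; rewrite {1}yk !det_mulmx.
  by rewrite (oneparam_SO t oneparam_amx).2 -[x]scale1r (oneparam_SO 1 (oneparam_nmx x)).2 !mul1r.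
have dk' : \det k' = cdif k.
  move: detk; rewrite kE det_ublock det_scalar1 -kE => h.
  have := cdif_neq0 Ok => c0; apply: (mulIf c0).
  by rewrite h -expr2 ck2.
exists x, k; split; last by rewrite expmx_amx.
exists k'; split => //; last by rewrite dk'.
move=> n1; rewrite dk'; move: nk; rewrite ger0_norm//.
by rewrite ck mulr_ge0// ?expR_ge0//; apply: ltW; exact: cdif_gt0.
Qed.

Lemma logA_lheight (y : mx) : Ggrp y -> logA y = lheight y.
Proof.
move=> Gy; rewrite /logA; case: xgetP => [t _ /= [x [k [Kk yE]]]|/(_ (lheight y))]; last first.
  by move=> /(_ (iwasawa Gy)).
have [k' [Ok' _ kE]] := Kk.
rewrite yE expmx_amx -mulmxA /lheight cdif_amx cdif_nmx normrM gtr0_norm ?expR_gt0//.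
have -> : `|cdif k| = 1.
  have -> : cdif k = \det k'.
    rewrite /cdif kE /idx_d /idx_d1 block_mxEdr block_mxEur !mxE subr0 eqxx mulr1n//.
  have := congr1 (fun M => \det M) Ok'; rewrite det_mulmx det_tr det1 -expr2 => h.
  by apply/eqP; rewrite -sqrp_eq1// real_normK ?num_real// h.
by rewrite mulr1 expRK opprK.
Qed.

End Group.

(** * Iterated integrals *)

Section Currying.
Variable R : realType.
Local Notation leb := (@lebesgue_measure R).

Lemma measurable_integral_param d (T : measurableType d) (F : T -> R -> \bar R) :
  measurable_fun setT (fun z : T * R => F z.1 z.2) -> (forall t s, 0 <= F t s)%E ->
  measurable_fun setT (fun t => \int[leb]_s F t s)%E.
Proof.
move=> mF F0.
exact: (@measurable_fun_fubini_tonelli_F _ _ T (measurableTypeR R) R leb (fun z => F z.1 z.2)).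
Qed.

Lemma integral_swap d (T : measurableType d) (m : {sigma_finite_measure set T -> \bar R})
    (F : T -> R -> \bar R) :
  measurable_fun setT (fun z : T * R => F z.1 z.2) -> (forall t s, 0 <= F t s)%E ->
  (\int[m]_t \int[leb]_s F t s = \int[leb]_s \int[m]_t F t s)%E.
Proof.
move=> mF F0.
exact: (@fubini_tonelli _ _ T (measurableTypeR R) R m leb (fun z => F z.1 z.2)).
Qed.

Lemma measurable_uncurry4 d d1 (T : measurableType d) (U : measurableType d1)
    (K : U -> R -> R -> R -> \bar R) (f1 : T -> U) (f2 f3 f4 : T -> R) :
  measurable_fun setT (fun z : U * R * R * R => K z.1.1.1 z.1.1.2 z.1.2 z.2) ->
  measurable_fun setT f1 -> measurable_fun setT f2 -> measurable_fun setT f3 ->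
  measurable_fun setT f4 -> measurable_fun setT (fun t => K (f1 t) (f2 t) (f3 t) (f4 t)).
Proof.
move=> mK m1 m2 m3 m4.
apply: (@measurableT_comp _ _ _ _ _ _ _ _ (fun t => (f1 t, f2 t, f3 t, f4 t)) mK).
by do 3?[apply: measurable_fun_pair => //].
Qed.

Lemma measurable_fst_comp d d1 d2 (T : measurableType d) (U : measurableType d1)
    (V : measurableType d2) (f : T -> U * V) :
  measurable_fun setT f -> measurable_fun setT (fun t => (f t).1).
Proof. by move=> mf; exact: measurableT_comp. Qed.

Lemma measurable_snd_comp d d1 d2 (T : measurableType d) (U : measurableType d1)
    (V : measurableType d2) (f : T -> U * V) :
  measurable_fun setT f -> measurable_fun setT (fun t => (f t).2).
Proof. by move=> mf; exact: measurableT_comp. Qed.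

End Currying.

Ltac measurability := repeat first [exact: measurable_cst | exact: measurable_id | apply: measurable_funB
  | apply: measurable_funD | apply: measurable_funM | apply: measurable_fst_comp
  | apply: measurable_snd_comp].

Ltac measurability_integral := apply: measurable_integral_param;
  last by [move=> *; do ?[apply: integral_ge0 => *]].

Section Iterated.
Variable R : realType.
Local Notation leb := (@lebesgue_measure R).

Section Translate.
Variables (d : measure_display) (T : measurableType d) (m : {sigma_finite_measure set T -> \bar R}).
Variable K : T -> R -> R -> R -> \bar R.
Hypothesis mK : measurable_fun setT (fun z : T * R * R * R => K z.1.1.1 z.1.1.2 z.1.2 z.2).
Hypothesis K0 : forall t x y z, (0 <= K t x y z)%E.
Variables L1 L2 L3 : T -> R.

Lemma integral_translate3 :
  (\int[m]_t \int[leb]_x \int[leb]_y \int[leb]_z K t (x + L1 t)%R (y + L2 t)%R (z + L3 t)%R =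
   \int[leb]_x \int[leb]_y \int[leb]_z \int[m]_t K t x y z)%E.
Proof.
have mz t x y : measurable_fun setT (fun z => K t x y z).
  by apply: (measurable_uncurry4 mK); measurability.
have Kz0 t x y : (0 <= \int[leb]_z K t x y z)%E by apply: integral_ge0.
have my t x : measurable_fun setT (fun y => \int[leb]_z K t x y z)%E.
  measurability_integral.
  by apply: (measurable_uncurry4 mK); measurability.
have Ky0 t x : (0 <= \int[leb]_y \int[leb]_z K t x y z)%E by apply: integral_ge0.
have mx t : measurable_fun setT (fun x => \int[leb]_y \int[leb]_z K t x y z)%E.
  measurability_integral; measurability_integral.
  by apply: (measurable_uncurry4 mK); measurability.
transitivity (\int[m]_t \int[leb]_x \int[leb]_y \int[leb]_z K t x y z)%E.
  apply: eq_integral => t _; apply: etrans (ge0_integral_shift (L1 t) (mx t) (Ky0 t)).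
  apply: eq_integral => x _.
  apply: etrans (ge0_integral_shift (L2 t) (my t (x + L1 t)) (Kz0 t (x + L1 t))).
  apply: eq_integral => y _.
  exact: (ge0_integral_shift (L3 t) (mz t (x + L1 t) (y + L2 t)) (K0 t (x + L1 t) (y + L2 t))).
rewrite (@integral_swap _ _ _ m (fun t x => \int[leb]_y \int[leb]_z K t x y z)%E) => [|| t x]; last 2 first.
- by do 2!measurability_integral; apply: (measurable_uncurry4 mK); measurability.
- exact: Ky0.
apply: eq_integral => x _.
rewrite (@integral_swap _ _ _ m (fun t y => \int[leb]_z K t x y z)%E) => [|| t y]; last 2 first.
- by measurability_integral; apply: (measurable_uncurry4 mK); measurability.
- exact: Kz0.
apply: eq_integral => y _; apply: integral_swap => //.
by apply: (measurable_uncurry4 mK); measurability.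
Qed.

End Translate.

Section Linear4.
Variable K : R -> R -> R -> R -> \bar R.
Hypothesis mK : measurable_fun setT (fun z : R * R * R * R => K z.1.1.1 z.1.1.2 z.1.2 z.2).
Hypothesis K0 : forall t x y z, (0 <= K t x y z)%E.

Let mK' d (T : measurableType d) (f1 f2 f3 f4 : T -> R) :
  measurable_fun setT f1 -> measurable_fun setT f2 -> measurable_fun setT f3 ->
  measurable_fun setT f4 -> measurable_fun setT (fun t => K (f1 t) (f2 t) (f3 t) (f4 t)).
Proof. exact: (measurable_uncurry4 mK). Qed.

Lemma integral_linear4 :
  (\int[leb]_x \int[leb]_y \int[leb]_z \int[leb]_q
     K q (x + y - q)%R (x + z - q)%R (y + z - q)%R =
   2^-1%:E * \int[leb]_q1 \int[leb]_q2 \int[leb]_q3 \int[leb]_q4 K q1 q2 q3 q4)%E.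
Proof.
have Kz0 x y z : (0 <= \int[leb]_w K x y z w)%E by apply: integral_ge0.
have Ky0 x y : (0 <= \int[leb]_z \int[leb]_w K x y z w)%E by apply: integral_ge0.
have Kx0 x : (0 <= \int[leb]_y \int[leb]_z \int[leb]_w K x y z w)%E by apply: integral_ge0.
transitivity (\int[leb]_q \int[leb]_y \int[leb]_z \int[leb]_x
   K q y z (y + z + q - 2 * x)%R)%E.
  transitivity (\int[leb]_x \int[leb]_q \int[leb]_y \int[leb]_z K q y z (y + z + q - 2 * x)%R)%E.
    apply: eq_integral => x _.
    transitivity (\int[leb]_y \int[leb]_q \int[leb]_z
        K q (x + y - q)%R (x + z - q)%R (y + z - q)%R)%E.
      apply: eq_integral => y _.
      apply: (@integral_swap _ _ _ leb (fun z q => K q (x + y - q)%R (x + z - q)%R (y + z - q)%R)) => //.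
      by apply: mK'; measurability.
    apply: etrans (@integral_swap _ _ _ leb (fun y q => \int[leb]_z
      K q (x + y - q)%R (x + z - q)%R (y + z - q)%R)%E _ _) _.
    - by measurability_integral; apply: mK'; measurability.
    - by move=> y q; apply: integral_ge0.
    apply: eq_integral => q _.
    have mz y : measurable_fun setT (fun z => K q y z (y + z + q - 2 * x)%R) by apply: mK'; measurability.
    have my : measurable_fun setT (fun y => \int[leb]_z K q y z (y + z + q - 2 * x)%R)%E.
      by measurability_integral; apply: mK'; measurability.
    have y0 y : (0 <= \int[leb]_z K q y z (y + z + q - 2 * x)%R)%E by apply: integral_ge0.
    apply: etrans (ge0_integral_shift (x - q) my y0); apply: eq_integral => y _.
    apply: etrans (ge0_integral_shift (x - q) (mz _) (fun z => K0 _ _ _ _)).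
    apply: eq_integral => z _.
    have -> : x + y - q = y + (x - q) by ring.
    have -> : x + z - q = z + (x - q) by ring.
    by have -> : y + z - q = y + (x - q) + (z + (x - q)) + q - 2 * x by ring.
  apply: etrans (@integral_swap _ _ _ leb (fun x q => \int[leb]_y \int[leb]_z
    K q y z (y + z + q - 2 * x)%R)%E _ _) _.
  - by do 2!measurability_integral; apply: mK'; measurability.
  - by move=> x q; apply: integral_ge0 => y _; apply: integral_ge0.
  apply: eq_integral => q _.
  apply: etrans (@integral_swap _ _ _ leb (fun x y => \int[leb]_z K q y z (y + z + q - 2 * x)%R)%E _ _) _.
  - by measurability_integral; apply: mK'; measurability.
  - by move=> x y; apply: integral_ge0.
  apply: eq_integral => y _.
  apply: (@integral_swap _ _ _ leb (fun x z => K q y z (y + z + q - 2 * x)%R)) => //.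
  by apply: mK'; measurability.
have E q y z : (\int[leb]_x K q y z (y + z + q - 2 * x)%R = 2^-1%:E * \int[leb]_w K q y z w)%E.
  rewrite [X in (_ * X)%E](@ge0_integral_affine _ (- 2) (y + z + q))//; last first.
  - by apply: mK'; measurability.
  rewrite muleA -EFinM normrN normr_nat mulVf// mul1e.
  by apply: eq_integral => x _; rewrite mulNr addrC.
have mz q y : measurable_fun setT (fun z => \int[leb]_w K q y z w)%E.
  by measurability_integral; apply: mK'; measurability.
have my q : measurable_fun setT (fun y => \int[leb]_z \int[leb]_w K q y z w)%E.
  by do 2?[measurability_integral]; apply: mK'; measurability.
have mx : measurable_fun setT (fun q => \int[leb]_y \int[leb]_z \int[leb]_w K q y z w)%E.
  by do 3?[measurability_integral]; apply: mK'; measurability.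
have Z (f : R -> \bar R) : measurable_fun setT f -> (forall x, 0 <= f x)%E ->
    (\int[leb]_x (2^-1%:E * f x) = 2^-1%:E * \int[leb]_x f x)%E.
  by move=> mf f0; rewrite ge0_integralZl// lee_fin invr_ge0.
apply: etrans (Z _ mx Kx0); apply: eq_integral => q _.
apply: etrans (Z _ (my q) (Ky0 q)); apply: eq_integral => y _.
by apply: etrans (Z _ (mz q y) (Kz0 q y)); apply: eq_integral => z _.
Qed.

End Linear4.
End Iterated.

Section Trig.
Variable R : realType.
Local Notation leb := (@lebesgue_measure R).

Definition cis (x : R) : R[i] := cos x +i* sin x.
Definition cgamma (a b : R) : R[i] := gammaC a b +i* gammaS a b.

Lemma cisD x y : cis (x + y) = cis x * cis y.
Proof. by rewrite /cis cosD sinD; congr (_ +i* _); rewrite addrC. Qed.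

Lemma ReM (z w : R[i]) : complex.Re (z * w) = complex.Re z * complex.Re w - complex.Im z * complex.Im w.
Proof. by case: z w => [a b] [c d]. Qed.

Lemma integral_gammaD_cis (a b w k A : R) (z : R[i]) : 0 < a ->
  (\int[leb]_x (k * gammaD a x * (A + complex.Re (z * cis (w + b * x))))%:E =
   (k * (A * gammaR a + complex.Re (z * cgamma a b * cis w)))%:E)%E.
Proof.
move=> a0.
pose z' := z * cis w.
have IC := integrable_gammaC b a0; have IS := integrable_gammaS b a0; have IG := integrable_gammaD a0.
transitivity (\int[leb]_x ((k * A)%:E * (gammaD a x)%:E + ((k * complex.Re z')%:E * (gammaD a x * cos (b * x))%:E
   - (k * complex.Im z')%:E * (gammaD a x * sin (b * x))%:E)))%E.
  apply: eq_integral => x _; rewrite -!EFinM -EFinB -EFinD; congr _%:E.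
  by rewrite cisD mulrA -/z' ReM /=; ring.
have I1 := integrableZl measurableT (k * A) IG.
have I2 := integrableZl measurableT (k * complex.Re z') IC.
have I3 := integrableZl measurableT (k * complex.Im z') IS.
have I4 := integrableB measurableT I2 I3.
rewrite (integralD measurableT I1 I4) (integralB measurableT I2 I3).
rewrite (integralZl measurableT IG) (integralZl measurableT IC) (integralZl measurableT IS).
have F f : leb.-integrable setT (EFin \o f) -> (\int[leb]_x (EFin \o f) x = (\int[leb]_x f x)%:E)%E.
  by move=> If; rewrite /Rintegral fineK// integrable_fin_num.
rewrite (F _ IG) (F _ IC) (F _ IS) -!EFinM -EFinB -EFinD; congr _%:E.
rewrite -/(gammaR a) -/(gammaC a b) -/(gammaS a b).
have -> : z * cgamma a b * cis w = z' * cgamma a b by rewrite /z' mulrAC.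
by rewrite ReM /=; ring.
Qed.

Lemma integral_gammaD_cis3 (a k w b1 b2 b3 : R) (z : R[i]) : 0 < a ->
  (\int[leb]_x \int[leb]_y \int[leb]_t (k * gammaD a x * gammaD a y * gammaD a t *
     (1 + complex.Re (z * cis (w + b1 * x + b2 * y + b3 * t))))%:E =
   (k * (gammaR a ^+ 3 +
     complex.Re (z * (cgamma a b1 * cgamma a b2 * cgamma a b3) * cis w)))%:E)%E.
Proof.
move=> a0; have I := @integral_gammaD_cis _ _ _ _ _ _ a0.
under eq_integral => x _.
  under eq_integral => y _ do rewrite I.
  rewrite I; over.
rewrite I; congr (k * (_ + complex.Re (_ * _)))%:E; by ring.
Qed.

Lemma integral_gammaD_cis4 (a b1 b2 b3 b4 : R) (z : R[i]) : 0 < a ->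
  (\int[leb]_x \int[leb]_y \int[leb]_t \int[leb]_s
     (gammaD a x * gammaD a y * gammaD a t * gammaD a s *
     (1 + complex.Re (z * cis (b1 * x + b2 * y + b3 * t + b4 * s))))%:E =
   (gammaR a ^+ 4 +
     complex.Re (z * (cgamma a b1 * cgamma a b2 * cgamma a b3 * cgamma a b4)))%:E)%E.
Proof.
move=> a0; have I := @integral_gammaD_cis _ _ _ _ _ _ a0.
under eq_integral => x _.
  under eq_integral => y _.
    under eq_integral => t _ do rewrite I.
    rewrite I; over.
  rewrite I; over.
rewrite /= -[b1]addr0.
transitivity (\int[leb]_x (1 * gammaD a x * (1 * gammaR a * gammaR a * gammaR a +
   complex.Re (z * cgamma a b4 * cgamma a b3 * cgamma a b2 * cis (0 + b1 * x))))%:E)%E.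
  by apply: eq_integral => x _; rewrite mul1r add0r addr0.
rewrite I addr0 [cis 0](_ : _ = 1) ?mulr1 ?mul1r; last by rewrite /cis cos0 sin0.
by congr (_ + complex.Re _)%:E; ring.
Qed.

End Trig.

(** * Integration over the Lorentz group *)

Section Borel.
Variables (R : realType) (n : nat).
Local Notation mx := 'M[R]_(n + 1 + 1).
Local Notation bmx := (borelMx R n).
Local Notation leb := (@lebesgue_measure R).

Lemma open_measurable_bmx (A : set mx) : open A -> measurable (A : set bmx).
Proof. by move=> oA; apply: sub_sigma_algebra. Qed.

Lemma closed_measurable_bmx (A : set mx) : closed A -> measurable (A : set bmx).
Proof.
move=> cA; rewrite -[A]setCK; apply: measurableC; apply: open_measurable_bmx.
exact: closed_openC.
Qed.

Lemma continuous_measurable_bmx (f : mx -> R) : continuous f ->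
  measurable_fun [set: bmx] (f : bmx -> R).
Proof.
move=> /continuousP cf; apply: (measurability _ (RGenOpens.measurableE R)).
move=> _ [_ [a [b ->] <-]]; rewrite setTI; apply: open_measurable_bmx.
exact/cf/interval_open.
Qed.

Lemma measurable_entry i j : measurable_fun [set: bmx] ((fun y => y i j) : bmx -> R).
Proof. apply: continuous_measurable_bmx; exact: coord_continuous. Qed.

Lemma continuous_mulmxl (g : mx) : continuous (fun y : mx => g *m y).
Proof.
apply: mx_continuous => i j; under eq_fun do rewrite mxE.
apply: (continuous_big (@add_continuous _)) => k _ y.
by apply: continuousM; [exact: cst_continuous|exact: coord_continuous].
Qed.

Lemma measurable_mulmxl (g : mx) : measurable_fun [set: bmx] ((fun y => g *m y) : bmx -> bmx).
Proof.
apply: (@measurability _ _ bmx bmx setT _ (@open mx)) => // _ [A oA <-].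
rewrite setTI; apply: open_measurable_bmx.
by have /continuousP := @continuous_mulmxl g; apply.
Qed.

Lemma continuous_det : continuous (fun y : mx => \det y).
Proof.
have cp (s : 'I_(n + 1 + 1) -> 'I_(n + 1 + 1)) : continuous (fun y : mx => \prod_i y i (s i)).
  apply: (continuous_big (@mul_continuous _)) => i _; exact: coord_continuous.
rewrite /determinant; apply: (continuous_big (@add_continuous _)) => s _ y.
set c := (-1) ^+ _.
by apply: (@continuousM R _ (cst c) (fun x : mx => \prod_i x i (perm.fun_of_perm s i))); [exact: cst_continuous|exact: cp].
Qed.

Lemma closed_SOd1 : closed (@SOd1 R n).
Proof.
have -> : (@SOd1 R n) = \bigcap_(ij in [set: 'I_(n + 1 + 1) * 'I_(n + 1 + 1)])
    [set g | (g^T *m Jmx R n *m g) ij.1 ij.2 = Jmx R n ij.1 ij.2] `&` [set g | \det g = 1].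
  apply/seteqP; split => g /=.
    by move=> [Og dg]; split => // ij _ /=; rewrite Og.
  by move=> [Og dg]; split => //; apply/matrixP => i j; exact: (Og (i, j)).
apply: closedI; last first.
  by apply: (@closed_comp _ _ (fun g : mx => \det g) [set 1]) => [g _|]; [exact: continuous_det|exact: closed_eq].
apply: closed_bigI => -[i j] _.
apply: (@closed_comp _ _ (fun g : mx => (g^T *m Jmx R n *m g) i j) [set Jmx R n i j]) => [g _|]; last exact: closed_eq.
have -> : (fun g : mx => (g^T *m Jmx R n *m g) i j) = (fun g : mx =>
    \sum_k (\sum_l g l i * Jmx R n l k) * g k j).
  apply/funext => y; rewrite mxE; apply: eq_bigr => k _; rewrite mxE; congr (_ * _).
  by apply: eq_bigr => l _; rewrite mxE.
move: g; apply: (continuous_big (@add_continuous _)) => k _ g.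
apply: continuousM; last exact: coord_continuous.
move: g; apply: (continuous_big (@add_continuous _)) => l _ g.
by apply: continuousM; [exact: coord_continuous|exact: cst_continuous].
Qed.

Lemma closed_Ggrp : closed (@Ggrp R n).
Proof.
rewrite /Ggrp; case: ifP => _; first exact: closed_SOd1.
by apply: component_closed; exact: closed_SOd1.
Qed.

Lemma measurable_Ggrp : measurable (@Ggrp R n : set bmx).
Proof. by apply: closed_measurable_bmx; exact: closed_Ggrp. Qed.

Lemma compact_box (M : R) : compact [set y : mx | forall i j, y i j \in `[- M, M]].
Proof.
have cv : continuous (fun v : 'rV[R]_((n + 1 + 1) * (n + 1 + 1)) => vec_mx v : mx).
  apply: mx_continuous => i j; under eq_fun do rewrite mxE; exact: coord_continuous.
have := @rV_compact R ((n + 1 + 1) * (n + 1 + 1)) (fun=> `[- M, M]%classic) (fun=> @segment_compact R _ _).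
move/(continuous_compact (continuous_subspaceT cv)).
congr compact; apply/seteqP; split => y /=.
  by move=> [v Hv <-] i j; rewrite mxE; exact: Hv.
move=> H; exists (mxvec y); last exact: mxvecK.
move=> i; case/mxvec_indexP: i => i j; rewrite /= mxvecE; exact: H.
Qed.

Definition Gbox (M : nat) : set bmx := [set y | Ggrp y /\ forall i j, y i j \in `[- M%:R, M%:R]].

Lemma compact_Gbox M : compact (Gbox M : set mx).
Proof.
have -> : (Gbox M : set mx) = (@Ggrp R n) `&` [set y | forall i j, y i j \in `[- M%:R, M%:R]] by [].
rewrite setIC; apply: compact_closedI; [exact: compact_box|exact: closed_Ggrp].
Qed.

Lemma measurable_Gbox M : measurable (Gbox M).
Proof.
apply: closed_measurable_bmx; apply: compact_closed; last exact: compact_Gbox.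
exact: norm_hausdorff.
Qed.

Lemma bigcup_Gbox : \bigcup_M Gbox M = (@Ggrp R n : set bmx).
Proof.
apply/seteqP; split => y; first by move=> [M _ []].
move=> Gy; pose B := \sum_i \sum_j `|y i j|.
exists (Num.truncn B).+1 => //; split => // i j.
rewrite in_itv/= -ler_norml; apply: (@le_trans _ _ B); last by rewrite ltW// truncnS_gt.
rewrite /B (bigD1 i)//= (bigD1 j)//= -addrA lerDl addr_ge0// sumr_ge0// => k _.
by apply: sumr_ge0.
Qed.

End Borel.

Section HaarIntegration.
Variables (R : realType) (n : nat).
Local Notation mx := 'M[R]_(n + 1 + 1).
Local Notation bmx := (borelMx R n).
Local Notation leb := (@lebesgue_measure R).
Local Notation G := (@Ggrp R n : set bmx).
Variable mu : {measure set bmx -> \bar R}.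
Hypothesis haar : is_haar mu.

Definition muG : set bmx -> \bar R := mrestr mu (@measurable_Ggrp R n).
HB.instance Definition _ := Measure.on muG.

Lemma muG_sigma_finite : sigma_finite setT muG.
Proof.
exists (fun M => Gbox M `|` ~` G).
  apply/esym/seteqP; split => // y _; have [Gy|nGy] := pselect (G y); last by exists 0%N => //; right.
  by have := Gy; rewrite -bigcup_Gbox => -[M _ HM]; exists M => //; left.
move=> M; split.
  by apply: measurableU; [exact: measurable_Gbox|apply: measurableC; exact: measurable_Ggrp].
rewrite /muG /mrestr setIUl setICl setU0.
rewrite (_ : Gbox M `&` G = Gbox M); last by apply/setIidPl => y [].
by have [_ H _] := haar; apply: H; [exact: compact_Gbox|move=> y []].
Qed.

HB.instance Definition _ := Measure_isSigmaFinite.Build _ _ _ muG muG_sigma_finite.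

Lemma integral_muG (f : bmx -> \bar R) : measurable_fun setT f -> (forall y, 0 <= f y)%E ->
  (\int[mu]_(y in G) f y = \int[muG]_y f y)%E.
Proof.
move=> mf f0.
have mG := @measurable_Ggrp R n.
rewrite (@ge0_negligible_integral _ _ _ muG setT (~` G))//.
- rewrite setTD setCK; apply: eq_measure_integral => A mA AG.
  by rewrite -[RHS]/(mu (A `&` G)) setIidl.
- exact: measurableC.
- by rewrite -[LHS]/(mu (~` G `&` G)) setICl measure0.
Qed.

Lemma eq_integral_muG (f g : bmx -> \bar R) :
  measurable_fun setT f -> (forall y, 0 <= f y)%E ->
  measurable_fun setT g -> (forall y, 0 <= g y)%E ->
  (forall y, G y -> f y = g y) -> (\int[muG]_y f y = \int[muG]_y g y)%E.
Proof.
move=> mf f0 mg g0 fg; rewrite -!integral_muG//; apply: eq_integral => y; rewrite inE; exact: fg.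
Qed.

Lemma muG_mulmx (g h : mx) (A : set bmx) : Ggrp h ->
  (forall y, Ggrp y -> Ggrp (g *m y)) -> (forall y, Ggrp y -> Ggrp (h *m y)) ->
  g *m h = 1%:M -> h *m g = 1%:M -> measurable A ->
  muG ((fun y => g *m y) @^-1` A) = muG A.
Proof.
move=> Gh gG hG gh hg mA.
have mG := @measurable_Ggrp R n.
rewrite -[RHS]/(mu (A `&` G)) -[LHS]/(mu ((fun y => g *m y) @^-1` A `&` G)).
have [inv _ _] := haar.
rewrite -(inv h (A `&` G)) => //; last exact: measurableI.
congr (mu _); apply/seteqP; split => y /=.
  move=> [Ay Gy]; exists (g *m y); last by rewrite mulmxA hg mul1mx.
  by split => //; exact: gG.
move=> [b [Ab Gb] <-]; rewrite mulmxA gh mul1mx; split => //; exact: hG.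
Qed.

Lemma integral_mulmx (g h : mx) (f : bmx -> \bar R) : Ggrp h ->
  (forall y, Ggrp y -> Ggrp (g *m y)) -> (forall y, Ggrp y -> Ggrp (h *m y)) ->
  g *m h = 1%:M -> h *m g = 1%:M ->
  measurable_fun setT f -> (forall y, 0 <= f y)%E ->
  (\int[muG]_y f (g *m y) = \int[muG]_y f y)%E.
Proof.
move=> Gh gG hG gh hg mf f0.
have mg := measurable_mulmxl g.
have <- : (\int[pushforward muG ((fun y => g *m y) : bmx -> bmx)]_y f y = \int[muG]_y f (g *m y))%E.
  exact: (ge0_integral_pushforward mg muG measurableT mf).
apply: eq_measure_integral => A mA _; exact: (muG_mulmx Gh gG hG).
Qed.

Lemma integral_oneparam (c : R -> mx) t (f : bmx -> \bar R) : oneparam c ->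
  measurable_fun setT f -> (forall y, 0 <= f y)%E ->
  (\int[muG]_y f (c t *m y) = \int[muG]_y f y)%E.
Proof.
move=> hc; have [_ c0 cD _] := hc.
apply: (@integral_mulmx (c t) (c (- t))).
- exact: oneparam_G.
- by move=> y; exact: Ggrp_oneparam.
- by move=> y; exact: Ggrp_oneparam.
- by rewrite cD subrr.
- by rewrite cD addNr.
Qed.

Definition I01 (x : R) : R := \1_(`[0, 1]%classic : set R) x.

Lemma I01_ge0 x : 0 <= I01 x. Proof. by rewrite /I01 indicE. Qed.

Lemma measurable_I01 : measurable_fun setT I01.
Proof. by apply: measurable_indic. Qed.

Lemma integral_I01 (s : R) : (\int[leb]_t (I01 (s - t))%:E = 1)%E.
Proof.
have -> : (\int[leb]_t (I01 (s - t))%:E = \int[leb]_t (\1_(`[s - 1, s]%classic : set R) t)%:E)%E.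
  apply: eq_integral => t _; rewrite /I01 !indicE !mem_setE !in_itv/=; congr (_%:R%:E).
  by rewrite subr_ge0 !lerBlDr (addrC 1) andbC.
rewrite integral_indic//= setIT lebesgue_measure_itv/= lte_fin ltrBlDr ltrDl ltr01.
by rewrite -EFinB opprB addrC subrK.
Qed.

(* Fubini in [(y, t)] against the indicator of [0 <= tau y - t <= 1], whose
   integral in [t] is 1. *)
Lemma integral_fiber (c : R -> mx) (tau : bmx -> R) (f : bmx -> \bar R)
    (phi : bmx * R -> \bar R) : oneparam c ->
  measurable_fun setT tau -> (forall t y, G y -> tau (c t *m y) = tau y + t) ->
  measurable_fun setT f -> (forall y, 0 <= f y)%E ->
  measurable_fun setT phi -> (forall y, 0 <= phi y)%E ->
  (forall t y, G y -> f (c t *m y) = phi (y, t)) ->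
  (\int[muG]_y f y = \int[muG]_y ((I01 (tau y))%:E * \int[leb]_t phi (y, t)))%E.
Proof.
move=> hc mtau tauE mf f0 mphi phi0 fphi.
pose F (z : bmx * R) : \bar R := ((I01 (tau z.1 - z.2))%:E * f z.1)%E.
pose H (z : bmx * R) : \bar R := ((I01 (tau z.1))%:E * phi z)%E.
have mF : measurable_fun setT F.
  apply: emeasurable_funM; last by apply: measurableT_comp => //.
  apply/measurable_EFinP; apply: (measurableT_comp measurable_I01).
  by apply: measurable_funB => //; apply: measurableT_comp.
have F0 z : (0 <= F z)%E by rewrite mule_ge0// lee_fin I01_ge0.
have mH : measurable_fun setT H.
  apply: emeasurable_funM => //.
  apply/measurable_EFinP; apply: (measurableT_comp measurable_I01).
  by apply: measurableT_comp.
have H0 z : (0 <= H z)%E by rewrite mule_ge0// lee_fin I01_ge0.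
transitivity (\int[muG]_y \int[leb]_t F (y, t))%E.
  apply: eq_integral => y _; rewrite /F /=.
  rewrite ge0_integralZr//; first by rewrite integral_I01 mul1e.
  - apply/measurable_EFinP; apply: (measurableT_comp measurable_I01).
    by apply: measurable_funB => //; exact: measurable_cst.
  - by move=> t _; rewrite lee_fin I01_ge0.
transitivity (\int[muG]_y \int[leb]_t H (y, t))%E; last first.
  apply: eq_integral => y _; rewrite /H /= ge0_integralZl//.
  - by apply: measurableT_comp => //.
  - by rewrite lee_fin I01_ge0.
have eF := @fubini_tonelli _ _ bmx (measurableTypeR R) R muG leb F mF F0.
have eH := @fubini_tonelli _ _ bmx (measurableTypeR R) R muG leb H mH H0.
rewrite eF eH.
apply: eq_integral => t _.
have mFt : measurable_fun setT (fun y : bmx => F (y, t)) by apply: measurableT_comp => //; exact: pair2_measurable.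
have mHt : measurable_fun setT (fun y : bmx => H (y, t)) by apply: measurableT_comp => //; exact: pair2_measurable.
rewrite -(integral_oneparam t hc mFt)//.
apply: eq_integral_muG => //.
- by apply: (measurableT_comp mFt); exact: measurable_mulmxl.
- by move=> y Gy; rewrite /F /H /= tauE// addrK fphi.
Qed.

Lemma measurable_invr : measurable_fun setT (fun x : R => x^-1).
Proof.
have -> : (fun x : R => x^-1) = (fun x => x * (`|x| `^ (- 2%:R))).
  apply/funext => x; rewrite powR_invn// real_normK ?num_real//.
  by have [->|x0] := eqVneq x 0; [rewrite invr0 mul0r|rewrite expr2 invfM mulrA divff ?mul1r].
apply: measurable_funM => //.
by apply: (measurableT_comp (measurable_powR _)).
Qed.

Lemma measurable_cdif : measurable_fun [set: bmx] (@cdif R n).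
Proof. by apply: measurable_funB; exact: measurable_entry. Qed.

Lemma measurable_lheight : measurable_fun [set: bmx] (@lheight R n).
Proof.
apply: measurableT_comp => //; apply: (measurableT_comp (@measurable_ln R)).
by apply: measurableT_comp => //; exact: measurable_cdif.
Qed.

Lemma measurable_hcoord i : measurable_fun [set: bmx] (@hcoord R n i).
Proof.
apply: measurable_funM; first exact: measurable_entry.
by apply: (measurableT_comp measurable_invr); exact: measurable_cdif.
Qed.

Lemma hcoord_shift t (k i : 'I_n) (y : mx) : Oform y ->
  hcoord i (nmx (t *: delta_mx k 0) *m y) = hcoord i y + (if i == k then t else 0).
Proof.
move=> Oy; rewrite hcoord_nmx// !mxE eqxx andbT.
by case: (i == k); rewrite ?mulr1 ?mulr0.
Qed.

Section GaussFiber.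
Variables (w al : R -> R) (be : 'I_n -> R -> R).
Hypotheses (mw : measurable_fun setT w) (mal : measurable_fun setT al)
  (mbe : forall i, measurable_fun setT (be i)) (w0 : forall x, 0 <= w x).

Let gauss (i : 'I_n) (t : R) (y : bmx) : R :=
  expR (- (expR (al (lheight y)) * (t + (hcoord i y + be i (lheight y))) ^+ 2)).
Let factor (k : nat) (i : 'I_n) (y : bmx) : R :=
  if (i < k)%N then Num.sqrt pi * expR (- al (lheight y) / 2) * I01 (hcoord i y)
  else gauss i 0 y.
(* The integrand after the first [k] horizontal coordinates have been integrated
   out along N. *)
Let fk (k : nat) (y : bmx) : R := w (lheight y) * \prod_i factor k i y.

Let measurable_gauss i : measurable_fun setT (fun z : bmx * R => gauss i z.2 z.1).
Proof.
have mlh : measurable_fun setT (fun z : bmx * R => lheight z.1).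
  by apply: measurableT_comp => //; exact: measurable_lheight.
apply: (measurableT_comp (@measurable_expR R)); apply: measurableT_comp => //.
apply: measurable_funM.
  by apply: (measurableT_comp (@measurable_expR R)); exact: (measurableT_comp mal).
apply: measurable_funX; apply: measurable_funD => //.
apply: measurable_funD; last exact: (measurableT_comp (mbe i)).
by apply: measurableT_comp => //; exact: measurable_hcoord.
Qed.

Let measurable_factor k i : measurable_fun setT (factor k i).
Proof.
rewrite /factor; case: (i < k)%N.
  apply: measurable_funM; last by apply: (measurableT_comp measurable_I01); exact: measurable_hcoord.
  apply: measurable_funM => //; apply: (measurableT_comp (@measurable_expR R)).
  apply: measurable_funM => //; apply: measurableT_comp => //.
  by apply: (measurableT_comp mal); exact: measurable_lheight.
have h := measurable_fun_pair1 (0 : R) (measurable_gauss i); exact: h.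
Qed.

Let factor_ge0 k i y : 0 <= factor k i y.
Proof. by rewrite /factor; case: ifP => _; rewrite ?expR_ge0// !mulr_ge0 ?expR_ge0 ?I01_ge0. Qed.

Let mwl : measurable_fun setT (fun y : bmx => w (lheight y)).
Proof. by apply: (measurableT_comp mw); exact: measurable_lheight. Qed.

Let measurable_fk k : measurable_fun setT (fk k).
Proof.
by apply: measurable_funM => //; apply: measurable_prod => i _; exact: measurable_factor.
Qed.

Let fk_ge0 k y : 0 <= fk k y.
Proof. by rewrite mulr_ge0// prodr_ge0. Qed.

Let fk_step (k : 'I_n) : (\int[muG]_y (fk k y)%:E = \int[muG]_y (fk k.+1 y)%:E)%E.
Proof.
pose rest (y : bmx) := w (lheight y) * \prod_(i < n | i != k) factor k i y.
have rest0 y : 0 <= rest y by rewrite mulr_ge0// prodr_ge0.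
pose phi (z : bmx * R) : \bar R := (rest z.1 * gauss k z.2 z.1)%:E.
have mrest : measurable_fun setT rest.
  apply: measurable_funM => //; under eq_fun do rewrite big_mkcond.
  apply: measurable_prod => i _; case: (i != k); [exact: measurable_factor|exact: measurable_cst].
rewrite (@integral_fiber (fun t => nmx (t *: delta_mx k 0)) (hcoord k) _ phi).
- apply: eq_integral => y _.
  have -> : (\int[leb]_t phi (y, t) = (rest y * (Num.sqrt pi * expR (- al (lheight y) / 2)))%:E)%E.
    under eq_integral do rewrite /phi /= EFinM.
    rewrite ge0_integralZl//; last 3 first.
    + apply/measurable_EFinP; have h := measurable_fun_pair2 y (measurable_gauss k); exact: h.
    + by move=> t _; rewrite lee_fin expR_ge0.
    + by rewrite lee_fin.
    by rewrite integral_gauss_affine -EFinM.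
  rewrite -EFinM; congr _%:E; rewrite /fk (bigD1 k)//= /rest {2}/factor ltnSn.
  have -> : \prod_(i < n | i != k) factor k.+1 i y = \prod_(i < n | i != k) factor k i y.
    apply: eq_bigr => i ik; have ik' : (i == k :> nat) = false := negbTE ik.
    by rewrite /factor ltnS leq_eqVlt ik'.
  by ring.
- exact: oneparam_nmx.
- exact: measurable_hcoord.
- by move=> t y Gy; rewrite hcoord_shift ?eqxx//; exact: Ggrp_O Gy.
- by apply/measurable_EFinP.
- by move=> y; rewrite lee_fin.
- apply/measurable_EFinP; apply: measurable_funM => //; exact: measurableT_comp.
- by move=> y; rewrite lee_fin mulr_ge0// expR_ge0.
- move=> t y Gy; have Oy := Ggrp_O Gy; rewrite /phi /fk /rest /= (bigD1 k)//= lheight_nmx.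
  have fE (i : 'I_n) : i != k -> factor k i (nmx (t *: delta_mx k 0) *m y) = factor k i y.
    by move=> ik; rewrite /factor /gauss lheight_nmx hcoord_shift// (negbTE ik) addr0.
  rewrite (eq_bigr (factor k ^~ y))// {1}/factor ltnn /gauss lheight_nmx hcoord_shift// eqxx add0r.
  congr _%:E; rewrite mulrCA mulrC; congr (_ * expR (- (_ * _ ^+ 2))); ring.
Qed.

Lemma integral_gauss_fiber :
  (\int[muG]_y (w (lheight y) * \prod_(i < n)
     expR (- (expR (al (lheight y)) * (hcoord i y + be i (lheight y)) ^+ 2)))%:E =
   \int[muG]_y (w (lheight y) * (Num.sqrt pi * expR (- al (lheight y) / 2)) ^+ n *
     \prod_(i < n) I01 (hcoord i y))%:E)%E.
Proof.
have H k : (k <= n)%N -> (\int[muG]_y (fk 0 y)%:E = \int[muG]_y (fk k y)%:E)%E.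
  elim: k => [//|k IH] kn; rewrite IH ?(ltnW kn)//.
  exact: (fk_step (Ordinal kn)).
have := H n (leqnn n); congr (_ = _); apply: eq_integral => y _; congr _%:E; rewrite /fk.
  by congr (_ * _); apply: eq_bigr => i _; rewrite /factor /gauss add0r.
rewrite -mulrA; congr (_ * _).
rewrite (eq_bigr (fun i => (Num.sqrt pi * expR (- al (lheight y) / 2)) * I01 (hcoord i y))); last first.
  by move=> i _; rewrite /factor ltn_ord.
by rewrite big_split/= prodr_const card_ord.
Qed.

End GaussFiber.

Definition delta0 (i : 'I_n) : R := (i == 0%N :> nat)%:R.

Lemma sum_delta0 : (0 < n)%N -> \sum_(i < n) delta0 i ^+ 2 = 1.
Proof.
move=> n0; rewrite (bigD1 (Ordinal n0))//= big1 => [|i /negbTE i0].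
  by rewrite addr0 /delta0 eqxx expr1n.
by rewrite /delta0 (_ : (i == 0%N :> nat) = false)// expr0n.
Qed.

(* With l and x the coordinates of y, this is
   exp (- (e^(s1 - l1) + e^(s2 - l2) + e^(s3 - l3))), where l1, l2, l3 are the
   logarithms of the A-components of w0 n0 y, w0 y and y. *)
Definition horoF (s1 s2 s3 l : R) (x : 'I_n -> R) : R :=
  expR (- (expR s1 * (expR l + expR (- l) * \sum_(i < n) (x i + delta0 i) ^+ 2) +
           expR s2 * (expR l + expR (- l) * \sum_(i < n) x i ^+ 2) +
           expR s3 * expR (- l))).

Lemma measurable_expR_comp d (T : measurableType d) (f : T -> R) :
  measurable_fun setT f -> measurable_fun setT (fun z => expR (f z)).
Proof. by move=> mf; exact: (measurableT_comp (@measurable_expR R)). Qed.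

Lemma measurable_horoF d (T : measurableType d) (s1 s2 s3 l : T -> R) (x : T -> 'I_n -> R) :
  measurable_fun setT s1 -> measurable_fun setT s2 -> measurable_fun setT s3 ->
  measurable_fun setT l -> (forall i, measurable_fun setT (fun z => x z i)) ->
  measurable_fun setT (fun z => horoF (s1 z) (s2 z) (s3 z) (l z) (x z)).
Proof.
move=> m1 m2 m3 ml mx0.
have mE := @measurable_expR_comp _ T.
have mlN : measurable_fun setT (fun z => expR (- l z)) by apply: mE; exact: measurableT_comp.
apply: (mE); apply: measurableT_comp => //.
apply: measurable_funD; last by apply: measurable_funM => //; exact: mE.
apply: measurable_funD; (apply: measurable_funM; first exact: mE);
  (apply: measurable_funD; first exact: mE); apply: measurable_funM => //;
  apply: measurable_sum => i; apply: measurable_funX => //.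
by apply: measurable_funD.
Qed.

Lemma horoF_split (s1 s2 s3 t l : R) (x : 'I_n -> R) : (0 < n)%N ->
  let S := expR s1 + expR s2 in
  horoF s1 s2 s3 t (fun i => expR (t - l) * x i) =
  expR (- (S * expR t + expR (- t) * (expR s1 * expR s2 / S + expR s3))) *
  \prod_(i < n) expR (- (expR (ln S + t - 2 * l) *
    (x i + expR s1 / S * delta0 i * expR (l - t)) ^+ 2)).
Proof.
move=> n0 S; have S0 : 0 < S by rewrite addr_gt0// expR_gt0.
rewrite -expR_sum -expRD; congr expR.
rewrite sumrN -opprD; congr (- _).
have E (i : 'I_n) : expR (ln S + t - 2 * l) * (x i + expR s1 / S * delta0 i * expR (l - t)) ^+ 2 =
    expR (- t) * (expR s1 * (expR (t - l) * x i + delta0 i) ^+ 2 + expR s2 * (expR (t - l) * x i) ^+ 2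
      - expR s1 * expR s2 / S * delta0 i ^+ 2).
  have -> : expR (ln S + t - 2 * l) = S * (expR (- t) * expR (t - l) ^+ 2).
    rewrite -[in LHS]addrA [LHS]expRD lnK ?posrE//; congr (_ * _).
    by rewrite -expRM_natl -expRD; congr expR; ring.
  have -> : expR (l - t) = (expR (t - l))^-1 by rewrite -expRN opprB.
  have := expR_gt0 (t - l); move: (expR (t - l)) => u u0.
  by rewrite /S in S0 *; field; rewrite !gt_eqF.
rewrite (eq_bigr _ (fun i _ => E i)) -mulr_sumr sumrB big_split/= -!mulr_sumr sum_delta0//.
by rewrite /S; ring.
Qed.

Definition horo_const : \bar R := (\int[muG]_y
  (I01 (lheight y) * expR (n%:R * lheight y) * \prod_(i < n) I01 (hcoord i y))%:E)%E.

Lemma measurable_horo_const : measurable_fun [set: bmx] (fun y : bmx =>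
  I01 (lheight y) * expR (n%:R * lheight y) * \prod_(i < n) I01 (hcoord i y)).
Proof.
have ml := measurable_lheight.
apply: measurable_funM; last first.
  by apply: measurable_prod => i _; apply: (measurableT_comp measurable_I01); exact: measurable_hcoord.
apply: measurable_funM; first exact: (measurableT_comp measurable_I01).
apply: (measurableT_comp (@measurable_expR R)).
by apply: measurable_funM => //; exact: measurable_cst.
Qed.

Lemma horo_const_integrand_ge0 (y : bmx) :
  0 <= I01 (lheight y) * expR (n%:R * lheight y) * \prod_(i < n) I01 (hcoord i y).
Proof.
rewrite !mulr_ge0 ?expR_ge0 ?I01_ge0//.
by apply: prodr_ge0 => i _; exact: I01_ge0.
Qed.

Definition bessel (s1 s2 s3 : R) : \bar R := (\int[leb]_q
  (expR (- (n%:R / 2 * q) - expR q - expR (- q) * (expR (s1 + s2) + expR (s1 + s3) + expR (s2 + s3))))%:E)%E.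

Lemma integral_horoF (s1 s2 s3 : R) : (0 < n)%N ->
  (\int[muG]_y (horoF s1 s2 s3 (lheight y) (fun i => hcoord i y))%:E =
   (Num.sqrt pi ^+ n)%:E * horo_const * bessel s1 s2 s3)%E.
Proof.
move=> n0; pose S := expR s1 + expR s2.
have S0 : 0 < S by rewrite addr_gt0// expR_gt0.
have ml := measurable_lheight; have mh := measurable_hcoord.
pose f (y : bmx) : \bar R := (horoF s1 s2 s3 (lheight y) (fun i => hcoord i y))%:E.
pose phi (z : bmx * R) : \bar R :=
  (horoF s1 s2 s3 (lheight z.1 + z.2) (fun i => expR z.2 * hcoord i z.1))%:E.
pose psi (z : bmx * R) : \bar R :=
  (I01 (lheight z.1) * horoF s1 s2 s3 z.2 (fun i => expR (z.2 - lheight z.1) * hcoord i z.1))%:E.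
have mE := @measurable_expR_comp _ (bmx * R)%type.
have ml1 : measurable_fun setT (fun z : bmx * R => lheight z.1) by exact: measurableT_comp.
have mh1 i : measurable_fun setT (fun z : bmx * R => hcoord i z.1).
  by apply: measurableT_comp => //; exact: mh.
have mf : measurable_fun setT f.
  by apply/measurable_EFinP; apply: measurable_horoF => //; exact: measurable_cst.
have mphi : measurable_fun setT phi.
  apply/measurable_EFinP; apply: measurable_horoF => //; try exact: measurable_cst.
    by apply: measurable_funD.
  by move=> i; apply: measurable_funM => //; exact: mE.
have mpsi : measurable_fun setT psi.
  apply/measurable_EFinP; apply: measurable_funM; first exact: (measurableT_comp measurable_I01).
  apply: measurable_horoF => //; try exact: measurable_cst.
  by move=> i; apply: measurable_funM => //; apply: mE; exact: measurable_funB.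
have phi0 z : (0 <= phi z)%E by rewrite lee_fin expR_ge0.
have psi0 z : (0 <= psi z)%E by rewrite lee_fin mulr_ge0 ?expR_ge0 ?I01_ge0.
rewrite (@integral_fiber (@amx R n) (@lheight R n) _ phi)//; first last.
- move=> t y Gy; have Oy := Ggrp_O Gy; rewrite /phi /= lheight_amx//.
  by congr (horoF _ _ _ _ _)%:E; apply/funext => i; rewrite hcoord_amx.
- by move=> y; rewrite lee_fin expR_ge0.
- by move=> t y Gy; rewrite lheight_amx//; exact: Ggrp_O Gy.
- exact: oneparam_amx.
transitivity (\int[muG]_y \int[leb]_t psi (y, t))%E.
  apply: eq_integral => y _.
  have my : measurable_fun setT (fun t : R => phi (y, t)) := measurable_fun_pair2 y mphi.
  rewrite -(@ge0_integral_shift _ (- lheight y) (fun t => phi (y, t)))//.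
  transitivity (\int[leb]_t ((I01 (lheight y))%:E * phi (y, t - lheight y)%R))%E.
    rewrite ge0_integralZl//; last by rewrite lee_fin I01_ge0.
    apply: (measurableT_comp my).
    by apply: measurable_funD => //; exact: measurable_cst.
  apply: eq_integral => t _; rewrite /phi /psi -EFinM /=.
  by have -> : lheight y + (t - lheight y) = t by rewrite addrC subrK.
have eF := @fubini_tonelli _ _ bmx (measurableTypeR R) R muG leb psi mpsi psi0.
rewrite eF.
pose E t := expR (- (S * expR t + expR (- t) * (expR s1 * expR s2 / S + expR s3))).
have K (t : R) : (\int[muG]_y psi (y, t) =
    ((Num.sqrt pi ^+ n)%:E * horo_const) * (E t * expR (- (n%:R / 2 * (ln S + t))))%:E)%E.
  have := @integral_gauss_fiber (fun l => I01 l * E t) (fun l => ln S + t - 2 * l)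
    (fun i l => expR s1 / S * delta0 i * expR (l - t)).
  under eq_integral => y _ do rewrite -mulrA -horoF_split//.
  move=> -> //.
  - have -> : (fun y : bmx => (I01 (lheight y) * E t *
       (Num.sqrt pi * expR (- (ln S + t - 2 * lheight y) / 2)) ^+ n *
        \prod_(i < n) I01 (hcoord i y))%:E) = (fun y : bmx =>
       (Num.sqrt pi ^+ n * (E t * expR (- (n%:R / 2 * (ln S + t)))))%:E *
       (I01 (lheight y) * expR (n%:R * lheight y) * \prod_(i < n) I01 (hcoord i y))%:E)%E.
      apply/funext => y; rewrite -EFinM; congr _%:E; rewrite exprMn -expRM_natl.
      have -> : expR (n%:R * (- (ln S + t - 2 * lheight y) / 2)) = expR (- (n%:R / 2 * (ln S + t))) * expR (n%:R * lheight y).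
        by rewrite -expRD; congr expR; field.
      by ring.
    rewrite ge0_integralZl//.
    + by rewrite EFinM muleAC.
    + by apply/measurable_EFinP; exact: measurable_horo_const.
    + by move=> y _; rewrite lee_fin horo_const_integrand_ge0.
    + by rewrite lee_fin !mulr_ge0 ?expR_ge0// exprn_ge0.
  - by apply: measurable_funM; [exact: measurable_I01|exact: measurable_cst].
  - apply: measurable_funB; first exact: measurable_cst.
    by apply: measurable_funM => //; exact: measurable_cst.
  - move=> i; apply: measurable_funM; first exact: measurable_cst.
    apply: (measurableT_comp (@measurable_expR R)).
    by apply: measurable_funB => //; exact: measurable_cst.
  - by move=> l; rewrite mulr_ge0 ?I01_ge0 ?expR_ge0.
under eq_integral => t _ do rewrite K.
have mEt : measurable_fun setT (fun t : measurableTypeR R => (E t * expR (- (n%:R / 2 * (ln S + t))))%:E).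
  apply/measurable_EFinP; apply: measurable_funM; apply: measurable_expR_comp; apply: measurableT_comp => //.
    apply: measurable_funD; apply: measurable_funM; try exact: measurable_cst.
      exact: measurable_expR.
    by apply: continuous_measurable_fun; exact: continuous_expRN.
  apply: measurable_funM; first exact: measurable_cst.
  by apply: measurable_funD => //; exact: measurable_cst.
have Et0 (t : R) : (0 <= (E t * expR (- (n%:R / 2 * (ln S + t))))%:E)%E.
  by rewrite lee_fin mulr_ge0 ?expR_ge0.
rewrite ge0_integralZl//; last first.
- by rewrite mule_ge0 ?lee_fin ?exprn_ge0// integral_ge0// => y _; rewrite lee_fin horo_const_integrand_ge0.
congr (_ * _)%E; rewrite /bessel.
rewrite -(@ge0_integral_shift _ (- ln S) _ _ Et0); last exact: mEt.
apply: eq_integral => q _; congr _%:E; rewrite /E -expRD; congr expR.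
rewrite opprB !expRD !expRN lnK ?posrE// -!expRN.
by rewrite /S in S0 *; field; rewrite gt_eqF.
Qed.

Lemma I01_neq0 (x : R) : I01 x != 0 -> 0 <= x <= 1.
Proof. by rewrite /I01 indicE mem_setE in_itv/=; case: (0 <= x <= 1); rewrite ?eqxx. Qed.

Lemma I01_le1 (x : R) : I01 x <= 1.
Proof. by rewrite /I01 indicE; case: (_ \in _). Qed.

Lemma horo_box_last_column (y : bmx) i : Oform y -> 0 <= lheight y <= 1 ->
  (forall i, 0 <= hcoord i y <= 1) -> `|y i (idx_d1 n)| <= n%:R + 4.
Proof.
move=> Oy /andP[l0 l1] hx; have cd := norm_cdif Oy; have cs := norm_csum Oy.
have c1 : `|cdif y| <= 1 by rewrite cd -[leRHS]expR0 ler_expR oppr_le0.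
have s1 : `|csum y| <= 4 + n%:R.
  rewrite cs; apply: lerD.
    apply: le_trans (_ : expR 1 <= _); first by rewrite ler_expR.
    have -> : expR 1 = expR 2^-1 ^+ 2 :> R by rewrite -expRM_natl mulfV.
    have : expR 2^-1 * expR (- 2^-1) = 1 :> R by rewrite -expRD subrr expR0.
    have := expR_ge1Dx (- 2^-1 : R); have := expR_gt0 (2^-1 : R).
    by move: (expR _) (expR _) => u v; nra.
  rewrite -[leRHS]mul1r; apply: ler_pM; [exact: expR_ge0|by rewrite sumr_ge0// => ? _; exact: sqr_ge0
    |by rewrite -[leRHS]expR0 ler_expR oppr_le0|].
  apply: le_trans (_ : \sum_(i < n) 1 <= _); last by rewrite sumr_const card_ord.
  by apply: ler_sum => j _; have /andP[h0 h1] := hx j; rewrite expr_le1.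
have n0 : 0 <= n%:R :> R by [].
move: c1 s1; rewrite !ler_norml /cdif /csum => /andP[c1 c2] /andP[s1 s2].
elim/(@idx_ind n): i => [j||].
- have -> : y (emb j) (idx_d1 n) = hcoord j y * cdif y.
    by rewrite /hcoord divfK// cdif_neq0.
  have /andP[h0 h1] := hx j; rewrite -ler_norml; apply: (@le_trans _ _ 1); last by lra.
  have cd1 : `|cdif y| <= 1 by rewrite ler_norml /cdif c1 c2.
  by rewrite normrM mulr_ile1 ?normr_ge0// ger0_norm.
- by lra.
- by lra.
Qed.

Lemma horo_box_Gbox (y : bmx) : G y -> 0 <= lheight y <= 1 ->
  (forall i, 0 <= hcoord i y <= 1) -> Gbox (n + 5) y.
Proof.
move=> Gy hl hx; have Oy := Ggrp_O Gy.
split=> // i j; have C := horo_box_last_column _ Oy hl hx.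
have n0 : 0 <= n%:R :> R by [].
rewrite in_itv/= -ler_norml natrD.
have [->|jll] := eqVneq j (idx_d1 n); first by apply: le_trans (C i) _; lra.
have sq : y i j ^+ 2 <= 1 + y i (idx_d1 n) ^+ 2.
  have := mulJtr y y i i; rewrite OformT// Jmx_entry eqxx mulr1n => e.
  have e1 : (if i == idx_d1 n then -1 else 1 : R) <= 1 by case: ifP => _; lra.
  rewrite e in e1; apply: (@le_trans _ _
    (\sum_(k < n) y i (emb k) * y i (emb k) + y i (idx_d n) * y i (idx_d n))); last by lra.
  have sn (P : pred 'I_n) : 0 <= \sum_(k < n | P k) y i (emb k) * y i (emb k).
    by rewrite sumr_ge0// => k _; rewrite -expr2 sqr_ge0.
  elim/(@idx_ind n): j jll => [k _|_|/eqP//].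
  - rewrite (bigD1 k)//=; have := sn (fun l => l != k); have := sqr_ge0 (y i (idx_d n)).
    by rewrite !expr2; lra.
  - by rewrite expr2 lerDr sn.
have b0 : 0 <= n%:R + 4 :> R by lra.
have b1 : 0 <= n%:R + 5 :> R by lra.
have C2 : y i (idx_d1 n) ^+ 2 <= (n%:R + 4) ^+ 2.
  by rewrite -[leLHS]real_normK ?num_real// ler_pXn2r ?nnegrE.
rewrite -(@ler_pXn2r _ 2) ?nnegrE// real_normK ?num_real//.
by move: sq C2; rewrite !expr2; lra.
Qed.

Lemma horo_const_lty : (horo_const < +oo)%E.
Proof.
have mB := @measurable_Gbox R n (n + 5).
have muB : (muG (Gbox (n + 5)) < +oo)%E.
  rewrite /muG /mrestr; have [_ H _] := haar.
  rewrite (_ : _ `&` _ = Gbox (n + 5)); last by apply/setIidPl => y [].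
  by apply: H; [exact: compact_Gbox|move=> y []].
apply: (@le_lt_trans _ _ (\int[muG]_y ((expR n%:R)%:E * (\1_(Gbox (n + 5)) y)%:E))%E).
  rewrite /horo_const -integral_muG; last 2 first.
  - by apply/measurable_EFinP; exact: measurable_horo_const.
  - by move=> y; rewrite lee_fin horo_const_integrand_ge0.
  rewrite -[leRHS]integral_muG; last 2 first.
  - by apply/measurable_EFinP; apply: measurable_funM; [exact: measurable_cst|exact: measurable_indic].
  - by move=> y; rewrite -EFinM lee_fin mulr_ge0 ?expR_ge0.
  apply: ge0_le_integral => //.
  - exact: measurable_Ggrp.
  - by move=> y _; rewrite lee_fin horo_const_integrand_ge0.
  - by apply/measurable_EFinP; apply: measurable_funTS; exact: measurable_horo_const.
  - apply/measurable_EFinP; apply: measurable_funTS.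
    by apply: measurable_funM; [exact: measurable_cst|exact: measurable_indic].
  move=> y Gy; rewrite -EFinM lee_fin.
  have [->|fy0] := eqVneq (I01 (lheight y) * expR (n%:R * lheight y) * \prod_(i < n) I01 (hcoord i y)) 0.
    by rewrite mulr_ge0 ?expR_ge0.
  move: (fy0); rewrite !mulf_eq0 !negb_or => /andP[/andP[/I01_neq0 hl _] /prodf_neq0 hp].
  have hx i : 0 <= hcoord i y <= 1 by apply: I01_neq0; exact: hp.
  rewrite indicE mem_set ?mulr1; last exact: horo_box_Gbox.
  rewrite -[leRHS]mulr1; apply: ler_pM.
  - by rewrite mulr_ge0 ?I01_ge0 ?expR_ge0.
  - by apply: prodr_ge0 => i _; exact: I01_ge0.
  - rewrite -[leRHS]mul1r; apply: ler_pM; rewrite ?I01_ge0 ?expR_ge0 ?I01_le1// ler_expR.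
    by have /andP[_ l1] := hl; rewrite ler_piMr.
  - by apply: prodr_ile1 => i _; rewrite I01_ge0 I01_le1.
rewrite ge0_integralZl//; last by apply/measurable_EFinP; exact: measurable_indic.
by rewrite integral_indic// setIT lte_mul_pinfty// lee_fin expR_ge0.
Qed.

Lemma horo_const_gt0 : (0 < n)%N -> (0 < horo_const)%E.
Proof.
move=> n0; rewrite lt0e; apply/andP; split; last first.
  by apply: integral_ge0 => y _; rewrite lee_fin horo_const_integrand_ge0.
apply/negP => /eqP h0.
have := integral_horoF 0 0 0 n0; rewrite h0 mule0 mul0e -integral_muG; last 2 first.
- apply/measurable_EFinP; apply: measurable_horoF; try exact: measurable_cst.
    exact: measurable_lheight.
  by move=> i; exact: measurable_hcoord.
- by move=> y; rewrite lee_fin expR_ge0.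
move=> e.
have mG := @measurable_Ggrp R n.
have mf : measurable_fun G (fun y : bmx => (horoF 0 0 0 (lheight y) (fun i => hcoord i y))%:E).
  apply: measurable_funTS; apply/measurable_EFinP; apply: measurable_horoF; try exact: measurable_cst.
    exact: measurable_lheight.
  by move=> i; exact: measurable_hcoord.
have := (ae_eq_integral_abs mu mG mf).1.
under eq_integral => y _ do rewrite gee0_abs ?lee_fin ?expR_ge0//.
move=> /(_ e) [N [mN N0 sN]].
have [_ _] := haar; rewrite ltNge => /negP; apply.
rewrite -N0; apply: le_measure; rewrite ?inE//.
move=> y Gy; apply: sN => /= /(_ Gy) /eqP; rewrite eqe gt_eqF// expR_gt0//.
Qed.

(* The logarithms of the A-components of w0 n0 y and of w0 y. *)
Definition ht1 (y : mx) : R := - ln (expR (lheight y) +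
  expR (- lheight y) * \sum_(i < n) (hcoord i y + delta0 i) ^+ 2).
Definition ht2 (y : mx) : R := - ln (expR (lheight y) +
  expR (- lheight y) * \sum_(i < n) hcoord i y ^+ 2).

Lemma expR_ht1 y : expR (- ht1 y) =
  expR (lheight y) + expR (- lheight y) * \sum_(i < n) (hcoord i y + delta0 i) ^+ 2.
Proof.
rewrite /ht1 opprK lnK// posrE ltr_pwDl ?expR_gt0// mulr_ge0 ?expR_ge0//.
by apply: sumr_ge0 => i _; exact: sqr_ge0.
Qed.

Lemma expR_ht2 y : expR (- ht2 y) =
  expR (lheight y) + expR (- lheight y) * \sum_(i < n) hcoord i y ^+ 2.
Proof.
rewrite /ht2 opprK lnK// posrE ltr_pwDl ?expR_gt0// mulr_ge0 ?expR_ge0//.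
by apply: sumr_ge0 => i _; exact: sqr_ge0.
Qed.

Lemma measurable_ht1 : measurable_fun setT (ht1 : bmx -> R).
Proof.
have ml := measurable_lheight; have mh := measurable_hcoord.
apply: measurableT_comp => //; apply: (measurableT_comp (@measurable_ln R)).
apply: measurable_funD; first exact: measurable_expR_comp.
apply: measurable_funM; first by apply: measurable_expR_comp; exact: measurableT_comp.
apply: measurable_sum => i; apply: measurable_funX.
by apply: measurable_funD; [exact: mh|exact: measurable_cst].
Qed.

Lemma measurable_ht2 : measurable_fun setT (ht2 : bmx -> R).
Proof.
have ml := measurable_lheight; have mh := measurable_hcoord.
apply: measurableT_comp => //; apply: (measurableT_comp (@measurable_ln R)).
apply: measurable_funD; first exact: measurable_expR_comp.
apply: measurable_funM; first by apply: measurable_expR_comp; exact: measurableT_comp.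
by apply: measurable_sum => i; apply: measurable_funX; exact: mh.
Qed.

Lemma horoF_ht (y : mx) x1 x2 x3 :
  horoF (x1 + ht1 y) (x2 + ht2 y) (x3 + lheight y) (lheight y) (fun i => hcoord i y) =
  expR (- (expR x1 + expR x2 + expR x3)).
Proof.
rewrite /horoF -expR_ht1 -expR_ht2 -!expRD.
by rewrite !addrK.
Qed.

Definition weight (y : mx) : R := expR (n%:R / 2 * (ht1 y + ht2 y + lheight y)).

Lemma measurable_Re_cis d (T : measurableType d) (z : R[i]) (f : T -> R) :
  measurable_fun setT f -> measurable_fun setT (fun t => 1 + complex.Re (z * cis (f t))).
Proof.
move=> mf; apply: measurable_funD; first exact: measurable_cst.
under eq_fun do rewrite ReM /=.
have mcos : measurable_fun setT (@cos R) by apply: continuous_measurable_fun; exact: continuous_cos.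
have msin : measurable_fun setT (@sin R) by apply: continuous_measurable_fun; exact: continuous_sin.
by apply: measurable_funB; apply: measurable_funM; try exact: measurable_cst;
  [exact: (measurableT_comp mcos)|exact: (measurableT_comp msin)].
Qed.

Lemma integral_weight_cis (a1 a2 a3 : R) (z : R[i]) : (0 < n)%N ->
  (forall x, 0 <= 1 + complex.Re (z * cis x)) ->
  (\int[muG]_y (weight y * (gammaR (n%:R / 2) ^+ 3 +
     complex.Re (z * (cgamma (n%:R / 2) a1 * cgamma (n%:R / 2) a2 * cgamma (n%:R / 2) a3) *
       cis (a1 * ht1 y + a2 * ht2 y + a3 * lheight y))))%:E =
   (Num.sqrt pi ^+ n)%:E * horo_const * (2^-1)%:E * (gammaR (n%:R / 4) ^+ 4 +
     complex.Re (z * (cgamma (n%:R / 4) ((a1 + a2 + a3) / 2) *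
       cgamma (n%:R / 4) ((a1 + a2 - a3) / 2) * cgamma (n%:R / 4) ((a1 - a2 + a3) / 2) *
       cgamma (n%:R / 4) ((- a1 + a2 + a3) / 2))))%:E)%E.
Proof.
move=> n0 z0.
have r0 : 0 < n%:R / 2 :> R by rewrite divr_gt0// ltr0n.
have r4 : 0 < n%:R / 4 :> R by rewrite divr_gt0// ltr0n.
pose K (y : bmx) (s1 s2 s3 : R) : \bar R :=
  ((1 + complex.Re (z * cis (a1 * s1 + a2 * s2 + a3 * s3))) * expR (n%:R / 2 * (s1 + s2 + s3)) *
    horoF s1 s2 s3 (lheight y) (fun i => hcoord i y))%:E.
have mK : measurable_fun setT (fun z : bmx * R * R * R => K z.1.1.1 z.1.1.2 z.1.2 z.2).
  apply/measurable_EFinP; apply: measurable_funM; first apply: measurable_funM.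
  - by apply: measurable_Re_cis; measurability.
  - by apply: measurable_expR_comp; measurability.
  - apply: measurable_horoF; try (by measurability).
      by apply: (measurableT_comp (measurable_lheight)); measurability.
    by move=> i; apply: (measurableT_comp (measurable_hcoord i)); measurability.
have K0 y s1 s2 s3 : (0 <= K y s1 s2 s3)%E by rewrite lee_fin !mulr_ge0 ?expR_ge0.
have := @integral_translate3 R _ bmx muG K mK K0 ht1 ht2 (@lheight R n).
have -> : (\int[muG]_t \int[leb]_x \int[leb]_y \int[leb]_z K t (x + ht1 t)%R (y + ht2 t)%R (z + lheight t)%R)%E =
  (\int[muG]_y (weight y * (gammaR (n%:R / 2) ^+ 3 +
     complex.Re (z * (cgamma (n%:R / 2) a1 * cgamma (n%:R / 2) a2 * cgamma (n%:R / 2) a3) *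
       cis (a1 * ht1 y + a2 * ht2 y + a3 * lheight y))))%:E)%E.
  apply: eq_integral => y _; apply: etrans (@integral_gammaD_cis3 R _ (weight y)
    (a1 * ht1 y + a2 * ht2 y + a3 * lheight y) a1 a2 a3 z r0).
  apply: eq_integral => s1 _; apply: eq_integral => s2 _; apply: eq_integral => s3 _.
  rewrite /K horoF_ht -mulrA mulrC; congr (_ * _)%:E.
    by rewrite /gammaD /weight -!expRD; congr expR; ring.
  by congr (1 + complex.Re (z * cis _)); ring.
move=> ->.
pose C := ((Num.sqrt pi ^+ n)%:E * horo_const)%E.
have C0 : (0 <= C)%E.
  by rewrite mule_ge0 ?lee_fin ?exprn_ge0// integral_ge0// => y _; rewrite lee_fin horo_const_integrand_ge0.
pose g := @gammaD R (n%:R / 4).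
pose K4 (q1 q2 q3 q4 : R) : \bar R := (g q1 * g q2 * g q3 * g q4 *
  (1 + complex.Re (z * cis ((a1 + a2 + a3) / 2 * q1 + (a1 + a2 - a3) / 2 * q2 +
     (a1 - a2 + a3) / 2 * q3 + (- a1 + a2 + a3) / 2 * q4))))%:E.
have K40 q1 q2 q3 q4 : (0 <= K4 q1 q2 q3 q4)%E by rewrite lee_fin !mulr_ge0 ?expR_ge0.
have mg : measurable_fun setT g by exact: continuous_measurable_fun (@continuous_gammaD R _).
have mK4 : measurable_fun setT (fun z : R * R * R * R => K4 z.1.1.1 z.1.1.2 z.1.2 z.2).
  apply/measurable_EFinP; apply: measurable_funM; last by apply: measurable_Re_cis; measurability.
  by do 3?[apply: measurable_funM]; apply: (measurableT_comp mg); measurability.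
rewrite -/C -muleA -(@integral_gammaD_cis4 R _ _ _ _ _ z r4).
have L4 := @integral_linear4 R K4 mK4 K40.
transitivity (C * \int[leb]_x \int[leb]_y \int[leb]_z \int[leb]_q
     K4 q (x + y - q)%R (x + z - q)%R (y + z - q)%R)%E; last exact: (congr1 (fun I => C * I)%E L4).
have E s1 s2 s3 : (\int[muG]_y K y s1 s2 s3 =
    C * \int[leb]_q K4 q (s1 + s2 - q)%R (s1 + s3 - q)%R (s2 + s3 - q)%R)%E.
  transitivity (\int[muG]_y (((1 + complex.Re (z * cis (a1 * s1 + a2 * s2 + a3 * s3))) *
      expR (n%:R / 2 * (s1 + s2 + s3)))%:E * (horoF s1 s2 s3 (lheight y) (fun i => hcoord i y))%:E))%E.
    by apply: eq_integral => y _; rewrite -EFinM.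
  have c0 : 0 <= (1 + complex.Re (z * cis (a1 * s1 + a2 * s2 + a3 * s3))) * expR (n%:R / 2 * (s1 + s2 + s3)).
    by rewrite mulr_ge0 ?expR_ge0.
  rewrite ge0_integralZl//; last 2 first.
  - apply/measurable_EFinP; apply: measurable_horoF; try exact: measurable_cst.
      exact: measurable_lheight.
    exact: measurable_hcoord.
  - by move=> y _; rewrite lee_fin expR_ge0.
  rewrite (integral_horoF _ _ _ n0) -/C muleCA; congr (_ * _)%E.
  rewrite /bessel -ge0_integralZl//; last first.
  - apply/measurable_EFinP; apply: measurable_expR_comp.
    have mE : measurable_fun setT (fun q : R => expR (- q)).
      by apply: continuous_measurable_fun; exact: continuous_expRN.
    apply: measurable_funB; last by apply: measurable_funM; [exact: mE|exact: measurable_cst].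
    apply: measurable_funB; last exact: measurable_expR.
    by apply: measurableT_comp => //; apply: measurable_funM => //; exact: measurable_cst.
  apply: eq_integral => q _; rewrite -EFinM; congr _%:E.
  rewrite /K4 mulrC mulrCA mulrC mulrC [RHS]mulrC -mulrA.
  have -> : (a1 + a2 + a3) / 2 * q + (a1 + a2 - a3) / 2 * (s1 + s2 - q) +
     (a1 - a2 + a3) / 2 * (s1 + s3 - q) + (- a1 + a2 + a3) / 2 * (s2 + s3 - q) =
     a1 * s1 + a2 * s2 + a3 * s3 by field.
  congr (_ * _); rewrite /g /gammaD -!expRD; congr expR.
  by rewrite !expRD; field.
have m4 := measurable_uncurry4 mK4.
have Z (f : R -> \bar R) : measurable_fun setT f -> (forall x, 0 <= f x)%E ->
    (\int[leb]_x (C * f x) = C * \int[leb]_x f x)%E.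
  by move=> mf f0; rewrite ge0_integralZl.
pose F3 s1 s2 s3 := (\int[leb]_q K4 q (s1 + s2 - q)%R (s1 + s3 - q)%R (s2 + s3 - q)%R)%E.
have F30 s1 s2 s3 : (0 <= F3 s1 s2 s3)%E by apply: integral_ge0.
pose F2 s1 s2 := (\int[leb]_s3 F3 s1 s2 s3)%E.
have F20 s1 s2 : (0 <= F2 s1 s2)%E by apply: integral_ge0.
pose F1 s1 := (\int[leb]_s2 F2 s1 s2)%E.
have F10 s1 : (0 <= F1 s1)%E by apply: integral_ge0.
have m3 s1 s2 : measurable_fun setT (F3 s1 s2) by rewrite /F3; measurability_integral; apply: m4; measurability.
have m2 s1 : measurable_fun setT (F2 s1) by rewrite /F2 /F3; do 2 measurability_integral; apply: m4; measurability.
have m1 : measurable_fun setT F1 by rewrite /F1 /F2 /F3; do 3 measurability_integral; apply: m4; measurability.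
apply: etrans (Z _ m1 F10); apply: eq_integral => s1 _.
apply: etrans (Z _ (m2 s1) (F20 s1)); apply: eq_integral => s2 _.
by apply: etrans (Z _ (m3 s1 s2) (F30 s1 s2)); apply: eq_integral => s3 _.
Qed.

End HaarIntegration.

(** * The trilinear form *)

Section CGamma.
Variable R : realType.
Local Notation leb := (@lebesgue_measure R).

Lemma ImM (z w : R[i]) : complex.Im (z * w) = complex.Re z * complex.Im w + complex.Im z * complex.Re w.
Proof. by case: z w => [a b] [c d]. Qed.

Lemma complexP (z w : R[i]) : complex.Re z = complex.Re w -> complex.Im z = complex.Im w -> z = w.
Proof. by case: z w => [a b] [c d] /= -> ->. Qed.

Lemma Re_complexn (m : nat) : complex.Re (m%:R : R[i]) = m%:R.
Proof. by elim: m => [|m IH]//; rewrite -natr1 -[in RHS]natr1 raddfD /= IH. Qed.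

Lemma Im_complexn (m : nat) : complex.Im (m%:R : R[i]) = 0.
Proof. by elim: m => [|m IH]//; rewrite -natr1 raddfD /= IH addr0. Qed.

Lemma complexnE (m : nat) : (m%:R : R[i]) = (m%:R)%:C.
Proof. by apply: complexP; rewrite ?Re_complexn ?Im_complexn. Qed.

Lemma complexnV (m : nat) : (m%:R^-1 : R[i]) = (m%:R^-1)%:C.
Proof. by rewrite complexnE fmorphV. Qed.

Lemma cexpE (z : R[i]) : cexp z = (expR (complex.Re z))%:C * cis (complex.Im z).
Proof. by apply: complexP; rewrite ?ReM ?ImM /cis /= ?mul0r ?subr0 ?addr0. Qed.

Lemma continuous_expR_ln (a : R) (f : R -> R) : continuous f ->
  {in `]0, +oo[, continuous (fun t : R => f (a * ln t))}.
Proof.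
move=> cf t; rewrite in_itv/= andbT => t0.
apply: (@continuous_comp _ _ _ (fun t => a * ln t) f); last exact: cf.
by apply: cvgM; [exact: cvg_cst|exact: continuous_ln].
Qed.

Lemma integral_gamma_exp (a b : R) (h : R -> R) : continuous h ->
  (\int[leb]_(t in `]0%R, +oo[) (expR ((a - 1) * ln t) * h (b * ln t) * expR (- t)) =
   \int[leb]_x (gammaD a x * h (b * x)))%R.
Proof.
move=> ch; rewrite /Rintegral; congr fine.
rewrite (@integral_exp R (fun t => expR ((a - 1) * ln t) * h (b * ln t) * expR (- t))).
  apply: eq_integral => x _; rewrite expRK; congr _%:E.
  have -> : gammaD a x = expR ((a - 1) * x) * expR (- expR x) * expR x.
    by rewrite /gammaD -!expRD; congr expR; ring.
  by ring.
move=> t t0; apply: cvgM.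
  apply: cvgM; first exact: (continuous_expR_ln (@continuous_expR R)).
  exact: continuous_expR_ln.
apply: (@continuous_comp _ _ _ (fun t : R => - t) (@expR R)); first exact: continuousN.
exact: continuous_expR.
Qed.

Lemma cGammaE (a b : R) : cGamma (a +i* b) = cgamma a b.
Proof.
apply: complexP; rewrite /cGamma /cintegral [LHS]/=.
- rewrite -[RHS](@integral_gamma_exp _ _ _ (@continuous_cos R)).
  congr Rintegral; apply/funext => t.
  by rewrite !mulr0 !subr0 add0r.
- rewrite -[RHS](@integral_gamma_exp _ _ _ (@continuous_sin R)).
  congr Rintegral; apply/funext => t.
  by rewrite !mulr0 !subr0 !add0r.
Qed.

Lemma cgamma_neq0 a b : 0 < a -> cgamma a b != 0 :> R[i].
Proof.
move=> a0; apply/eqP => h; have := gammaN_gt0 b a0.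
by rewrite /gammaN; case: h => -> ->; rewrite expr0n addr0 ltxx.
Qed.

End CGamma.

Section TripleForm.
Variables (R : realType) (n : nat).
Hypothesis n_gt0 : (0 < n)%N.
Local Notation mx := 'M[R]_(n + 1 + 1).
Local Notation bmx := (borelMx R n).
Local Notation G := (@Ggrp R n : set bmx).

Lemma n0_oneparam : n0 R n = nmx (1 *: (\col_(i < n) delta0 R i)).
Proof. by rewrite scale1r. Qed.

Lemma Ggrp_n0 (y : mx) : Ggrp y -> Ggrp (n0 R n *m y).
Proof. by rewrite n0_oneparam => Gy; exact: (Ggrp_oneparam 1 (oneparam_nmx _) Gy). Qed.

Lemma logA_w0 (y : mx) : Ggrp y -> logA (w0 R n *m y) = ht2 y.
Proof.
move=> Gy; rewrite logA_lheight; last exact: Ggrp_w0.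
by rewrite /lheight cdif_w0// norm_csum//; exact: Ggrp_O.
Qed.

Lemma logA_w0n0 (y : mx) : Ggrp y -> logA (w0 R n *m n0 R n *m y) = ht1 y.
Proof.
move=> Gy; have Oy := Ggrp_O Gy.
rewrite -mulmxA logA_w0; last exact: Ggrp_n0.
rewrite /ht2 /ht1 lheight_nmx; congr (- ln (_ + _ * _)).
by apply: eq_bigr => i _; rewrite hcoord_nmx// mxE.
Qed.

Lemma powA_rho (y : mx) (a : R) :
  powA y (0 +i* a + rho R n) = (expR (n%:R / 2 * logA y))%:C * cis (a * logA y).
Proof.
rewrite /powA /rho complexnE complexnV -rmorphM cexpE.
by congr ((expR _)%:C * cis _); rewrite /= ?(mul0r, mulr0, addr0, add0r, subr0) mulrC.
Qed.

Lemma triple_integrand (a1 a2 a3 : R) (y : mx) : Ggrp y ->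
  powA (w0 R n *m n0 R n *m y) (0 +i* a1 + rho R n) *
  powA (w0 R n *m y) (0 +i* a2 + rho R n) * powA y (0 +i* a3 + rho R n) =
  (weight y)%:C * cis (a1 * ht1 y + a2 * ht2 y + a3 * lheight y).
Proof.
move=> Gy; rewrite !powA_rho logA_w0n0// logA_w0// logA_lheight// /weight !mulrDr !expRD !rmorphM !cisD.
by ring.
Qed.

Variable mu : {measure set bmx -> \bar R}.
Hypothesis haar : is_haar mu.

Definition tconst : R := Num.sqrt pi ^+ n * fine (horo_const mu) / 2.

Lemma tconst_gt0 : 0 < tconst.
Proof.
rewrite /tconst divr_gt0// mulr_gt0 ?exprn_gt0 ?sqrtr_gt0 ?pi_gt0//.
by rewrite fine_gt0// horo_const_gt0// horo_const_lty.
Qed.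

(* The identity of [integral_weight_cis] is linear in z; it is used for z = 0,
   which gives integrability, and for z = 1 and z = - i, where the integrand is
   still nonnegative, so that Tonelli suffices throughout. *)
Lemma Tst_cgamma (a1 a2 a3 : R) :
  Tst mu (0 +i* a1) (0 +i* a2) (0 +i* a3) *
    (cgamma (n%:R / 2) a1 * cgamma (n%:R / 2) a2 * cgamma (n%:R / 2) a3) =
  tconst%:C * (cgamma (n%:R / 4) ((a1 + a2 + a3) / 2) *
       cgamma (n%:R / 4) ((a1 + a2 - a3) / 2) * cgamma (n%:R / 4) ((a1 - a2 + a3) / 2) *
       cgamma (n%:R / 4) ((- a1 + a2 + a3) / 2)).
Proof.
set W := _ * _ * cgamma _ a3; set P := _ * cgamma _ ((- a1 + a2 + a3) / 2).
pose th (y : bmx) := a1 * ht1 y + a2 * ht2 y + a3 * lheight y.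
have r0 : 0 < n%:R / 2 :> R by rewrite divr_gt0// ltr0n.
have g3 : 0 < gammaR (n%:R / 2) ^+ 3 :> R by rewrite exprn_gt0// gammaR_gt0.
have mG := @measurable_Ggrp R n.
have mth : measurable_fun setT th.
  by do 2?[apply: measurable_funD]; apply: measurable_funM; try exact: measurable_cst;
    [exact: measurable_ht1|exact: measurable_ht2|exact: measurable_lheight].
have mw : measurable_fun setT (fun y : bmx => weight y).
  apply: measurable_expR_comp; apply: measurable_funM; first exact: measurable_cst.
  by do 2?[apply: measurable_funD]; [exact: measurable_ht1|exact: measurable_ht2|exact: measurable_lheight].
pose I (z : R[i]) := (\int[mu]_(y in G) (weight y *
  (gammaR (n%:R / 2) ^+ 3 + complex.Re (z * W * cis (th y))))%:E)%E.
have IE z : (forall x, 0 <= 1 + complex.Re (z * cis x)) ->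
    I z = (tconst * (gammaR (n%:R / 4) ^+ 4 + complex.Re (z * P)))%:E.
  move=> z0; have fin : horo_const mu \is a fin_num.
    by rewrite ge0_fin_numE ?horo_const_lty// ltW// horo_const_gt0.
  have pos y : 0 <= gammaR (n%:R / 2) ^+ 3 + complex.Re (z * W * cis (th y)).
    rewrite -lee_fin -[X in (_ <= X%:E)%E]mul1r -(@integral_gammaD_cis3 R _ 1 _ _ _ _ _ r0).
    do 3!apply: integral_ge0 => ? _.
    by rewrite lee_fin !mulr_ge0 ?gammaD_ge0.
  rewrite /I integral_muG; last 2 first.
  - apply/measurable_EFinP; apply: measurable_funM => //.
    have := @measurable_Re_cis R _ _ (z * W) th mth.
    move=> /(measurable_funD (measurable_cst (gammaR (n%:R / 2) ^+ 3 - 1))).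
    by congr measurable_fun; apply/funext => y /=; ring.
  - by move=> y; rewrite lee_fin mulr_ge0 ?expR_ge0.
  rewrite (integral_weight_cis haar _ _ _ n_gt0 z0) -(fineK fin) -!EFinM; congr _%:E.
have Re0 : complex.Re (0 : R[i]) = 0 by [].
have C1 (x : R) : 0 <= 1 + complex.Re (1 * cis x).
  by rewrite mul1r /=; have := cos_geN1 x; lra.
have C2 (x : R) : 0 <= 1 + complex.Re ((0 -i* 1) * cis x).
  by rewrite ReM /=; have := sin_geN1 x; lra.
have C3 (x : R) : 0 <= 1 + complex.Re (0 * cis x) by rewrite mul0r addr0.
have iw : mu.-integrable G (EFin \o (fun y : bmx => weight y)).
  apply/integrableP; split; first by apply: measurable_funTS; apply/measurable_EFinP.
  under eq_integral => y _ do rewrite gee0_abs ?lee_fin ?expR_ge0//.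
  have : (\int[mu]_(y in G) ((gammaR (n%:R / 2) ^+ 3)%:E * (weight y)%:E) =
      (tconst * gammaR (n%:R / 4) ^+ 4)%:E)%E.
    have := IE 0 C3; rewrite (mul0r P) Re0 addr0 => <-.
    by apply: eq_integral => y _; rewrite !mul0r Re0 addr0 -EFinM (mulrC (weight y)).
  rewrite ge0_integralZl//; last 3 first.
  - by apply: measurable_funTS; apply/measurable_EFinP.
  - by move=> y _; rewrite lee_fin expR_ge0.
  - by rewrite lee_fin ltW.
  by rewrite ltey => e; apply/eqP => h; move: e; rewrite h gt0_muley ?lte_fin.
have mcos : measurable_fun setT (fun y : bmx => cos (th y)).
  by apply: (measurableT_comp _ mth); apply: continuous_measurable_fun; exact: continuous_cos.
have msin : measurable_fun setT (fun y : bmx => sin (th y)).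
  by apply: (measurableT_comp _ mth); apply: continuous_measurable_fun; exact: continuous_sin.
have iwM (h : bmx -> R) : measurable_fun setT h -> (forall y, `|h y| <= 1) ->
    mu.-integrable G (EFin \o (fun y : bmx => weight y * h y)).
  move=> mh h1; apply: le_integrable iw => //.
    by apply: measurable_funTS; apply/measurable_EFinP; exact: measurable_funM.
  by move=> y _ /=; rewrite lee_fin normrM ler_piMr.
have ic := iwM _ mcos (fun y => cos_max (th y)).
have is_ := iwM _ msin (fun y => sin_max (th y)).
have ET : Tst mu (0 +i* a1) (0 +i* a2) (0 +i* a3) =
    (\int[mu]_(y in G) (weight y * cos (th y)))%R +i* (\int[mu]_(y in G) (weight y * sin (th y)))%R.
  rewrite /Tst /cintegral; congr (_ +i* _); apply: eq_Rintegral => y; rewrite inE => Gy;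
    rewrite triple_integrand//= mul0r ?subr0 ?addr0//.
set T := Tst _ _ _ _ in ET *.
pose w0 := (\int[mu]_(y in G) weight y)%R.
have IL z : I z = (gammaR (n%:R / 2) ^+ 3 * w0 + complex.Re (z * (T * W)))%:E.
  pose u := complex.Re (z * W); pose v := complex.Im (z * W).
  transitivity (\int[mu]_(y in G) ((gammaR (n%:R / 2) ^+ 3)%:E * (weight y)%:E +
      (u%:E * (weight y * cos (th y))%:E - v%:E * (weight y * sin (th y))%:E)))%E.
    apply: eq_integral => y _; rewrite -!EFinM -EFinB -EFinD; congr _%:E.
    by rewrite ReM /= -/u -/v; ring.
  have I1 := integrableZl mG (gammaR (n%:R / 2) ^+ 3) iw.
  have I2 := integrableZl mG u ic.
  have I3 := integrableZl mG v is_.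
  have I4 := integrableB mG I2 I3.
  rewrite (integralD mG I1 I4) (integralB mG I2 I3).
  rewrite (integralZl mG iw) (integralZl mG ic) (integralZl mG is_).
  have F f : mu.-integrable G (EFin \o f) -> (\int[mu]_(x in G) (EFin \o f) x = (\int[mu]_(x in G) f x)%:E)%E.
    by move=> If; rewrite /Rintegral fineK// integrable_fin_num.
  rewrite (F _ iw) (F _ ic) (F _ is_) -!EFinM -EFinB -EFinD; congr _%:E.
  have -> : z * (T * W) = z * W * T by ring.
  by rewrite [in RHS]ReM ET /= -/u -/v -/w0; ring.
have e z hz := EFin_inj (etrans (esym (IL z)) (IE z hz)).
have := e _ C3; rewrite mul0r (mul0r P) Re0 !addr0 => e0.
have e1 : complex.Re (T * W) = tconst * complex.Re P.
  by have := e _ C1; rewrite e0 (mulrDr tconst) (mul1r (T * W)) (mul1r P) => /addrI.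
have e2 : complex.Re ((0 -i* 1) * (T * W)) = tconst * complex.Re ((0 -i* 1) * P).
  by have := e _ C2; rewrite e0 (mulrDr tconst) => /addrI.
apply: complexP; first by rewrite e1 [RHS]ReM /= mul0r subr0.
have ReI (z : R[i]) : complex.Re ((0 -i* 1) * z) = complex.Im z.
  by rewrite ReM [complex.Re (0 -i* 1)]/= [complex.Im (0 -i* 1)]/= mul0r sub0r mulN1r opprK.
by rewrite -ReI e2 ReI [RHS]ImM [complex.Re _%:C]/= [complex.Im _%:C]/= mul0r addr0.
Qed.

End TripleForm.

Section Asymptotics.
Variable R : realType.

Lemma ln_le_subr1 (x : R) : 0 < x -> ln x <= x - 1.
Proof. by move=> x0; have := @le_ln1Dx R (x - 1); rewrite [1 + _]addrC subrK; apply; lra. Qed.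

Lemma ln_div_le (u v : R) : 0 < u -> 0 < v -> ln u - ln v <= (u - v) / v.
Proof.
move=> u0 v0; rewrite -ln_div ?posrE// mulrBl divff ?gt_eqF//.
by apply: ln_le_subr1; rewrite divr_gt0.
Qed.

Lemma norm_expRB1 (x : R) : `|expR x - 1| <= `|x| * expR `|x|.
Proof.
have h := expR_ge1Dx x; have h' := expR_ge1Dx (- x).
have e : expR x * expR (- x) = 1 by rewrite -expRD subrr expR0.
have p := expR_gt0 x; have [x0|x0] := leP 0 x.
  rewrite ger0_norm; last by lra.
  by rewrite ger0_norm//; nra.
rewrite (ltr0_norm x0) ler0_norm; last by rewrite subr_le0 -[leRHS]expR0 ler_expR ltW.
have q : 1 <= expR (- x) by rewrite -[leLHS]expR0 ler_expR; lra.
by nra.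
Qed.

Lemma stirling_shift (a B : R) : 0 < a -> 0 <= B -> exists c C : R, forall S b : R,
  2 * B + 8 <= S -> `| `|b| - S / 2| <= B / 2 ->
  `|ln (gammaN a b) - (c + (2 * a - 1) * ln S - pi * `|b|)| <= C / S.
Proof.
move=> a0 B0; have [c [C H]] := stirling a0.
exists (c - (2 * a - 1) * ln 2), (4 * `|C| + `|2 * a - 1| * (2 * B)) => S b hS.
rewrite ler_norml => /andP[b1 b2].
have S0 : 0 < S by lra.
have bS : S / 4 <= `|b| by lra.
have b_gt0 : 0 < `|b| by lra.
have L : `|ln `|b| - (ln S - ln 2)| <= 2 * B / S.
  rewrite -ln_div ?posrE// ler_norml; apply/andP; split.
    have := @ln_div_le (S / 2) `|b| _ b_gt0; rewrite divr_gt0// => /(_ isT).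
    have : (S / 2 - `|b|) / `|b| <= 2 * B / S.
      rewrite ler_pdivrMr//; apply: (@le_trans _ _ (B / 2)); first by lra.
      apply: (@le_trans _ _ (2 * B / S * (S / 4))); first by rewrite le_eqVlt; apply/orP; left; apply/eqP; field; rewrite gt_eqF.
      by rewrite ler_wpM2l// divr_ge0//; lra.
    by lra.
  have := @ln_div_le `|b| (S / 2) b_gt0; rewrite divr_gt0// => /(_ isT).
  have : (`|b| - S / 2) / (S / 2) <= 2 * B / S.
    rewrite ler_pdivrMr ?divr_gt0//; apply: (@le_trans _ _ B); first by lra.
    by rewrite le_eqVlt; apply/orP; left; apply/eqP; field; rewrite gt_eqF.
  by lra.
have Hb : `|ln (gammaN a b) - (c + (2 * a - 1) * ln `|b| - pi * `|b|)| <= 4 * `|C| / S.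
  apply: le_trans (H b _) _; first by lra.
  rewrite ler_pdivrMr//; apply: le_trans (ler_norm C) _.
  apply: (@le_trans _ _ (4 * `|C| / S * (S / 4))); first by rewrite le_eqVlt; apply/orP; left; apply/eqP; field; rewrite gt_eqF.
  by rewrite ler_wpM2l// divr_ge0 ?mulr_ge0// ltW.
have -> : ln (gammaN a b) - (c - (2 * a - 1) * ln 2 + (2 * a - 1) * ln S - pi * `|b|) =
  (ln (gammaN a b) - (c + (2 * a - 1) * ln `|b| - pi * `|b|)) + (2 * a - 1) * (ln `|b| - (ln S - ln 2)).
  by ring.
apply: le_trans (ler_normD _ _) _; rewrite [leRHS]mulrDl; apply: lerD => //.
by rewrite normrM -[leRHS]mulrA ler_wpM2l.
Qed.

Lemma sum4_norm (s m k : R) : `|m| + `|k| <= `|s| ->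
  `|(s + m + k) / 2| + `|(s + m - k) / 2| + `|(s - m + k) / 2| + `|(- s + m + k) / 2| = 2 * `|s| /\
  forall t, t \in [:: (s + m + k) / 2; (s + m - k) / 2; (s - m + k) / 2; (- s + m + k) / 2] ->
    `| `|t| - `|s| / 2| <= (`|m| + `|k|) / 2.
Proof.
move=> h; have := ler_norm m; have := ler_norm k; have := ler_norm (- m); have := ler_norm (- k).
rewrite !normrN => k1 m1 k2 m2.
have [s0|s0] := leP 0 s.
  rewrite (ger0_norm s0) in h *.
  have e1 : `|(s + m + k) / 2| = (s + m + k) / 2 by rewrite ger0_norm//; lra.
  have e2 : `|(s + m - k) / 2| = (s + m - k) / 2 by rewrite ger0_norm//; lra.
  have e3 : `|(s - m + k) / 2| = (s - m + k) / 2 by rewrite ger0_norm//; lra.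
  have e4 : `|(- s + m + k) / 2| = - ((- s + m + k) / 2) by rewrite ler0_norm//; lra.
  split; first by rewrite e1 e2 e3 e4; field.
  by move=> t; rewrite !inE => /or4P[] /eqP ->; rewrite ?e1 ?e2 ?e3 ?e4 ler_norml; lra.
rewrite (ltr0_norm s0) in h *.
have e1 : `|(s + m + k) / 2| = - ((s + m + k) / 2) by rewrite ler0_norm//; lra.
have e2 : `|(s + m - k) / 2| = - ((s + m - k) / 2) by rewrite ler0_norm//; lra.
have e3 : `|(s - m + k) / 2| = - ((s - m + k) / 2) by rewrite ler0_norm//; lra.
have e4 : `|(- s + m + k) / 2| = (- s + m + k) / 2 by rewrite ger0_norm//; lra.
split; first by rewrite e1 e2 e3 e4; field.
by move=> t; rewrite !inE => /or4P[] /eqP ->; rewrite ?e1 ?e2 ?e3 ?e4 ler_norml; lra.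
Qed.

Lemma normc_cgamma (a b : R) : Normc.normc (cgamma a b) = Num.sqrt (gammaN a b).
Proof. by []. Qed.

Lemma normc_cgamma_ln (a b : R) : 0 < a ->
  Normc.normc (cgamma a b) = expR (ln (gammaN a b) / 2).
Proof.
move=> a0; rewrite normc_cgamma -[in LHS](lnK (x := gammaN a b)) ?posrE ?gammaN_gt0//.
rewrite -[X in Num.sqrt (expR X)](mulfVK (x := 2))// mulrC expRM_natl sqrtr_sqr ger0_norm ?expR_ge0//.
Qed.

Lemma normc_real (x : R) : 0 <= x -> Normc.normc (x%:C) = x.
Proof. by move=> x0; rewrite /= expr0n addr0 sqrtr_sqr ger0_norm. Qed.

Lemma normc_imaginary (x : R) : Normc.normc (0 +i* x) = `|x|.
Proof. by rewrite /= expr0n add0r sqrtr_sqr. Qed.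

Lemma gamma_ratio_asymptotics (r m k K : R) (T : R -> R) : 0 < r -> 0 < K ->
  (forall s, T s = K * expR ((ln (gammaN r ((s + m + k) / 2)) + ln (gammaN r ((s + m - k) / 2)) +
    ln (gammaN r ((s - m + k) / 2)) + ln (gammaN r ((- s + m + k) / 2)) - ln (gammaN (2 * r) s)) / 2)) ->
  exists c : R, 0 < c /\ exists M C : R, 0 < M /\ forall s, M <= `|s| ->
    exists e, `|e| <= C / `|s| /\
      T s = c * expR (- (pi / 2) * `|s|) * (`|s| `^ (2 * r - 3 / 2)) * (1 + e).
Proof.
move=> r0 K0 HT; pose B := `|m| + `|k|.
have B0 : 0 <= B by rewrite addr_ge0.
have [c1 [C1 H1]] := stirling_shift r0 B0.
have r20 : 0 < 2 * r by rewrite mulr_gt0.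
have [c2 [C2 H2]] := stirling r20.
pose E := (4 * `|C1| + `|C2|) / 2.
have E0 : 0 <= E by rewrite divr_ge0// addr_ge0// mulr_ge0.
exists (K * expR ((4 * c1 - c2) / 2)); split; first by rewrite mulr_gt0 ?expR_gt0.
exists (2 * B + 8), (E * expR E); split; first by lra.
move=> s hs; have S0 : 0 < `|s| by lra.
have [|h4 hb] := @sum4_norm s m k; first by rewrite -/B; lra.
have G1 t : t \in [:: (s + m + k) / 2; (s + m - k) / 2; (s - m + k) / 2; (- s + m + k) / 2] ->
    `|ln (gammaN r t) - (c1 + (2 * r - 1) * ln `|s| - pi * `|t|)| <= `|C1| / `|s|.
  move=> /hb/(H1 _ _ hs)/le_trans; apply.
  by rewrite ler_pM2r ?invr_gt0// ler_norm.
have G2 : `|ln (gammaN (2 * r) s) - (c2 + (2 * (2 * r) - 1) * ln `|s| - pi * `|s|)| <= `|C2| / `|s|.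
  have s2 : 2 <= `|s| by lra.
  by apply: le_trans (H2 _ s2) _; rewrite ler_pM2r ?invr_gt0// ler_norm.
have := G1 ((s + m + k) / 2); have := G1 ((s + m - k) / 2).
have := G1 ((s - m + k) / 2); have := G1 ((- s + m + k) / 2).
rewrite !inE !eqxx !orbT => /(_ isT) g4 /(_ isT) g3 /(_ isT) g2 /(_ isT) g1.
move: (HT s) g1 g2 g3 g4 G2 h4.
move: (ln (gammaN r ((s + m + k) / 2))) (ln (gammaN r ((s + m - k) / 2))) (ln (gammaN r ((s - m + k) / 2)))
  (ln (gammaN r ((- s + m + k) / 2))) (ln (gammaN (2 * r) s)) => x1 x2 x3 x4 x5.
move: `|(s + m + k) / 2| `|(s + m - k) / 2| `|(s - m + k) / 2| `|(- s + m + k) / 2| => t1 t2 t3 t4.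
move=> -> g1 g2 g3 g4 g5 ht.
pose x := (x1 + x2 + x3 + x4 - x5) / 2 - ((4 * c1 - c2) / 2 + (2 * r - 3 / 2) * ln `|s| - pi / 2 * `|s|).
have xE : `|x| <= E / `|s|.
  have -> : x = ((x1 - (c1 + (2 * r - 1) * ln `|s| - pi * t1)) + (x2 - (c1 + (2 * r - 1) * ln `|s| - pi * t2)) +
    (x3 - (c1 + (2 * r - 1) * ln `|s| - pi * t3)) + (x4 - (c1 + (2 * r - 1) * ln `|s| - pi * t4)) -
    (x5 - (c2 + (2 * (2 * r) - 1) * ln `|s| - pi * `|s|))) / 2.
    have -> : t4 = 2 * `|s| - t1 - t2 - t3 by rewrite -ht; ring.
    by rewrite /x; field.
  have -> : E / `|s| = (`|C1| / `|s| + `|C1| / `|s| + `|C1| / `|s| + `|C1| / `|s| + `|C2| / `|s|) / 2.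
    by rewrite /E; field; rewrite gt_eqF.
  rewrite normrM [`|2^-1|]ger0_norm// ler_pM2r//.
  apply: le_trans (ler_normB _ _) _; apply: lerD g5.
  apply: le_trans (ler_normD _ _) _; apply: lerD g4.
  apply: le_trans (ler_normD _ _) _; apply: lerD g3.
  by apply: le_trans (ler_normD _ _) _; apply: lerD g2.
exists (expR x - 1); split.
  apply: le_trans (norm_expRB1 _) _.
  rewrite mulrAC; apply: ler_pM; rewrite ?expR_ge0// ler_expR.
  apply: le_trans xE _; rewrite ler_pdivrMr// ler_peMr//; lra.
rewrite [1 + _]addrC subrK /powR gt_eqF// -!mulrA; congr (_ * _).
by rewrite -!expRD; congr expR; rewrite /x; field.
Qed.

End Asymptotics.

Lemma gammaQuot_cgamma (R : realType) (n : nat) (a1 a2 a3 : R) : (0 < n)%N ->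
  gammaQuot n (0 +i* a1) (0 +i* a2) (0 +i* a3) =
  (cgamma (n%:R / 4) ((a1 + a2 + a3) / 2) * cgamma (n%:R / 4) ((a1 + a2 - a3) / 2) *
   cgamma (n%:R / 4) ((a1 - a2 + a3) / 2) * cgamma (n%:R / 4) ((- a1 + a2 + a3) / 2)) /
  (cgamma (n%:R / 2) a1 * cgamma (n%:R / 2) a2 * cgamma (n%:R / 2) a3).
Proof.
move=> n0.
have E4 (b : R) : (2 * (0 +i* b) + n%:R) / 4 = (n%:R / 4) +i* (b / 2) :> R[i].
  rewrite !complexnE -fmorphV; apply: complexP => /=.
    by field.
  by field.
have E2 (b : R) : (2 * (0 +i* b) + n%:R) / 2 = (n%:R / 2) +i* b :> R[i].
  rewrite !complexnE -fmorphV; apply: complexP => /=.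
    by field.
  by field.
have D (b c : R) : (0 +i* b) + (0 +i* c) = 0 +i* (b + c) :> R[i] by apply: complexP => /=; rewrite ?addr0.
have O (b : R) : - (0 +i* b) = 0 +i* (- b) :> R[i] by apply: complexP => /=; rewrite ?oppr0.
rewrite /gammaQuot !(D, O, E4, E2) !cGammaE.
by congr (_ / _); ring.
Qed.

Theorem theorem3p1 (R : realType) (d n : nat) (d_ge2 : (2 <= d)%N)
    (n_def : n = (d - 1)%N)
    (dy : {measure set (borelMx R n) -> \bar R}) (dy_haar : is_haar dy) :
  (exists c : R, 0 < c /\
    forall lam mu nu : R[i], imaginary lam -> imaginary mu -> imaginary nu ->
      Tst dy lam mu nu = c%:C * gammaQuot n lam mu nu) /\
  (forall mu nu : R[i], imaginary mu -> imaginary nu ->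
    exists c : R, 0 < c /\
    exists M C : R, 0 < M /\
    forall lam : R[i], imaginary lam -> M <= Normc.normc lam ->
      exists e : R, `|e| <= C / Normc.normc lam /\
        Normc.normc (Tst dy lam mu nu) =
          c * expR (- (pi / 2) * Normc.normc lam)
            * (Normc.normc lam `^ (d%:R / 2 - 2)) * (1 + e)).
Proof.
have n0 : (0 < n)%N by rewrite n_def subn_gt0.
have dE : d%:R = n%:R + 1 :> R by rewrite n_def natrB ?subrK// ltnW.
have r0 : 0 < n%:R / 4 :> R by rewrite divr_gt0// ltr0n.
have r2 : 0 < n%:R / 2 :> R by rewrite divr_gt0// ltr0n.
have HT (a1 a2 a3 : R) : Tst dy (0 +i* a1) (0 +i* a2) (0 +i* a3) =
    (tconst dy)%:C * gammaQuot n (0 +i* a1) (0 +i* a2) (0 +i* a3).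
  rewrite gammaQuot_cgamma// mulrA -(Tst_cgamma n0 dy_haar) mulfK//.
  by rewrite !mulf_neq0 ?cgamma_neq0.
have imagE (z : R[i]) : imaginary z -> z = 0 +i* complex.Im z by move=> z0; apply: complexP.
have c0 := tconst_gt0 n0 dy_haar.
split.
  exists (tconst dy); split=> // lam mu nu /imagE -> /imagE -> /imagE ->; exact: HT.
move=> mu nu /imagE -> /imagE ->; move: (complex.Im mu) (complex.Im nu) => m k.
pose K := tconst dy / (Normc.normc (cgamma (n%:R / 2) m) * Normc.normc (cgamma (n%:R / 2) k)).
have K0 : 0 < K by rewrite /K divr_gt0// !normc_cgamma_ln// mulr_gt0// expR_gt0.
have [] := @gamma_ratio_asymptotics R (n%:R / 4) m k K
  (fun s => Normc.normc (Tst dy (0 +i* s) (0 +i* m) (0 +i* k))) r0 K0.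
  move=> s; rewrite HT gammaQuot_cgamma// !(Normc.normcM, Normc.normcV) normc_real ?ltW//.
  have -> : 2 * (n%:R / 4) = n%:R / 2 :> R by field.
  have N4 b := normc_cgamma_ln b r0; have N2 b := normc_cgamma_ln b r2.
  rewrite (N2 s) (N4 ((s + m + k) / 2)) (N4 ((s + m - k) / 2)) (N4 ((s - m + k) / 2)) (N4 ((- s + m + k) / 2)).
  have -> (x1 x2 x3 x4 x5 : R) : (x1 + x2 + x3 + x4 - x5) / 2 = x1 / 2 + x2 / 2 + x3 / 2 + x4 / 2 - x5 / 2 by field.
  have := expR_gt0 (ln (gammaN (n%:R / 2) s) / 2).
  rewrite !expRD expRN /K (N2 m) (N2 k).
  have := expR_gt0 (ln (gammaN (n%:R / 2) m) / 2); have := expR_gt0 (ln (gammaN (n%:R / 2) k) / 2).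
  move: (expR _) (expR _) (expR _) (expR _) (expR _) (expR _) (expR _) => e1 e2 e3 e4 e5 e6 e7.
  by move=> e1_gt0 e2_gt0 e3_gt0; field; rewrite !gt_eqF.
move=> c [c_gt0 [M [C [M0 H]]]]; exists c; split=> //; exists M, C; split=> //.
move=> lam /imagE ->; rewrite normc_imaginary => /H [e [he ->]].
exists e; split=> //; congr (_ * _ `^ _ * _); rewrite dE.
by field.
Qed.
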